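(* A submanifold $\iota:N\hookrightarrow M$ of a generalized Kähler manifold $M$, with associated classical complex structures $J_+,J_-$, is a generalized Kähler submanifold if and only if $N$ is a complex submanifold of both complex manifolds $(M,J_+)$ and $(M,J_-)$.
   Context: Everything is $C^\infty$. For a finite-dimensional real vector space $W$ put $\mathbf{W}=W\oplus W^*$ with $g((X,\alpha),(Y,\mu))=\frac12(\alpha(Y)+\mu(X))$; the superscript $c$ denotes complexification, and tensors and maps are extended complex-linearly. A linear generalized complex structure on $W$ is $\mathcal{J}\in\mathrm{End}(\mathbf W)$, $\mathcal{J}^2=-\mathrm{Id}$, $g$-skew-symmetric. A generalized (Euclidean) metric on $W$ is a Euclidean metric $G$ on $\mathbf W$ for which there is a decomposition $\mathbf{W}=W_+\oplus W_-$ with $W_\pm$ maximal $g$-positive, respectively $g$-negative, $W_+\perp_g W_-$, $W_+\perp_G W_-$, $G|_{W_\pm}=\pm2g|_{W_\pm}$; $H$ is the endomorphism equal to $\pm\mathrm{Id}$ on $W_\pm$ (so $G(\cdot,\cdot)=2g(H\cdot,\cdot)$). One has $W_\pm=\{(X,\flat_{\psi\pm\gamma}X): X\in W\}$ for a unique pair $(\gamma,\psi)$, $\gamma$ a positive definite metric and $\psi\in\wedge^2W^*$, where $\flat_\theta X=\theta(X,\cdot)$; $\tau_\pm X=(X,\flat_{\psi\pm\gamma}X)$. A generalized Hermitian structure $(G,\mathcal{J})$ on $W$ is a generalized metric $G$ and a generalized complex structure $\mathcal J$ commuting with $H$; then $\mathcal{J}'=H\circ\mathcal{J}$ is a second generalized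 complex structure. With $L$ the $i$-eigenspace of $\mathcal J$, put $L_\pm=L\cap W_\pm^c$. The structure is equivalent to the decomposition $\mathbf{W}^c=L_+\oplus L_-\oplus\bar L_+\oplus\bar L_-$ such that (i) $L_+\oplus L_-$ and $L_+\oplus\bar L_-$ are Dirac (maximal $g$-isotropic) subspaces (the $i$-eigenspaces of $\mathcal J$, $\mathcal J'$), (ii) $L_+\oplus\bar L_+$ and $L_-\oplus\bar L_-$ are the complexifications of the $\pm1$-eigenspaces of the product structure $H$ of a generalized metric. The projections to $W$ of $\mathcal J|_{W_\pm}$ are the $\gamma$-compatible complex structures $J_\pm=pr_W\circ\mathcal{J}\circ\tau_\pm$ on $W$. An almost generalized Hermitian structure on a manifold $M$ is a smooth field of such structures on the tangent spaces. It is generalized Kähler if $\mathcal J$ and $\mathcal J'$ are both integrable, i.e. the sections of their $i$-eigenbundles are closed under the Courant bracket $[(X,\alpha),(Y,\mu)]=([X,Y],L_X\mu-L_Y\alpha+\frac12d(\alpha(Y)-\mu(X)))$; in that case $J_\pm$ are integrable. For a linear map $f_*:V\to W$, the pullback of $U\subseteq\mathbf{W}^c$ is $\overleftarrow f^*U=\{(X,f^*\eta):(f_*X,\eta)\in U\}$. A subspace $\iota_*:V\subseteq W$ of a generalized Hermitian space is a generalized Hermitian subspace if $\overleftarrow\iota^*L_\pm$ define a generalized Hermitian structure on $V$ (i.e. satisfy the decomposition conditions above for $V$), called the induced structure. A submanifold $\iota:N\hookrightarrow M$ is a generalized almost Hermitian submanifold if each $T_xN$ is a generalized Hermitian subspace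 of $T_xM$ and the pullbacks of $L_\pm$ are smooth subbundles of $(TN\oplus T^*N)^c$. It is a generalized Kähler submanifold if moreover the induced structure is generalized Kähler. $N$ is a complex submanifold of $(M,J_\pm)$ if $J_\pm(TN)=TN$. *)

(* Defs.v *)
From HB Require Import structures.
From mathcomp Require Import all_boot all_order all_algebra.
From mathcomp Require Import all_classical all_reals all_analysis.
From mathcomp.real_closed Require Import complex.

Set Implicit Arguments.
Unset Strict Implicit.
Unset Printing Implicit Defensive.

Import Order.TTheory GRing.Theory Num.Theory.
Import numFieldNormedType.Exports.

Local Open Scope classical_set_scope.
Local Open Scope ring_scope.

(* Conventions for W = R^m.  Vectors and covectors are row vectors (a covector
   alpha acts by X |-> X *m alpha^T), an element (X, alpha) of the space
   W (+) W^* is [row_mx X alpha] : 'rV_(m + m), linear maps act by right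
   multiplication ([v *m A] is A(v), so A o B is B *m A), a bilinear form b is
   the matrix with b(u, v) = u *m b *m v^T, and a subspace is the row space of
   a matrix, compared with [:=:] and [<=] in scope MS. *)

Notation toC A := (map_mx (real_complex _) A).
Notation conjmx A := (map_mx conjc A).

Definition gform (F : fieldType) (m : nat) (u v : 'rV[F]_(m + m)) : F :=
  2^-1 * (lsubmx v *m (rsubmx u)^T + lsubmx u *m (rsubmx v)^T) 0 0.

Definition gen_complex (R : realType) (m : nat) (J : 'M[R]_(m + m)) : Prop :=
  J *m J = - 1%:M /\
  forall u v : 'rV[R]_(m + m), gform (u *m J) v = - gform u (v *m J).

Definition gdefinite (R : realType) (m : nat) (e : R) (A : 'M[R]_(m + m)) :
    Prop :=
  forall u : 'rV[R]_(m + m), (u <= A)%MS -> u != 0 -> 0 < e * gform u u.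

(* e = 1: maximal g-positive; e = -1: maximal g-negative *)
Definition max_gdefinite (R : realType) (m : nat) (e : R)
    (A : 'M[R]_(m + m)) : Prop :=
  gdefinite e A /\
  forall B : 'M[R]_(m + m), gdefinite e B -> (A <= B)%MS -> (B <= A)%MS.

Definition bilin (F : fieldType) (n : nat) (b : 'M[F]_n) (u v : 'rV[F]_n) : F :=
  (u *m b *m v^T) 0 0.

Definition euclidean (R : realType) (n : nat) (b : 'M[R]_n) : Prop :=
  b^T = b /\ forall u : 'rV[R]_n, u != 0 -> 0 < bilin b u u.

Definition gen_metric_split (R : realType) (m : nat)
    (G Wp Wm : 'M[R]_(m + m)) : Prop :=
  [/\ (Wp + Wm == 1%:M)%MS && mxdirect (Wp + Wm),
      max_gdefinite 1 Wp,
      max_gdefinite (- 1) Wm &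
      forall u v : 'rV[R]_(m + m),
        [/\ (u <= Wp)%MS -> (v <= Wm)%MS -> gform u v = 0,
            (u <= Wp)%MS -> (v <= Wm)%MS -> bilin G u v = 0,
            (u <= Wp)%MS -> (v <= Wp)%MS -> bilin G u v = 2 * gform u v &
            (u <= Wm)%MS -> (v <= Wm)%MS -> bilin G u v = - 2 * gform u v]].

Definition gen_metric (R : realType) (m : nat) (G : 'M[R]_(m + m)) : Prop :=
  euclidean G /\ exists Wp Wm, gen_metric_split G Wp Wm.

(* The matrix block_mx 0 1 1 0 is that of 2g, and is its own inverse, so this
   is the solution H of G(u, v) = 2 g(H u, v); see [gen_metric_opP]. *)
Definition gen_metric_op (R : realType) (m : nat) (G : 'M[R]_(m + m)) :
    'M[R]_(m + m) :=
  G *m block_mx 0 1%:M 1%:M 0.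

Lemma gform_bilin (R : realType) (m : nat) (u v : 'rV[R]_(m + m)) :
  2 * gform u v = bilin (block_mx 0 1%:M 1%:M 0) u v.
Proof.
rewrite /gform /bilin mulrA divff ?pnatr_eq0// mul1r.
rewrite -[in RHS](hsubmxK u) -[in RHS](hsubmxK v) mul_row_block.
rewrite !mulmx0 !mulmx1 addr0 add0r tr_row_mx mul_row_col addrC.
rewrite !mxE addrC; congr (_ + _); apply: eq_bigr => i _.
by rewrite !mxE mulrC.
Qed.

Lemma gen_metric_opP (R : realType) (m : nat) (G Wp Wm : 'M[R]_(m + m)) :
  euclidean G -> gen_metric_split G Wp Wm -> forall u : 'rV[R]_(m + m),
  ((u <= Wp)%MS -> u *m gen_metric_op G = u) /\
  ((u <= Wm)%MS -> u *m gen_metric_op G = - u).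
Proof.
case=> Gsym _ [/andP[/andP[_ fullW] _] _ _ GW] u.
pose K : 'M[R]_(m + m) := block_mx 0 1%:M 1%:M 0.
have KK : K *m K = 1%:M.
  rewrite /K mulmx_block !mul0mx !mulmx0 !mulmx1 !addr0 !add0r.
  by rewrite -scalar_mx_block.
have biE (b c : 'M[R]_(m + m)) :
    (forall w, bilin b u w = bilin c u w) -> u *m b = u *m c.
  move=> bc; apply/rowP => j; have := bc (delta_mx 0 j).
  by rewrite /bilin !trmx_delta -!colE !mxE.
have biD b (v w w' : 'rV[R]_(m + m)) :
    bilin b v (w + w') = bilin b v w + bilin b v w'.
  by rewrite /bilin linearD mulmxDr mxE.
have biN b (v w : 'rV[R]_(m + m)) : bilin (- b) v w = - bilin b v w.
  by rewrite /bilin mulmxN mulNmx mxE.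
have GC (v w : 'rV[R]_(m + m)) : bilin G v w = bilin G w v.
  by rewrite /bilin -[v *m G *m w^T]trmxK mxE !trmx_mul trmxK Gsym mulmxA.
have gC (v w : 'rV[R]_(m + m)) : gform v w = gform w v.
  by rewrite /gform addrC.
have dec (w : 'rV[R]_(m + m)) :
    exists wp wm, [/\ (wp <= Wp)%MS, (wm <= Wm)%MS & w = wp + wm].
  have /sub_addsmxP[[a b] /= ->] := submx_trans (submx1 w) fullW.
  by exists (a *m Wp), (b *m Wm); rewrite !submxMl.
split=> uW.
  rewrite /gen_metric_op mulmxA (biE _ K) ?mulmxA -?mulmxA ?KK ?mulmx1//.
  move=> w; have [wp [wm [wpW wmW ->]]] := dec w.
  rewrite !biD -!gform_bilin.
  have [_ _ -> // _] := GW u wp; have [-> // -> // _ _] := GW u wm.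
  by rewrite mulr0.
rewrite /gen_metric_op mulmxA (biE _ (- K)).
  by rewrite mulmxN mulNmx -mulmxA KK mulmx1.
move=> w; have [wp [wm [wpW wmW ->]]] := dec w.
rewrite !biD !biN -!gform_bilin.
have [_ _ _ -> //] := GW u wm.
have [g0 G0 _ _] := GW wp u; rewrite GC G0// [gform u wp]gC g0//.
by rewrite mulr0 oppr0 mulNr.
Qed.

Definition Wplus (R : realType) (m : nat) (G : 'M[R]_(m + m)) :
    'M[R]_(m + m) :=
  eigenspace (gen_metric_op G) 1.

Definition Wminus (R : realType) (m : nat) (G : 'M[R]_(m + m)) :
    'M[R]_(m + m) :=
  eigenspace (gen_metric_op G) (- 1).

Lemma Wplus_minusE (R : realType) (m : nat) (G Wp Wm : 'M[R]_(m + m)) :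
  euclidean G -> gen_metric_split G Wp Wm ->
  (Wplus G :=: Wp)%MS /\ (Wminus G :=: Wm)%MS.
Proof.
move=> eG sG; have HW := gen_metric_opP eG sG.
have [/andP[/andP[_ fullW] _] _ _ _] := sG.
have dec (w : 'rV[R]_(m + m)) :
    exists wp wm, [/\ (wp <= Wp)%MS, (wm <= Wm)%MS & w = wp + wm].
  have /sub_addsmxP[[a b] /= ->] := submx_trans (submx1 w) fullW.
  by exists (a *m Wp), (b *m Wm); rewrite !submxMl.
have n2 (x : 'rV[R]_(m + m)) : x = - x -> x = 0.
  move/eqP; rewrite -addr_eq0 -mulr2n -scaler_nat scaler_eq0 pnatr_eq0 /=.
  by move/eqP.
split; apply/eqmxP/andP; split; apply/rV_subP => u.
- move/eigenspaceP; have [wp [wm [wpW wmW ->]]] := dec u.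
  rewrite mulmxDl (HW wp).1// (HW wm).2// scale1r => /addrI e.
  by rewrite (n2 wm)// addr0.
- by move=> uW; apply/eigenspaceP; rewrite (HW u).1// scale1r.
- move/eigenspaceP; have [wp [wm [wpW wmW ->]]] := dec u.
  rewrite mulmxDl (HW wp).1// (HW wm).2// scaleN1r opprD => /addIr e.
  by rewrite (n2 wp)// add0r.
- by move=> uW; apply/eigenspaceP; rewrite (HW u).2// scaleN1r.
Qed.

Definition tau (R : realType) (m : nat) (theta : 'M[R]_m) : 'M[R]_(m, m + m) :=
  row_mx 1%:M theta.

Definition gamma_psi_pair (R : realType) (m : nat) (G : 'M[R]_(m + m))
    (gp : 'M[R]_m * 'M[R]_m) : Prop :=
  [/\ euclidean gp.1, gp.2^T = - gp.2,
      (Wplus G :=: tau (gp.2 + gp.1))%MS &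
      (Wminus G :=: tau (gp.2 - gp.1))%MS].

(* (gamma, psi), which exists by [gamma_psiP] below and is unique *)
Definition gamma_psi (R : realType) (m : nat) (G : 'M[R]_(m + m)) :
    'M[R]_m * 'M[R]_m :=
  xget (0, 0) [set gp | gamma_psi_pair G gp].

Lemma gamma_psiP (R : realType) (m : nat) (G : 'M[R]_(m + m)) :
  gen_metric G -> gamma_psi_pair G (gamma_psi G).
Proof.
case=> eG [Wp [Wm sG]]; have [eWp eWm] := Wplus_minusE eG sG.
have [/andP[/eqmxP fullW dirW] [Wpos _] [Wneg _] GW] := sG.
pose B : 'M[R]_(m + m, m) := col_mx 1%:M 0.
have rkB e (A : 'M[R]_(m + m)) : gdefinite e A -> \rank (A *m B) = \rank A.
  move=> defA; rewrite -(mxrank_mul_ker A B).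
  suff -> : (A :&: kermx B = 0)%MS by rewrite mxrank0 addn0.
  apply/eqP/rowV0P => u; rewrite sub_capmx => /andP[uA /sub_kermxP].
  rewrite -[u]hsubmxK mul_row_col mulmx1 mulmx0 addr0 => l0.
  apply/eqP; apply: contraTT isT => u0; have := defA u uA.
  rewrite -{1}[u]hsubmxK u0 => /(_ isT).
  by rewrite /gform l0 !mul0mx addr0 mxE !mulr0 ltxx.
have rksum : (\rank Wp + \rank Wm = m + m)%N.
  by rewrite -(mxdirectP dirW) /= fullW mxrank1.
have graph e (A : 'M[R]_(m + m)) : gdefinite e A -> \rank A = m ->
    exists theta, (A :=: tau theta)%MS.
  move=> defA rA; have /row_fullP[D DAB] : row_full (A *m B).
    by rewrite /row_full (rkB e)// rA.
  exists (rsubmx (D *m A)).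
  have eD : tau (rsubmx (D *m A)) = D *m A.
    rewrite -[RHS]hsubmxK /tau; congr row_mx; rewrite -DAB mulmxA.
    by rewrite -[in LHS](hsubmxK (D *m A)) mul_row_col mulmx1 mulmx0 addr0.
  apply: eqmx_sym; apply/eqmxP; rewrite -(geq_leqif (mxrank_leqif_eq _)).
    rewrite rA; have := mxrankM_maxl (D *m A) B.
    by rewrite -mulmxA DAB mxrank1 eD.
  by rewrite eD submxMl.
have lep : (\rank Wp <= m)%N by rewrite -(rkB 1)// rank_leq_col.
have lem : (\rank Wm <= m)%N by rewrite -(rkB (- 1))// rank_leq_col.
have rp : \rank Wp = m.
  apply/eqP; rewrite eqn_leq lep /= -(leq_add2r (\rank Wm)) rksum.
  by rewrite leq_add2l.
have rm : \rank Wm = m by move: rksum; rewrite rp => /addnI.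
have [tp ep] := graph _ _ Wpos rp; have [tm em] := graph _ _ Wneg rm.
have gtau (a b : 'M[R]_m) (X Y : 'rV[R]_m) :
    2 * gform (X *m tau a) (Y *m tau b) = bilin (a^T + b) Y X.
  rewrite /gform mulrA divff ?pnatr_eq0// mul1r /tau !mul_mx_row !mulmx1.
  rewrite !row_mxKl !row_mxKr /bilin mulmxDr mulmxDl [LHS]mxE [RHS]mxE.
  rewrite trmx_mul mulmxA; congr (_ + _).
  by rewrite -[X *m _]trmxK mxE !trmx_mul !trmxK.
have t0 : tp^T + tm = 0.
  apply/matrixP => i j; rewrite [RHS]mxE.
  have [] := GW (delta_mx 0 j *m tau tp) (delta_mx 0 i *m tau tm).
  rewrite ep em !submxMl => /(_ isT isT) g0 _ _ _.
  have := gtau tp tm (delta_mx 0 j) (delta_mx 0 i).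
  rewrite g0 mulr0 /bilin trmx_delta -rowE -colE.
  by rewrite [X in _ = X]mxE [X in _ = X]mxE => <-.
have etm : tm = - tp^T by apply/eqP; rewrite -addr_eq0 addrC t0.
pose psi := 2^-1 *: (tp - tp^T); pose gam := 2^-1 *: (tp + tp^T).
have h2 : 2^-1 + 2^-1 = 1 :> R by rewrite [RHS]splitr mul1r.
apply: (@xgetI _ (0, 0) [set gp | gamma_psi_pair G gp] (gam, psi)).
split=> /=.
- split; first by rewrite /gam linearZ linearD /= trmxK addrC.
  move=> u u0; have posu := Wpos (u *m tau tp).
  have -> : bilin gam u u = 1 * gform (u *m tau tp) (u *m tau tp).
    apply: (@mulfI _ 2); rewrite ?pnatr_eq0// mul1r gtau /bilin /gam.
    rewrite -scalemxAr -scalemxAl mxE mulrA divff ?pnatr_eq0// mul1r.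
    by rewrite [tp + _]addrC.
  apply: posu; rewrite ?ep ?submxMl//; apply: contra u0 => /eqP.
  rewrite /tau mul_mx_row mulmx1 -row_mx0 => /eq_row_mx[-> _]; exact: eqxx.
- by rewrite /psi linearZ linearB /= trmxK -scalerN opprB.
- have -> : psi + gam = tp; last exact: eqmx_trans eWp ep.
  rewrite /psi /gam -scalerDr addrC addrACA subrr addr0.
  by rewrite scalerDr -scalerDl h2 scale1r.
- have -> : psi - gam = tm; last exact: eqmx_trans eWm em.
  rewrite etm /psi /gam -scalerBr opprD addrACA subrr add0r.
  by rewrite scalerDr -scalerDl h2 scale1r.
Qed.

Definition gen_hermitian (R : realType) (m : nat) (G J : 'M[R]_(m + m)) :
    Prop :=
  [/\ gen_metric G, gen_complex J &
      J *m gen_metric_op G = gen_metric_op G *m J].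

(* J' = H o J *)
Definition second_gcs (R : realType) (m : nat) (G J : 'M[R]_(m + m)) :
    'M[R]_(m + m) :=
  J *m gen_metric_op G.

Definition i_eigenspace (R : realType) (n : nat) (J : 'M[R]_n) : 'M[R[i]]_n :=
  eigenspace (toC J) 'i%C.

Definition Lplus (R : realType) (m : nat) (G J : 'M[R]_(m + m)) :
    'M[R[i]]_(m + m) :=
  (i_eigenspace J :&: toC (Wplus G))%MS.

Definition Lminus (R : realType) (m : nat) (G J : 'M[R]_(m + m)) :
    'M[R[i]]_(m + m) :=
  (i_eigenspace J :&: toC (Wminus G))%MS.

(* J_+- = pr_W o J o tau_+- *)
Definition Jplus (R : realType) (m : nat) (G J : 'M[R]_(m + m)) : 'M[R]_m :=
  let gp := gamma_psi G in tau (gp.2 + gp.1) *m J *m col_mx 1%:M 0.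

Definition Jminus (R : realType) (m : nat) (G J : 'M[R]_(m + m)) : 'M[R]_m :=
  let gp := gamma_psi G in tau (gp.2 - gp.1) *m J *m col_mx 1%:M 0.

Definition isotropic (F : fieldType) (m k : nat) (A : 'M[F]_(k, m + m)) :
    Prop :=
  forall u v : 'rV[F]_(m + m), (u <= A)%MS -> (v <= A)%MS -> gform u v = 0.

Definition dirac (F : fieldType) (m k : nat) (A : 'M[F]_(k, m + m)) : Prop :=
  isotropic A /\
  forall B : 'M[F]_(m + m), isotropic B -> (A <= B)%MS -> (B <= A)%MS.

Definition gen_hermitian_decomposition (R : realType) (m : nat)
    (Lp Lm : 'M[R[i]]_(m + m)) : Prop :=
  [/\ (Lp + Lm + conjmx Lp + conjmx Lm == 1%:M)%MS
        && mxdirect (Lp + Lm + conjmx Lp + conjmx Lm),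
      dirac (Lp + Lm)%MS,
      dirac (Lp + conjmx Lm)%MS &
      exists G : 'M[R]_(m + m),
        [/\ gen_metric G,
            (Lp + conjmx Lp :=: toC (Wplus G))%MS &
            (Lm + conjmx Lm :=: toC (Wminus G))%MS]].

(* {(X, f^* eta) : (f_* X, eta) \in U}: kermx computes the (X, eta) with
   (f_* X, eta) \in U, the last factor is (X, eta) |-> (X, f^* eta), and <<_>>
   turns the result into a square matrix; see [pullbackP]. *)
Definition pullback (F : fieldType) (n m : nat) (f : 'M[F]_(n, m))
    (U : 'M[F]_(m + m)) : 'M[F]_(n + n) :=
  (<<kermx (block_mx f 0 0 (1%:M : 'M[F]_m) *m cokermx U)
       *m block_mx 1%:M 0 0 f^T>>)%MS.

Lemma pullbackP (F : fieldType) (n m : nat) (f : 'M[F]_(n, m))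
    (U : 'M[F]_(m + m)) (v : 'rV[F]_(n + n)) :
  (v <= pullback f U)%MS <->
  exists (X : 'rV[F]_n) (eta : 'rV[F]_m),
    (row_mx (X *m f) eta <= U)%MS /\ v = row_mx X (eta *m f^T).
Proof.
have mulE (X : 'rV[F]_n) (eta : 'rV_m) :
    (row_mx X eta *m block_mx f 0 0 1%:M = row_mx (X *m f) eta) *
    (row_mx X eta *m block_mx 1%:M 0 0 f^T = row_mx X (eta *m f^T)).
  by rewrite !mul_row_block !mulmx0 !mulmx1 !addr0 !add0r.
rewrite /pullback genmxE; split=> [/submxP[w ->]|[X [eta [XU ->]]]].
  rewrite mulmxA; set u := w *m kermx _; exists (lsubmx u), (rsubmx u).
  rewrite -!mulE hsubmxK; split=> //.
  by rewrite submxE -mulmxA /u -mulmxA mulmx_ker mulmx0.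
rewrite -mulE submxMr //; apply/sub_kermxP.
by rewrite mulmxA mulE; apply/eqP; rewrite -submxE.
Qed.

(* f is C^oo on the open set U: all its iterated partial derivatives exist and
   are continuous on U. *)
Definition smooth_on (R : realType) (m : nat) (U : set 'rV[R]_m)
    (f : 'rV[R]_m -> R) : Prop :=
  forall (s : seq 'I_m) (x : 'rV[R]_m), U x ->
  let h := foldr (fun i k => 'D_(delta_mx 0 i) k) f s in
  {for x, continuous h} /\ forall i, derivable h x (delta_mx 0 i).

Definition smooth_mx (R : realType) (m p q : nat) (U : set 'rV[R]_m)
    (f : 'rV[R]_m -> 'M[R]_(p, q)) : Prop :=
  forall i j, smooth_on U (fun x => f x i j).

Definition smooth_cmx (R : realType) (m p q : nat) (U : set 'rV[R]_m)
    (f : 'rV[R]_m -> 'M[R[i]]_(p, q)) : Prop :=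
  smooth_mx U (fun x => map_mx (@complex.Re R) (f x)) /\
  smooth_mx U (fun x => map_mx (@complex.Im R) (f x)).

Definition cpartial (R : realType) (m : nat) (i : 'I_m)
    (f : 'rV[R]_m -> R[i]) (x : 'rV[R]_m) : R[i] :=
  ('D_(delta_mx 0 i) (fun y => complex.Re (f y)) x +i*
   'D_(delta_mx 0 i) (fun y => complex.Im (f y)) x)%C.

Definition lie_bracket (R : realType) (m : nat)
    (X Y : 'rV[R]_m -> 'rV[R[i]]_m) (x : 'rV[R]_m) : 'rV[R[i]]_m :=
  \row_k \sum_j (X x 0 j * cpartial j (fun y => Y y 0 k) x
                 - Y x 0 j * cpartial j (fun y => X y 0 k) x).

Definition lie_derivative (R : realType) (m : nat)
    (X mu : 'rV[R]_m -> 'rV[R[i]]_m) (x : 'rV[R]_m) : 'rV[R[i]]_m :=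
  \row_k \sum_j (X x 0 j * cpartial j (fun y => mu y 0 k) x
                 + mu x 0 j * cpartial k (fun y => X y 0 j) x).

Definition exterior_d (R : realType) (m : nat) (f : 'rV[R]_m -> R[i])
    (x : 'rV[R]_m) : 'rV[R[i]]_m :=
  \row_k cpartial k f x.

Definition courant (R : realType) (m : nat)
    (s t : 'rV[R]_m -> 'rV[R[i]]_(m + m)) (x : 'rV[R]_m) :
    'rV[R[i]]_(m + m) :=
  let X y := lsubmx (s y) in let alpha y := rsubmx (s y) in
  let Y y := lsubmx (t y) in let mu y := rsubmx (t y) in
  row_mx (lie_bracket X Y x)
    (lie_derivative X mu x - lie_derivative Y alpha x
     + 2^-1 *: exterior_d (fun y => (Y y *m (alpha y)^T
                                     - X y *m (mu y)^T) 0 0) x).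

Record chart (R : realType) (m : nat) (T : topologicalType) := Chart {
  chart_dom : set T;
  chart_cod : set 'rV[R]_m;
  chart_fun :> T -> 'rV[R]_m;
  chart_inv : 'rV[R]_m -> T;
  chart_dom_open : open chart_dom;
  chart_cod_open : open chart_cod;
  chart_funP : forall p, chart_dom p -> chart_cod (chart_fun p);
  chart_invP : forall x, chart_cod x -> chart_dom (chart_inv x);
  chart_funK : forall p, chart_dom p -> chart_inv (chart_fun p) = p;
  chart_invK : forall x, chart_cod x -> chart_fun (chart_inv x) = x;
  chart_fun_continuous : forall p, chart_dom p -> {for p, continuous chart_fun};
  chart_inv_continuous : forall x, chart_cod x -> {for x, continuous chart_inv}
}.

Definition smooth_in_charts (R : realType) (m n : nat)
    (T U : topologicalType) (c : chart R m T) (d : chart R n U) (f : T -> U) :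
    Prop :=
  smooth_mx (chart_cod c `&` [set x | chart_dom d (f (chart_inv c x))])
    (fun x => d (f (chart_inv c x))).

Record manifold (R : realType) (m : nat) := Manifold {
  mfd_space :> topologicalType;
  mfd_hausdorff : hausdorff_space mfd_space;
  mfd_second_countable : @second_countable mfd_space;
  atlas : set (chart R m mfd_space);
  atlas_cover : forall p, exists c, atlas c /\ chart_dom c p;
  atlas_compatible : forall c d, atlas c -> atlas d ->
    smooth_in_charts c d id
}.

Definition chart_at (R : realType) (m : nat) (M : manifold R m) (p : M) :
    chart R m M :=
  sval (cid (atlas_cover p)).

(* The tangent space T_pM is 'rV[R]_m, a row vector standing for the tangent
   vector with these components in the chart [chart_at p].  A field of
   endomorphisms, forms or subspaces of TM (+) T^*M is hence a function of p
   with values in matrices. *)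

Definition tangent_map (R : realType) (n m : nat) (N : manifold R n)
    (M : manifold R m) (iota : N -> M) (x : N) : 'M[R]_(n, m) :=
  jacobian (fun y => chart_at (iota x) (iota (chart_inv (chart_at x) y)))
    (chart_at x x).

(* For p in the domain of c, the change of components from [chart_at p] to c on
   T_pM (+) T_p^*M: tangent vectors are pushed forward by the Jacobian matrix,
   covectors are pulled back by its inverse. *)
Definition frame (R : realType) (m : nat) (M : manifold R m)
    (c : chart R m M) (p : M) : 'M[R]_(m + m) :=
  let A := jacobian (fun y => c (chart_inv (chart_at p) y)) (chart_at p p) in
  block_mx A 0 0 (invmx A)^T.

Definition smooth_endomorphism (R : realType) (m : nat) (M : manifold R m)
    (J : M -> 'M[R]_(m + m)) : Prop :=
  forall c, atlas c -> smooth_mx (chart_cod c) (fun x =>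
    let p := chart_inv c x in
    invmx (frame c p) *m J p *m frame c p).

Definition smooth_form (R : realType) (m : nat) (M : manifold R m)
    (G : M -> 'M[R]_(m + m)) : Prop :=
  forall c, atlas c -> smooth_mx (chart_cod c) (fun x =>
    let p := chart_inv c x in
    invmx (frame c p) *m G p *m (invmx (frame c p))^T).

(* the fibre over c^-1(x) of a field of subspaces of (TM (+) T^*M)^c, in the
   components of the chart c *)
Definition local_bundle (R : realType) (m : nat) (M : manifold R m)
    (E : M -> 'M[R[i]]_(m + m)) (c : chart R m M) (x : 'rV[R]_m) :
    'M[R[i]]_(m + m) :=
  E (chart_inv c x) *m toC (frame c (chart_inv c x)).

Definition smooth_subbundle (R : realType) (m : nat) (M : manifold R m)
    (E : M -> 'M[R[i]]_(m + m)) : Prop :=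
  forall c, atlas c -> forall x, chart_cod c x ->
  exists (V : set 'rV[R]_m) (k : nat) (F : 'rV[R]_m -> 'M[R[i]]_(k, m + m)),
    [/\ open V, V x, V `<=` chart_cod c, smooth_cmx V F &
        forall y, V y -> row_free (F y) /\ (F y :=: local_bundle E c y)%MS].

Definition courant_closed (R : realType) (m : nat) (M : manifold R m)
    (E : M -> 'M[R[i]]_(m + m)) : Prop :=
  forall c, atlas c ->
  forall V : set 'rV[R]_m, open V -> V `<=` chart_cod c ->
  forall s t : 'rV[R]_m -> 'rV[R[i]]_(m + m),
  smooth_cmx V s -> smooth_cmx V t ->
  (forall x, V x -> (s x <= local_bundle E c x)%MS) ->
  (forall x, V x -> (t x <= local_bundle E c x)%MS) ->
  forall x, V x -> (courant s t x <= local_bundle E c x)%MS.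

Record almost_gen_hermitian (R : realType) (m : nat) (M : manifold R m) :=
  AlmostGenHermitian {
  agh_G : M -> 'M[R]_(m + m);
  agh_J : M -> 'M[R]_(m + m);
  agh_smoothG : smooth_form agh_G;
  agh_smoothJ : smooth_endomorphism agh_J;
  agh_hermitian : forall p, gen_hermitian (agh_G p) (agh_J p)
}.

Definition gen_kahler (R : realType) (m : nat) (M : manifold R m)
    (S : almost_gen_hermitian M) : Prop :=
  courant_closed (fun p => i_eigenspace (agh_J S p)) /\
  courant_closed (fun p => i_eigenspace (second_gcs (agh_G S p) (agh_J S p))).

Definition smooth_map (R : realType) (n m : nat) (N : manifold R n)
    (M : manifold R m) (f : N -> M) : Prop :=
  continuous f /\
  forall (c : chart R n N) (d : chart R m M), atlas c -> atlas d ->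
    smooth_in_charts c d f.

(* injective immersions; embedded submanifolds are a special case *)
Definition submanifold (R : realType) (n m : nat) (N : manifold R n)
    (M : manifold R m) (iota : N -> M) : Prop :=
  [/\ injective iota, smooth_map iota & forall x, row_free (tangent_map iota x)].

Definition pullback_bundle (R : realType) (n m : nat) (N : manifold R n)
    (M : manifold R m) (iota : N -> M) (E : M -> 'M[R[i]]_(m + m)) (x : N) :
    'M[R[i]]_(n + n) :=
  pullback (toC (tangent_map iota x)) (E (iota x)).

Definition Lplus_bundle (R : realType) (m : nat) (M : manifold R m)
    (S : almost_gen_hermitian M) (p : M) : 'M[R[i]]_(m + m) :=
  Lplus (agh_G S p) (agh_J S p).

Definition Lminus_bundle (R : realType) (m : nat) (M : manifold R m)
    (S : almost_gen_hermitian M) (p : M) : 'M[R[i]]_(m + m) :=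
  Lminus (agh_G S p) (agh_J S p).

Definition gen_almost_hermitian_submanifold (R : realType) (n m : nat)
    (N : manifold R n) (M : manifold R m) (S : almost_gen_hermitian M)
    (iota : N -> M) : Prop :=
  [/\ forall x, gen_hermitian_decomposition
        (pullback_bundle iota (Lplus_bundle S) x)
        (pullback_bundle iota (Lminus_bundle S) x),
      smooth_subbundle (pullback_bundle iota (Lplus_bundle S)) &
      smooth_subbundle (pullback_bundle iota (Lminus_bundle S))].

(* L_+- determine the structure, so at most one SN is induced by S. *)
Definition induced_structure (R : realType) (n m : nat) (N : manifold R n)
    (M : manifold R m) (S : almost_gen_hermitian M) (iota : N -> M)
    (SN : almost_gen_hermitian N) : Prop :=
  forall x,
    (Lplus_bundle SN x :=: pullback_bundle iota (Lplus_bundle S) x)%MS /\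
    (Lminus_bundle SN x :=: pullback_bundle iota (Lminus_bundle S) x)%MS.

Definition gen_kahler_submanifold (R : realType) (n m : nat)
    (N : manifold R n) (M : manifold R m) (S : almost_gen_hermitian M)
    (iota : N -> M) : Prop :=
  gen_almost_hermitian_submanifold S iota /\
  exists SN : almost_gen_hermitian N,
    induced_structure S iota SN /\ gen_kahler SN.

(* J(TN) = TN *)
Definition complex_submanifold (R : realType) (n m : nat) (N : manifold R n)
    (M : manifold R m) (J : M -> 'M[R]_m) (iota : N -> M) : Prop :=
  forall x, (tangent_map iota x *m J (iota x) :=: tangent_map iota x)%MS.

(* Main.v *)
Require Import Defs.
From HB Require Import structures.
From mathcomp Require Import all_boot all_order all_algebra.
From mathcomp Require Import all_classical all_reals all_analysis.
From mathcomp.real_closed Require Import complex.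
From mathcomp Require Import perm ring zify.
(* Imported once more, so that its notation conjmx takes precedence over another
   one of the same name. *)
Import Defs.

(** Through the isomorphisms tau_+- of W onto W_+-, a generalized Hermitian
    structure is the same as a metric gamma, a 2-form psi and two
    gamma-compatible complex structures J_+-; in this picture L_+- is the
    image under tau_+- of the holomorphic vectors of J_+-. The record of
    this correspondence is [herm_data], obtained from a structure by
    [gen_hermitian_data] and giving one back by [herm_data_hermitian].

    The pullback of L_+- to a subspace V consists of the vectors of V^c that
    are holomorphic for J_+-, lifted by the maps tau'_+- of the restricted
    pair (gamma, psi) ([pullback_tauE]). These vectors meet their conjugates
    in 0, so they span a space of dimension at most n / 2; a decomposition
    of V (+) V^* of total dimension 2n forces equality for both signs, and
    then V^c is the sum of holomorphic and antiholomorphic vectors, hence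
    invariant ([decomposition_invariant]). Conversely, if V is invariant
    then gamma, psi and J_+- restrict, and the structure they define has the
    pullbacks as its spaces L_+- ([herm_data_restrict], [pullback_LE]). On a
    manifold the restricted data are smooth functions of the ambient data
    and of the Jacobian matrix of the inclusion.

    It remains to see that integrability is inherited. For a generalized
    complex structure K with i-eigenbundle E, the scalar product of the
    Courant bracket of two sections of E with a third one is, up to the
    factor 2i, a trilinear expression in the values of the sections, with
    the first derivatives of K as coefficients ([gform_courant]). As E is
    its own orthogonal, E is closed under the bracket if and only if this
    expression, the [torsion], vanishes on E ([courant_closedP]). A vector
    X_+ tau'_+ + X_- tau'_- on the submanifold lifts to the vector with the
    same components X_+-, pushed forward, in the ambient space ([lift_mx]).
    The lift preserves the scalar product and intertwines the induced
    structures with the ambient ones, so that it carries eigenbundles to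
    eigenbundles. Differentiating these relations shows that it also carries
    torsion to torsion: the additional terms involve the second derivatives
    of the inclusion and cancel in the cyclic sum because second derivatives
    commute ([torsion_lift]). In this way no section needs to be extended
    off the submanifold, and both i-eigenbundles of the induced structure
    are closed as soon as the ambient ones are ([induced_kahler]).

    Smoothness is the existence and continuity of all iterated partial
    derivatives, so total differentiability ([C1_differentiable]), the
    symmetry of second derivatives ([schwarz]) and the chain rule
    ([smooth_on_comp], [jacobian_rep_comp]) are derived from the mean value
    theorem. *)

Set Implicit Arguments.
Unset Strict Implicit.
Unset Printing Implicit Defensive.

Import Order.TTheory GRing.Theory Num.Theory.
Import numFieldNormedType.Exports.

Local Open Scope classical_set_scope.
Local Open Scope ring_scope.

(** * Partial derivatives: differentiability and symmetry *)

Definition partial (R : realType) (m : nat) (i : 'I_m) (f : 'rV[R]_m -> R) :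
    'rV[R]_m -> R :=
  'D_(delta_mx 0 i) f.

Section Increments.
Context {R : realType}.

(** Transfers both differentiability and the value of the derivative between
    f and its restriction to a line, as they are defined from these
    quotients. *)
Lemma growth_rate_line (V : normedModType R) (f : V -> R) (x v : V) (t : R) :
  (fun h : R => h^-1 *: (((fun s : R => f (x + s *: v)) \o shift t) (h *: 1)
                         - f (x + t *: v))) =
  (fun h : R => h^-1 *: ((f \o shift (x + t *: v)) (h *: v) - f (x + t *: v))).
Proof.
apply/funext => h /=; congr (_ *: (f _ - _)).
by rewrite [h *: 1]mulr1 scalerDl addrCA.
Qed.

Lemma MVT_line (V : normedModType R) (f : V -> R) (x v : V) (b : R) :
  (forall t, `|t| <= `|b| -> derivable f (x + t *: v) v) ->
  exists2 c, `|c| <= `|b| & f (x + b *: v) - f x = b * 'D_v f (x + c *: v).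
Proof.
move=> df; pose g (s : R) := f (x + s *: v).
have dg t : `|t| <= `|b| -> is_derive t (1 : R) g ('D_v f (x + t *: v)).
  move=> /df dft; have e := growth_rate_line f x v t.
  split; first by rewrite /derivable /g e.
  by rewrite /derive /g e.
have cg (p q : R) : (forall t, t \in `[p, q] -> `|t| <= `|b|) ->
    {within `[p, q], continuous g}.
  move=> pq; apply: derivable_within_continuous => t /pq tb.
  by have [] := dg t tb.
have g0 : g 0 = f x by rewrite /g scale0r addr0.
have [b0|b0] := leP 0 b.
  have tb t : t \in `[0, b] -> `|t| <= `|b|.
    by rewrite in_itv /= => /andP[t0 tb]; rewrite !ger0_norm.
  have tb' t : t \in `]0, b[ -> `|t| <= `|b|.
    by move/subset_itv_oo_cc; exact: tb.
  have [c cb e] := MVT_segment b0 (fun t tt => dg t (tb' t tt)) (cg _ _ tb).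
  by exists c; [exact: tb | rewrite -g0 e subr0 mulrC].
have tb t : t \in `[b, 0] -> `|t| <= `|b|.
  rewrite in_itv /= => /andP[tb t0].
  by rewrite !ler0_norm ?lerN2 ?(ltW b0).
have tb' t : t \in `]b, 0[ -> `|t| <= `|b|.
  by move/subset_itv_oo_cc; exact: tb.
have [c cb e] :=
  MVT_segment (ltW b0) (fun t tt => dg t (tb' t tt)) (cg _ _ tb).
exists c; first exact: tb.
by rewrite -g0 -[LHS]opprB e sub0r mulrN opprK mulrC.
Qed.

End Increments.

Section C1.
Context {R : realType}.

(** The corners of the polygonal path from 0 to h along the coordinate axes. *)
Definition head_entries (m : nat) (h : 'rV[R]_m) (k : nat) : 'rV[R]_m :=
  \row_i (if (i < k)%N then h 0 i else 0).

Lemma mxnorm_le (m : nat) (u : 'rV[R]_m) (r : R) :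
  0 <= r -> (forall i, `|u 0 i| <= r) -> `|u| <= r.
Proof.
move=> r0 ur; rewrite [`|u|]mx_normrE (bigmax_le _ r0)//= => -[i j] _ /=.
by rewrite ord1.
Qed.

Lemma entry_le_mxnorm (m : nat) (u : 'rV[R]_m) (i : 'I_m) : `|u 0 i| <= `|u|.
Proof. by rewrite [leRHS]mx_normrE; exact: (le_bigmax _ _ (0, i)). Qed.

Lemma head_entriesS (m : nat) (h : 'rV[R]_m) (k : 'I_m) :
  head_entries h k.+1 = head_entries h k + h 0 k *: delta_mx 0 k.
Proof.
apply/rowP => i; rewrite !mxE /= ltnS leq_eqVlt (inj_eq val_inj).
have [->|ik] := eqVneq i k; first by rewrite ltnn mulr1 add0r.
by rewrite mulr0 addr0.
Qed.

(** Along each edge of the path from x to x + h the mean value theorem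
    replaces the increment by a partial derivative, which is close to its
    value at x. *)
Lemma C1_increment (m : nat) (f : 'rV[R]_m -> R) (x h : 'rV[R]_m) (d e : R) :
  (forall y, `|y - x| < d -> forall i,
     derivable f y (delta_mx 0 i) /\ `|partial i f y - partial i f x| <= e) ->
  `|h| < d ->
  `|f (x + h) - f x - \sum_i h 0 i * partial i f x| <= m%:R * e * `|h|.
Proof.
move=> fd hd.
(* Walk from x to x + h one coordinate at a time. *)
have -> : f (x + h) - f x = \sum_(i < m)
    (f (x + head_entries h i.+1) - f (x + head_entries h i)).
  rewrite -(big_mkord xpredT (fun i => f (x + head_entries h i.+1) -
                                       f (x + head_entries h i))).
  rewrite telescope_sumr//; congr (f (x + _) - f _).
    by apply/rowP => i; rewrite !mxE ltn_ord.
  by rewrite -[LHS]addr0; congr (_ + _); apply/rowP => i; rewrite !mxE ltn0.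
rewrite -sumrB (le_trans (ler_norm_sum _ _ _))//.
rewrite -mulrA mulr_natl -[X in _ *+ X]card_ord -sumr_const ler_sum// => i _.
have near_x t : `|t| <= `|h 0 i| ->
    `|x + head_entries h i + t *: delta_mx 0 i - x| < d.
  move=> th; rewrite addrAC addrC [x + _]addrC addrK.
  apply: le_lt_trans hd; apply: mxnorm_le => // j; rewrite !mxE /=.
  have [->|ji] := eqVneq j i.
    by rewrite ltnn addr0 mulr1 (le_trans th)// entry_le_mxnorm.
  rewrite mulr0 add0r; case: ifP => _; first exact: entry_le_mxnorm.
  by rewrite normr0.
have [|c ch] := @MVT_line R _ f (x + head_entries h i) (delta_mx 0 i) (h 0 i).
  by move=> t /near_x /fd /(_ i)[].
rewrite head_entriesS addrA => ->.
rewrite -mulrBr normrM mulrC ler_pM//.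
  by have [] := fd _ (near_x c ch) i.
exact: entry_le_mxnorm.
Qed.

Lemma linear_approx_differentiable (V W : normedModType R) (f : V -> W) (x : V)
    (df : {linear V -> W}) :
  continuous df ->
  (forall e : R, 0 < e ->
     \forall h \near 0, `|f (h + x) - f x - df h| <= e * `|h|) ->
  differentiable f x.
Proof.
move=> dfc fdf.
have fE : f \o shift x = cst (f x) + df +o_ 0 id.
  apply/eqaddoP => e e0; near=> h; rewrite /= !fctE /= opprD addrA.
  by near: h; exact: fdf.
by apply/diff_locallyP; rewrite (diff_unique dfc fE); split.
Unshelve. all: by end_near. Qed.

Lemma C1_differentiable (m : nat) (f : 'rV[R]_m -> R) (x : 'rV[R]_m) :
  (\forall y \near x, forall i, derivable f y (delta_mx 0 i)) ->
  (forall i, {for x, continuous (partial i f)}) ->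
  differentiable f x.
Proof.
move=> df cf.
(* The candidate differential is given by the partial derivatives at x. *)
pose l (h : 'rV[R]_m) : R := \sum_i h 0 i * partial i f x.
have ll : linear l.
  move=> a u v; rewrite /l scaler_sumr -big_split; apply: eq_bigr => i _ /=.
  by rewrite !mxE mulrDl -mulrA.
pose lL : {linear 'rV[R]_m -> R} :=
  HB.pack l (GRing.isLinear.Build _ _ _ _ l ll).
have lc : continuous lL.
  suff dl y : differentiable l y by move=> y; exact/differentiable_continuous.
  rewrite (_ : l = \sum_i (fun h : 'rV[R]_m => h 0 i * partial i f x)).
    apply: differentiable_sum => i.
    by apply: differentiableM => //; exact: differentiable_coord.
  by apply/funext => h; rewrite fct_sumE.
apply: (linear_approx_differentiable lc) => _/posnumP[e].
  have [d /= d0 fd] : exists2 d : R, 0 < d & forall y, `|y - x| < d -> forall i,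
      derivable f y (delta_mx 0 i) /\
      `|partial i f y - partial i f x| <= e%:num / m.+1%:R.
    have : \forall y \near x, forall i, derivable f y (delta_mx 0 i) /\
        `|partial i f y - partial i f x| <= e%:num / m.+1%:R.
      near=> y => i; split; first by move: i; near: y.
      rewrite distrC; move: i; near: y; apply: filter_forall => i.
      by move/cvgrPdist_le : (cf i); apply; rewrite divr_gt0.
    move/nbhs_ballP => [d /= d0 xd]; exists d => // y yd; apply: xd.
    by rewrite -ball_normE /= distrC.
  near=> h.
  have hd : `|h| < d.
    near: h; apply/nbhs_ballP; exists d => //= h.
    by rewrite -ball_normE /= sub0r normrN.
  have := C1_increment fd hd.
  rewrite [h + x]addrC => /le_trans; apply.
  rewrite ler_wpM2r// mulrCA -[leRHS]mulr1 ler_wpM2l//.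
  by rewrite ler_pdivrMr// mul1r ler_nat.
Unshelve. all: by end_near. Qed.

End C1.

Section Schwarz.
Context {R : realType} {m : nat}.

(** Two applications of the mean value theorem: first to the difference of f
    and its translate, along the i-th axis, then to the i-th partial
    derivative along the j-th axis. *)
Lemma second_increment (f : 'rV[R]_m -> R) (x : 'rV[R]_m) (i j : 'I_m)
    (d h : R) :
  (forall y, `|y - x| < d -> derivable f y (delta_mx 0 i) /\
                             derivable (partial i f) y (delta_mx 0 j)) ->
  `|h| + `|h| < d ->
  exists2 y, `|y - x| < d &
    f (x + h *: delta_mx 0 i + h *: delta_mx 0 j)
    - f (x + h *: delta_mx 0 i) - (f (x + h *: delta_mx 0 j) - f x)
    = h * (h * partial j (partial i f) y).
Proof.
move=> fd hd; set ei : 'rV[R]_m := delta_mx 0 i.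
set ej : 'rV[R]_m := delta_mx 0 j.
have en t k : `|t *: (delta_mx 0 k : 'rV[R]_m)| <= `|t|.
  apply: mxnorm_le => // l; rewrite !mxE /=.
  by case: (l == k); rewrite ?mulr1// mulr0 normr0.
have near_x t s : `|t| <= `|h| -> `|s| <= `|h| ->
    `|x + t *: ei + s *: ej - x| < d.
  move=> th sh; rewrite [_ - x]addrC -!addrA addKr.
  apply: le_lt_trans hd; rewrite (le_trans (ler_normD _ _))// lerD//.
    exact: le_trans (en t i) th.
  exact: le_trans (en s j) sh.
have near_x0 t : `|t| <= `|h| -> `|x + t *: ei - x| < d.
  by move=> th; have := near_x t 0 th; rewrite normr0 scale0r addr0; apply.
pose fj (y : 'rV[R]_m) := f (y + h *: ej).
pose phi : 'rV[R]_m -> R := fj - f.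
have dsh t : `|t| <= `|h| -> derivable fj (x + t *: ei) ei
    /\ 'D_ei fj (x + t *: ei)
       = partial i f (x + t *: ei + h *: ej).
  move=> th; have [df _] := fd _ (near_x t h th (lexx _)).
  have e : (fun k : R => k^-1 *: ((fj \o
        shift (x + t *: ei)) (k *: ei) - f (x + t *: ei + h *: ej))) =
      (fun k : R => k^-1 *: ((f \o shift (x + t *: ei + h *: ej)) (k *: ei)
        - f (x + t *: ei + h *: ej))).
    by apply/funext => k /=; rewrite !addrA.
  by split; rewrite /derivable /partial /derive e.
have dphi t : `|t| <= `|h| -> derivable phi (x + t *: ei) ei.
  move=> th; have [dfj _] := dsh t th; have [df _] := fd _ (near_x0 t th).
  exact: derivableB.
have [c ch] := @MVT_line R _ phi x ei h dphi.
have [dc Dc] := dsh c ch; have [dc' _] := fd _ (near_x0 c ch).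
rewrite (deriveB dc dc') Dc.
have [|c' ch' e'] := @MVT_line R _ (partial i f) (x + c *: ei) ej h.
  by move=> t th; have [] := fd _ (near_x c t ch th).
by rewrite e' => e; exists (x + c *: ei + c' *: ej); [exact: near_x|].
Qed.

(** The second increment of f over a square is symmetric in i and j, so it
    approximates both mixed derivatives. *)
Lemma schwarz (f : 'rV[R]_m -> R) (x : 'rV[R]_m) (i j : 'I_m) :
  (\forall y \near x,
     [/\ derivable f y (delta_mx 0 i), derivable f y (delta_mx 0 j),
         derivable (partial i f) y (delta_mx 0 j) &
         derivable (partial j f) y (delta_mx 0 i)]) ->
  {for x, continuous (partial j (partial i f))} ->
  {for x, continuous (partial i (partial j f))} ->
  partial j (partial i f) x = partial i (partial j f) x.
Proof.
move=> df cij cji; apply/eqP; rewrite -subr_eq0 -normr_le0.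
apply/ler_addgt0Pl => _/posnumP[e]; rewrite addr0.
have : \forall y \near x,
   [/\ derivable f y (delta_mx 0 i) /\
         derivable (partial i f) y (delta_mx 0 j),
       derivable f y (delta_mx 0 j) /\
         derivable (partial j f) y (delta_mx 0 i),
       `|partial j (partial i f) x - partial j (partial i f) y| <= e%:num / 2 &
       `|partial i (partial j f) x - partial i (partial j f) y| <= e%:num / 2].
  have e2 : 0 < e%:num / 2 by [].
  move/cvgrPdist_le : cij => /(_ _ e2) cij.
  move/cvgrPdist_le : cji => /(_ _ e2) cji.
  apply: filterS (filterI df (filterI cij cji)) => z /=.
  move=> [[fi fj fij fji] [xij xji]].
  exact: (And4 (conj fi fij) (conj fj fji) xij xji).
move/nbhs_ballP => [d /= d0 xd].
have bd y : `|y - x| < d -> ball x d y by rewrite -ball_normE /= distrC.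
(* A step of d / 4 in both directions stays within distance d of x. *)
have h0 : 0 < d / 4 by rewrite divr_gt0.
have hd : `|d / 4| + `|d / 4| < d.
  rewrite gtr0_norm// -mulrDl -mulr2n -[_ *+ 2]mulr_natr -mulrA gtr_pMr//.
  by rewrite ltr_pdivrMr// mul1r ltr_nat.
have [|u ud eu] := second_increment (f := f) (x := x) (i := i) (j := j) _ hd.
  by move=> y /bd /xd[].
have [|w wd ew] := second_increment (f := f) (x := x) (i := j) (j := i) _ hd.
  by move=> y /bd /xd[].
have euw : partial j (partial i f) u = partial i (partial j f) w.
  apply: (mulfI (lt0r_neq0 h0)); apply: (mulfI (lt0r_neq0 h0)).
  apply: etrans (esym eu) (etrans _ ew).
  have -> : x + (d / 4) *: delta_mx 0 j + (d / 4) *: delta_mx 0 i =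
      x + (d / 4) *: delta_mx 0 i + (d / 4) *: delta_mx 0 j by exact: addrAC.
  move: (f _) (f _) (f _) (f x) => a b c k.
  by rewrite !opprB addrACA [RHS]addrACA; congr (_ + _); exact: addrC.
have [_ _ ui _] := xd u (bd u ud); have [_ _ _ wj] := xd w (bd w wd).
move: ui wj; rewrite euw.
move: (partial j (partial i f) x) (partial i (partial j f) x)
  (partial i (partial j f) w) => p q r pr qr; clear -pr qr.
rewrite -(subrKA r) -[r - q]opprB (le_trans (ler_normB _ _))//.
by rewrite [leRHS]splitr lerD.
Qed.

End Schwarz.

(** * Smooth functions of several variables *)

Section SmoothFunctions.
Context {R : realType} {m : nat}.
Implicit Types (U V : set 'rV[R]_m) (f g : 'rV[R]_m -> R).

Definition C0_derivable U f : Prop := forall x, U x ->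
  {for x, continuous f} /\ forall i, derivable f x (delta_mx 0 i).

(** The recursion differentiates f first, whereas in smooth_on the last
    derivative of a list is the outermost one: induction on the order then
    applies to the partial derivatives of f, which is what the product and
    chain rules need. *)
Fixpoint Ck (k : nat) U f : Prop :=
  C0_derivable U f /\
  if k is k'.+1 then forall i, Ck k' U (partial i f) else True.

Lemma CkC0 k U f : Ck k U f -> C0_derivable U f.
Proof. by case: k => [|k] []. Qed.

Lemma CkS k U f : Ck k.+1 U f -> Ck k U f.
Proof.
elim: k f => [|k IH] f [? df]; split => // i.
by apply: IH; exact: df.
Qed.

Lemma smooth_onP U f : smooth_on U f <-> forall k, Ck k U f.
Proof.
split=> [sf k|Cf].
  elim: k f sf => [|k IH] f sf /=; split => //.
  - by move=> x Ux; have := sf [::] x Ux.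
  - by move=> x Ux; have := sf [::] x Ux.
  - move=> i; apply: IH => s x Ux; have := sf (rcons s i) x Ux.
    by rewrite foldr_rcons.
move=> s; elim/last_ind: s f Cf => [|s i IH] f Cf x Ux; first exact: (Cf 0%N).1.
by rewrite foldr_rcons; apply: IH => // k; exact: (Cf k.+1).2.
Qed.

Lemma smooth_onC0 U f : smooth_on U f -> C0_derivable U f.
Proof. by move/smooth_onP/(_ 0%N)/CkC0. Qed.

Lemma smooth_on_partial U f i : smooth_on U f -> smooth_on U (partial i f).
Proof. by move=> /smooth_onP sf; apply/smooth_onP => k; exact: (sf k.+1).2. Qed.

Lemma smooth_on_local U f :
  (forall x, U x -> exists V, [/\ V x & smooth_on V f]) -> smooth_on U f.
Proof. by move=> loc s x /loc[V [Vx]]; exact. Qed.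

Lemma smooth_on_sub U V f : V `<=` U -> smooth_on U f -> smooth_on V f.
Proof. by move=> VU sf s x /VU; exact: sf. Qed.

Lemma open_near U x (P : 'rV[R]_m -> Prop) :
  open U -> U x -> (forall y, U y -> P y) -> \forall y \near x, P y.
Proof. by move=> oU Ux UP; apply: filterS (open_nbhs_nbhs (conj oU Ux)). Qed.

Lemma eq_partial U f g i x : open U -> U x -> {in U, f =1 g} ->
  partial i f x = partial i g x.
Proof.
move=> oU Ux fg; apply: near_eq_derive; apply: open_near oU Ux _ => y Uy.
by apply: fg; rewrite inE.
Qed.

Lemma eq_C0_derivable U f g : open U -> {in U, f =1 g} ->
  C0_derivable U f -> C0_derivable U g.
Proof.
move=> oU fg cf x Ux; have [cfx dfx] := cf x Ux.
have nfg : \forall y \near x, f y = g y.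
  by apply: open_near oU Ux _ => y Uy; apply: fg; rewrite inE.
split=> [|i]; last exact: near_eq_derivable nfg (dfx i).
rewrite /prop_for /continuous_at -(fg x) ?inE//.
exact: cvg_trans (near_eq_cvg nfg) cfx.
Qed.

Lemma eq_Ck k U f g : open U -> {in U, f =1 g} -> Ck k U f -> Ck k U g.
Proof.
move=> oU; elim: k f g => [|k IH] f g fg [cf df];
  (split; first exact: eq_C0_derivable fg cf).
- exact: I.
- move=> i; apply: IH (df i) => y; rewrite inE => Uy; exact: eq_partial fg.
Qed.

Lemma eq_smooth_on U f g : open U -> {in U, f =1 g} ->
  smooth_on U f -> smooth_on U g.
Proof.
by move=> oU fg /smooth_onP sf; apply/smooth_onP => k; exact: eq_Ck fg (sf k).
Qed.

Lemma smooth_on_cst U (c : R) : smooth_on U (fun=> c).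
Proof.
apply/smooth_onP => k; elim: k c => [|k IH] c.
  by split=> // x Ux; split=> *; [exact: cst_continuous | exact: derivable_cst].
split=> [x Ux|i]; first by split=> *;
  [exact: cst_continuous | exact: derivable_cst].
rewrite (_ : partial i _ = fun=> 0)//; apply/funext => y.
by rewrite /partial derive_cst.
Qed.

Lemma C0_derivableD U f g : C0_derivable U f -> C0_derivable U g ->
  C0_derivable U (f + g).
Proof.
move=> cf cg x Ux; have [? ?] := cf x Ux; have [? ?] := cg x Ux.
by split=> [|i]; [exact: continuousD | exact: derivableD].
Qed.

Lemma C0_derivableM U f g : C0_derivable U f -> C0_derivable U g ->
  C0_derivable U (f * g).
Proof.
move=> cf cg x Ux; have [? ?] := cf x Ux; have [? ?] := cg x Ux.
by split=> [|i]; [exact: continuousM | exact: derivableM].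
Qed.

Lemma CkD k U f g : open U -> Ck k U f -> Ck k U g -> Ck k U (f + g).
Proof.
move=> oU; elim: k f g => [|k IH] f g [cf df] [cg dg];
  (split; first exact: C0_derivableD).
- exact: I.
- move=> i; apply: eq_Ck oU _ (IH _ _ (df i) (dg i)) => y; rewrite inE => Uy.
  by rewrite /partial deriveD//; [exact: (cf y Uy).2 | exact: (cg y Uy).2].
Qed.

Lemma CkM k U f g : open U -> Ck k U f -> Ck k U g -> Ck k U (f * g).
Proof.
move=> oU; elim: k f g => [|k IH] f g Cf Cg.
  by split; first exact: C0_derivableM (CkC0 Cf) (CkC0 Cg).
have [[cf df] [cg dg]] := (Cf, Cg); split; first exact: C0_derivableM.
move=> i; have := CkD oU (IH _ _ (CkS Cf) (dg i)) (IH _ _ (CkS Cg) (df i)).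
apply: eq_Ck oU _ => y; rewrite inE => Uy.
by rewrite /partial deriveM//; [exact: (cf y Uy).2 | exact: (cg y Uy).2].
Qed.

(** The derivative of 1 / f is - f' / f^2, so regularity of 1 / f propagates
    from order k to order k + 1. *)
Lemma CkV k U f : open U -> (forall x, U x -> f x != 0) -> Ck k U f ->
  Ck k U (fun x => (f x)^-1).
Proof.
move=> oU f0; elim: k => [|k IH] Cf; have cf := CkC0 Cf.
  split; last exact: I.
  move=> x Ux; have [? ?] := cf x Ux; have fx0 := f0 x Ux.
  by split=> [|i]; [exact: continuousV | exact: derivableV].
split.
  move=> x Ux; have [? ?] := cf x Ux; have fx0 := f0 x Ux.
  by split=> [|i]; [exact: continuousV | exact: derivableV].
move=> i; have Cv := IH (CkS Cf).
have CN := (smooth_onP U _).1 (@smooth_on_cst U (- 1)) k.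
have := CkM oU CN (CkM oU Cv (CkM oU Cv (Cf.2 i))).
apply: eq_Ck oU _ => y; rewrite inE => Uy.
rewrite /partial deriveV ?f0//; last exact: (cf y Uy).2.
by rewrite !fctE /= /cst mulN1r scaleNr mulrA -expr2 exprVn.
Qed.

Lemma smooth_onD U f g : open U -> smooth_on U f -> smooth_on U g ->
  smooth_on U (fun x => f x + g x).
Proof.
by move=> oU /smooth_onP sf /smooth_onP sg; apply/smooth_onP => k; exact: CkD.
Qed.

Lemma smooth_onM U f g : open U -> smooth_on U f -> smooth_on U g ->
  smooth_on U (fun x => f x * g x).
Proof.
by move=> oU /smooth_onP sf /smooth_onP sg; apply/smooth_onP => k; exact: CkM.
Qed.

Lemma smooth_onV U f : open U -> (forall x, U x -> f x != 0) ->
  smooth_on U f -> smooth_on U (fun x => (f x)^-1).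
Proof.
by move=> oU f0 /smooth_onP sf; apply/smooth_onP => k; exact: CkV.
Qed.

Lemma smooth_onZ U f (c : R) : open U -> smooth_on U f ->
  smooth_on U (fun x => c * f x).
Proof. by move=> oU; apply: smooth_onM => //; exact: smooth_on_cst. Qed.

Lemma smooth_onN U f : open U -> smooth_on U f -> smooth_on U (fun x => - f x).
Proof.
move=> oU sf; have -> : (fun x => - f x) = (fun x => -1 * f x).
  by apply/funext => x; rewrite mulN1r.
exact: smooth_onZ.
Qed.

Lemma Ck_sum k U (I : Type) (r : seq I) (P : pred I)
    (F : I -> 'rV[R]_m -> R) : open U ->
  (forall i, Ck k U (F i)) -> Ck k U (fun x => \sum_(i <- r | P i) F i x).
Proof.
move=> oU CF; elim: r => [|i r IH].
  apply: eq_Ck oU _ ((smooth_onP U _).1 (@smooth_on_cst U 0) k) => x _.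
  by rewrite big_nil.
have CF' : Ck k U (fun x => if P i then F i x +
    \sum_(j <- r | P j) F j x else \sum_(j <- r | P j) F j x).
  case: (P i); [exact: CkD oU (CF i) IH | exact: IH].
by apply: eq_Ck oU _ CF' => x _; rewrite big_cons.
Qed.

Lemma smooth_on_sum U (I : Type) (r : seq I) (P : pred I)
    (F : I -> 'rV[R]_m -> R) : open U ->
  (forall i, smooth_on U (F i)) ->
  smooth_on U (fun x => \sum_(i <- r | P i) F i x).
Proof.
move=> oU sF; apply/smooth_onP => k; apply: Ck_sum oU _ => i.
by move/smooth_onP : (sF i).
Qed.

Lemma smooth_on_prod U (I : Type) (r : seq I) (P : pred I)
    (F : I -> 'rV[R]_m -> R) : open U ->
  (forall i, smooth_on U (F i)) ->
  smooth_on U (fun x => \prod_(i <- r | P i) F i x).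
Proof.
move=> oU sF; elim: r => [|i r IH].
  apply: eq_smooth_on oU _ (@smooth_on_cst U (1)) => x _.
  by rewrite big_nil.
have sF' : smooth_on U (fun x => if P i then F i x *
    \prod_(j <- r | P j) F j x else \prod_(j <- r | P j) F j x).
  case: (P i); [exact: smooth_onM oU (sF i) IH | exact: IH].
by apply: eq_smooth_on oU _ sF' => x _; rewrite big_cons.
Qed.

Lemma smooth_on_differentiable U f x : open U -> U x -> smooth_on U f ->
  differentiable f x.
Proof.
move=> oU Ux sf; apply: C1_differentiable => [|i].
  by apply: open_near oU Ux _ => y Uy i; exact: (smooth_onC0 sf Uy).2.
exact: (smooth_onC0 (smooth_on_partial i sf) Ux).1.
Qed.

Lemma smooth_on_schwarz U f x i j : open U -> U x -> smooth_on U f ->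
  partial i (partial j f) x = partial j (partial i f) x.
Proof.
move=> oU Ux sf; have sp k := smooth_on_partial k sf; apply: schwarz.
- apply: open_near oU Ux _ => y Uy; have d0 := (smooth_onC0 sf Uy).2.
  by have d1 k := (smooth_onC0 (sp k) Uy).2; split.
- exact: (smooth_onC0 (smooth_on_partial i (sp j)) Ux).1.
- exact: (smooth_onC0 (smooth_on_partial j (sp i)) Ux).1.
Qed.

End SmoothFunctions.

(** * Smooth matrix fields and Jacobians *)

Section SmoothMaps.
Context {R : realType} {m : nat}.
Implicit Types (U V : set 'rV[R]_m).

Lemma eq_smooth_mx U (p q : nat) (f g : 'rV[R]_m -> 'M[R]_(p, q)) :
  open U -> {in U, f =1 g} -> smooth_mx U f -> smooth_mx U g.
Proof.
move=> oU fg sf i j; apply: (eq_smooth_on oU _ (sf i j)) => x Ux.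
by rewrite fg.
Qed.

Lemma smooth_mx_sub U V (p q : nat) (f : 'rV[R]_m -> 'M[R]_(p, q)) :
  V `<=` U -> smooth_mx U f -> smooth_mx V f.
Proof. by move=> VU sf i j; apply: (smooth_on_sub VU (sf i j)). Qed.

Lemma smooth_mx_cst U (p q : nat) (A : 'M[R]_(p, q)) : smooth_mx U (fun=> A).
Proof. by move=> i j; exact: smooth_on_cst. Qed.

Lemma smooth_mxM U (p q r : nat) (f : 'rV[R]_m -> 'M[R]_(p, q))
    (g : 'rV[R]_m -> 'M[R]_(q, r)) : open U ->
  smooth_mx U f -> smooth_mx U g -> smooth_mx U (fun x => f x *m g x).
Proof.
move=> oU sf sg i j.
have sfg : smooth_on U (fun x => \sum_k f x i k * g x k j).
  apply: (smooth_on_sum _ _ (F := fun k x => f x i k * g x k j) oU) => k.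
  exact: smooth_onM oU (sf i k) (sg k j).
by apply: (eq_smooth_on oU _ sfg) => x _; rewrite mxE.
Qed.

Lemma smooth_mxD U (p q : nat) (f g : 'rV[R]_m -> 'M[R]_(p, q)) : open U ->
  smooth_mx U f -> smooth_mx U g -> smooth_mx U (fun x => f x + g x).
Proof.
move=> oU sf sg i j.
apply: (eq_smooth_on oU _ (smooth_onD oU (sf i j) (sg i j))) => x _.
by rewrite mxE.
Qed.

Lemma smooth_mxN U (p q : nat) (f : 'rV[R]_m -> 'M[R]_(p, q)) : open U ->
  smooth_mx U f -> smooth_mx U (fun x => - f x).
Proof.
move=> oU sf i j.
by apply: (eq_smooth_on oU _ (smooth_onN oU (sf i j))) => x _; rewrite mxE.
Qed.

Lemma smooth_mx_tr U (p q : nat) (f : 'rV[R]_m -> 'M[R]_(p, q)) : open U ->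
  smooth_mx U f -> smooth_mx U (fun x => (f x)^T).
Proof.
by move=> oU sf i j; apply: (eq_smooth_on oU _ (sf j i)) => x _; rewrite mxE.
Qed.

Lemma smooth_mxZ U (p q : nat) (a : R) (f : 'rV[R]_m -> 'M[R]_(p, q)) :
  open U -> smooth_mx U f -> smooth_mx U (fun x => a *: f x).
Proof.
move=> oU sf i j.
by apply: (eq_smooth_on oU _ (smooth_onZ a oU (sf i j))) => x _; rewrite mxE.
Qed.

Lemma smooth_row_mx U (p q r : nat) (f : 'rV[R]_m -> 'M[R]_(p, q))
    (g : 'rV[R]_m -> 'M[R]_(p, r)) : open U ->
  smooth_mx U f -> smooth_mx U g -> smooth_mx U (fun x => row_mx (f x) (g x)).
Proof.
move=> oU sf sg i j; case: (split_ordP j) => k ->.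
  by apply: (eq_smooth_on oU _ (sf i k)) => x _; rewrite row_mxEl.
by apply: (eq_smooth_on oU _ (sg i k)) => x _; rewrite row_mxEr.
Qed.

Lemma smooth_col_mx U (p q r : nat) (f : 'rV[R]_m -> 'M[R]_(p, q))
    (g : 'rV[R]_m -> 'M[R]_(r, q)) : open U ->
  smooth_mx U f -> smooth_mx U g -> smooth_mx U (fun x => col_mx (f x) (g x)).
Proof.
move=> oU sf sg i j; case: (split_ordP i) => k ->.
  by apply: (eq_smooth_on oU _ (sf k j)) => x _; rewrite col_mxEu.
by apply: (eq_smooth_on oU _ (sg k j)) => x _; rewrite col_mxEd.
Qed.

Lemma smooth_det U (p : nat) (f : 'rV[R]_m -> 'M[R]_p) : open U ->
  smooth_mx U f -> smooth_on U (fun x => \det (f x)).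
Proof.
move=> oU sf; apply: (smooth_on_sum _ _
  (F := fun (s : 'S_p) x => (-1) ^+ s * \prod_i f x i (s i)) oU) => s.
apply: (smooth_onZ _ oU).
by apply: (smooth_on_prod _ _ (F := fun i x => f x i (s i)) oU) => i; exact: sf.
Qed.

(** By the adjugate formula the entries of the inverse are rational in those
    of the matrix. *)
Lemma smooth_invmx U (p : nat) (f : 'rV[R]_m -> 'M[R]_p) : open U ->
  (forall x, U x -> f x \in unitmx) ->
  smooth_mx U f -> smooth_mx U (fun x => invmx (f x)).
Proof.
move=> oU uf sf i j.
have sdet : smooth_on U (fun x => (\det (f x))^-1).
  apply: (smooth_onV oU _ (smooth_det oU sf)) => x /uf.
  by rewrite unitmxE unitfE.
have scof : smooth_on U (fun x => \det (row' j (col' i (f x)))).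
  apply: (smooth_det oU _) => k l.
  by apply: (eq_smooth_on oU _ (sf (lift j k) (lift i l))) => x _; rewrite !mxE.
have := smooth_onM oU sdet (smooth_onZ ((-1) ^+ (j + i)) oU scof).
apply: (eq_smooth_on oU _) => x; rewrite inE => Ux.
by rewrite /invmx (uf x Ux) !mxE.
Qed.

Lemma smooth_mx_differentiable U (n : nat) (f : 'rV[R]_m -> 'rV[R]_n) x :
  open U -> U x -> smooth_mx U f -> differentiable f x.
Proof.
move=> oU Ux sf.
have -> : f = \sum_j (fun y => f y 0 j *: delta_mx 0 j).
  by apply/funext => y; rewrite fct_sumE [LHS]row_sum_delta.
apply: differentiable_sum => j; apply: differentiableZl.
exact: smooth_on_differentiable oU Ux (sf 0 j).
Qed.

(** The Jacobian matrix is defined from the total differential; for smooth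
    maps it is the matrix of partial derivatives. *)
Lemma jacobianE U (n : nat) (f : 'rV[R]_m -> 'rV[R]_n) x i j :
  open U -> U x -> smooth_mx U f ->
  jacobian f x i j = partial i (fun y => f y 0 j) x.
Proof.
move=> oU Ux sf; have df := smooth_mx_differentiable oU Ux sf.
have := deriveEjacobian (delta_mx 0 i) df.
rewrite derive_mx; last exact: diff_derivable.
by rewrite -rowE => /rowP/(_ j); rewrite !mxE => <-.
Qed.

Lemma smooth_jacobian U (n : nat) (f : 'rV[R]_m -> 'rV[R]_n) :
  open U -> smooth_mx U f -> smooth_mx U (jacobian f).
Proof.
move=> oU sf i j; apply: (eq_smooth_on oU _ (smooth_on_partial i (sf 0 j))).
by move=> x; rewrite inE => Ux; rewrite (jacobianE i j oU Ux sf).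
Qed.

Lemma eq_jacobian U (n : nat) (f g : 'rV[R]_m -> 'rV[R]_n) x :
  open U -> U x -> {in U, f =1 g} -> smooth_mx U f ->
  jacobian f x = jacobian g x.
Proof.
move=> oU Ux fg sf; apply/matrixP => i j.
have sg := eq_smooth_mx oU fg sf.
apply: etrans (jacobianE i j oU Ux sf) _.
apply: etrans _ (esym (jacobianE i j oU Ux sg)).
by apply: (eq_partial _ oU Ux) => y Uy; rewrite fg.
Qed.

Lemma jacobian_id (x : 'rV[R]_m) : jacobian id x = 1%:M.
Proof.
apply/row_matrixP => i; rewrite !rowE mulmx1 -deriveEjacobian ?derive_id//.
Qed.

End SmoothMaps.

Section Composition.
Context {R : realType} {m n : nat}.

Lemma jacobian_comp (p : nat) (f : 'rV[R]_n -> 'rV[R]_p)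
    (g : 'rV[R]_m -> 'rV[R]_n) x :
  differentiable g x -> differentiable f (g x) ->
  jacobian (f \o g) x = jacobian g x *m jacobian f (g x).
Proof.
move=> dg df; apply/row_matrixP => i; rewrite !rowE mulmxA.
rewrite /jacobian !mul_rV_lin1 /=.
by rewrite diff_comp.
Qed.

Lemma partial_comp (U : set 'rV[R]_m) (V : set 'rV[R]_n) (f : 'rV[R]_n -> R)
    (g : 'rV[R]_m -> 'rV[R]_n) x i :
  open U -> open V -> (forall x, U x -> V (g x)) -> smooth_on V f ->
  smooth_mx U g -> U x ->
  partial i (f \o g) x =
  \sum_j partial j f (g x) * partial i (fun y => g y 0 j) x.
Proof.
move=> oU oV UV sf sg Ux; have dg := smooth_mx_differentiable oU Ux sg.
have df := smooth_on_differentiable oV (UV x Ux) sf.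
have dgi : 'd g x (delta_mx 0 i) = \row_j partial i (fun y => g y 0 j) x.
  rewrite -deriveE// derive_mx; last exact: diff_derivable.
  by apply/rowP => j; rewrite !mxE.
rewrite /partial deriveE; last exact: differentiable_comp.
rewrite diff_comp//= dgi [X in 'd f _ X]row_sum_delta linear_sum /=.
apply: eq_bigr => j _.
by rewrite linearZ /= -deriveE// mxE mulrC.
Qed.

(** By the chain rule the partial derivatives of f o g are sums of products
    of functions of the same form with derivatives of g, which allows an
    induction on the order, for all f at once. *)
Lemma smooth_on_comp (U : set 'rV[R]_m) (V : set 'rV[R]_n) (f : 'rV[R]_n -> R)
    (g : 'rV[R]_m -> 'rV[R]_n) :
  open U -> open V -> (forall x, U x -> V (g x)) -> smooth_on V f ->
  smooth_mx U g -> smooth_on U (fun x => f (g x)).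
Proof.
move=> oU oV UV sf sg; apply/smooth_onP => k.
have CF h : smooth_on V h -> C0_derivable U (fun x => h (g x)).
  move=> sh x Ux; have dg := smooth_mx_differentiable oU Ux sg.
  have dh := smooth_on_differentiable oV (UV x Ux) sh.
  have dc : differentiable (h \o g) x by exact: differentiable_comp.
  split=> [|i]; last exact: diff_derivable.
  exact: differentiable_continuous.
elim: k f sf => [|k IH] f sf; (split; first exact: CF); first exact: I.
move=> i; have Cs : Ck k U (fun x => \sum_j partial j f (g x) *
    partial i (fun y => g y 0 j) x).
  apply: (Ck_sum _ _ (F := fun j x => partial j f (g x) *
    partial i (fun y => g y 0 j) x) oU) => j.
  apply: (CkM oU (IH _ (smooth_on_partial j sf))).
  exact: (smooth_onP _ _).1 (smooth_on_partial i (sg 0 j)) k.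
apply: (eq_Ck oU _ Cs) => x; rewrite inE => Ux.
by rewrite -(partial_comp i oU oV UV sf sg Ux).
Qed.

Lemma smooth_mx_comp (U : set 'rV[R]_m) (V : set 'rV[R]_n) (p q : nat)
    (f : 'rV[R]_n -> 'M[R]_(p, q)) (g : 'rV[R]_m -> 'rV[R]_n) :
  open U -> open V -> (forall x, U x -> V (g x)) -> smooth_mx V f ->
  smooth_mx U g -> smooth_mx U (fun x => f (g x)).
Proof.
move=> oU oV UV sf sg i j.
by apply: (smooth_on_comp oU oV UV (sf i j) sg).
Qed.

End Composition.

(** * Generalized Hermitian structures as pairs of Hermitian structures *)

Notation bdiag a b := (block_mx a 0 0 b).

Section Pairing.
Context {F : fieldType} {m : nat}.

(** The matrix of 2g. *)
Definition pairing : 'M[F]_(m + m) := block_mx 0 1%:M 1%:M 0.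

Lemma pairingK : pairing *m pairing = 1%:M.
Proof.
rewrite /pairing mulmx_block !mul0mx !mulmx0 !mulmx1 !addr0 !add0r.
by rewrite -scalar_mx_block.
Qed.

Lemma gformE (u v : 'rV[F]_(m + m)) :
  gform u v = 2^-1 * (u *m pairing *m v^T) 0 0.
Proof.
rewrite /gform; congr (_ * _).
rewrite -[in RHS](hsubmxK u) -[in RHS](hsubmxK v) mul_row_block.
rewrite !mulmx0 !mulmx1 addr0 add0r tr_row_mx mul_row_col addrC.
rewrite !mxE addrC; congr (_ + _); apply: eq_bigr => i _.
by rewrite !mxE mulrC.
Qed.

Lemma gformC (u v : 'rV[F]_(m + m)) : gform u v = gform v u.
Proof. by rewrite /gform addrC. Qed.

Lemma gformDl (u v w : 'rV[F]_(m + m)) :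
  gform (u + v) w = gform u w + gform v w.
Proof. by rewrite !gformE !mulmxDl [X in _ * X = _]mxE mulrDr. Qed.

Lemma gformDr (u v w : 'rV[F]_(m + m)) :
  gform w (u + v) = gform w u + gform w v.
Proof. by rewrite !(gformC w) gformDl. Qed.

Lemma gformZl (a : F) (u v : 'rV[F]_(m + m)) :
  gform (a *: u) v = a * gform u v.
Proof. by rewrite !gformE -!scalemxAl [X in _ * X = _]mxE mulrCA. Qed.

Lemma gformZr (a : F) (u v : 'rV[F]_(m + m)) :
  gform u (a *: v) = a * gform u v.
Proof. by rewrite !(gformC u) gformZl. Qed.

Lemma gformNl (u v : 'rV[F]_(m + m)) : gform (- u) v = - gform u v.
Proof. by rewrite -scaleN1r gformZl mulN1r. Qed.

Lemma gform_nondegenerate (u : 'rV[F]_(m + m)) : (2 : F) != 0 ->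
  (forall v, gform u v = 0) -> u = 0.
Proof.
move=> two uv; have : u *m pairing = 0.
  apply/rowP => j; have := uv (delta_mx 0 j); rewrite gformE trmx_delta -colE.
  by move/eqP; rewrite mulf_eq0 invr_eq0 (negPf two) /= !mxE => /eqP.
move/(congr1 (mulmx^~ pairing)); rewrite -mulmxA pairingK mulmx1.
by rewrite mul0mx.
Qed.

(** Skewness as an identity of matrices can be extended to complex scalars
    and differentiated. *)
Lemma gskewP (J : 'M[F]_(m + m)) : (2 : F) != 0 ->
  J *m pairing = - (pairing *m J^T) <->
  forall u v, gform (u *m J) v = - gform u (v *m J).
Proof.
move=> two; split=> [JK u v|Jg].
  rewrite !gformE -mulrN trmx_mul; congr (_ * _).
  by rewrite -[u *m J *m _]mulmxA JK mulmxN mulNmx !mulmxA mxE.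
apply/row_matrixP => i; apply/rowP => j.
have := Jg (delta_mx 0 i) (delta_mx 0 j).
rewrite !gformE -mulrN trmx_mul trmx_delta => /mulfI.
rewrite invr_eq0 => /(_ two).
have entry (B : 'M[F]_(m + m)) :
    row i B 0 j = ((delta_mx 0 i : 'rV[F]_(m + m)) *m B
      *m (delta_mx j 0 : 'cV_(m + m))) 0 0.
  by rewrite -[_ *m B]rowE -colE !mxE.
by rewrite !entry mulmxN mulNmx !mulmxA => ->; rewrite !mxE.
Qed.

End Pairing.
Arguments pairing {F m}.

Section HermitianData.
Context {R : realType} {m : nat}.
Implicit Types (G J : 'M[R]_(m + m)) (gam psi Jp Jm : 'M[R]_m).

(** The isomorphism (X_+, X_-) |-> X_+ tau_+ + X_- tau_- of W (+) W onto W
    (+) W^*. Conjugation by it makes G, H and J block diagonal. *)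
Definition taus gam psi : 'M[R]_(m + m) :=
  col_mx (tau (psi + gam)) (tau (psi - gam)).

(** The form in which a structure changes frame and restricts to subspaces.
    It determines G and J, see metric_of and endo_of below. *)
Definition herm_data G J gam psi Jp Jm : Prop :=
  [/\ euclidean gam, psi^T = - psi,
      taus gam psi *m G *m (taus gam psi)^T = bdiag (2 *: gam) (2 *: gam),
      taus gam psi *m J = bdiag Jp Jm *m taus gam psi &
      [/\ Jp *m Jp = - 1%:M, Jm *m Jm = - 1%:M,
          Jp *m gam = - (gam *m Jp^T) & Jm *m gam = - (gam *m Jm^T)]].

Lemma euclidean_unit (n : nat) (b : 'M[R]_n) : euclidean b -> b \in unitmx.
Proof.
move=> [_ bpos]; rewrite -row_free_unit; apply/row_freeP.
have /eqP kb : kermx b == 0.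
  apply/rowV0P => u /sub_kermxP ub0; apply/eqP; apply: contraTT isT => u0.
  by have := bpos u u0; rewrite /bilin ub0 mul0mx mxE ltxx.
have : row_free b by rewrite -kermx_eq0 kb.
by move/row_freeP.
Qed.

Lemma bdiagM (n1 n2 : nat) (a c : 'M[R]_n1) (b d : 'M[R]_n2) :
  bdiag a b *m bdiag c d = bdiag (a *m c) (b *m d).
Proof. by rewrite mulmx_block !mul0mx !mulmx0 !addr0 !add0r. Qed.

Lemma bdiag_unit (a b : 'M[R]_m) :
  a \in unitmx -> b \in unitmx -> bdiag a b \in unitmx.
Proof. by rewrite !unitmxE det_ublock unitrM => -> ->. Qed.

Lemma tau_pairing (a b : 'M[R]_m) :
  tau a *m pairing *m (tau b)^T = a + b^T.
Proof.
rewrite /tau /pairing mul_row_block !mulmx0 !mulmx1 addr0 add0r.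
by rewrite tr_row_mx mul_row_col trmx1 mulmx1 mul1mx.
Qed.

Lemma col_mx_form (n : nat) (a b c d : 'M[R]_(m, n)) (M : 'M[R]_n) :
  col_mx a b *m M *m (col_mx c d)^T =
  block_mx (a *m M *m c^T) (a *m M *m d^T) (b *m M *m c^T) (b *m M *m d^T).
Proof. by rewrite tr_col_mx mul_col_mx mul_col_row. Qed.

(** The two graphs tau_+- are orthogonal for g, which restricts to +- gam on
    them. *)
Lemma taus_pairing gam psi : gam^T = gam -> psi^T = - psi ->
  taus gam psi *m pairing *m (taus gam psi)^T =
  bdiag (2 *: gam) (- 2 *: gam).
Proof.
move=> gT pT; rewrite /taus col_mx_form !tau_pairing.
have -> : (psi + gam)^T = - psi + gam by rewrite linearD /= gT pT.
have -> : (psi - gam)^T = - psi - gam by rewrite linearB /= gT pT.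
congr block_mx.
- by rewrite addrACA subrr add0r scaler_nat mulr2n.
- by rewrite -opprD subrr.
- by rewrite addrACA subrr addNr addr0.
- by rewrite addrACA subrr add0r -opprD scaleNr scaler_nat mulr2n.
Qed.

Lemma taus_unit gam psi : euclidean gam -> psi^T = - psi ->
  taus gam psi \in unitmx.
Proof.
move=> eg pT; have := taus_pairing eg.1 pT => e.
have : bdiag (2 *: gam) (- 2 *: gam) \in unitmx.
  by apply: bdiag_unit; rewrite unitmxZ ?euclidean_unit// unitfE ?oppr_eq0
    pnatr_eq0.
by rewrite -e !unitmx_mul => /andP[/andP[]].
Qed.

End HermitianData.

Section HermitianDataTheory.
Context {R : realType} {m : nat}.
Implicit Types (G J : 'M[R]_(m + m)) (gam psi Jp Jm : 'M[R]_m).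

Lemma gen_metric_opE G : gen_metric_op G = G *m pairing.
Proof. by []. Qed.

(** That G is twice gam on both graphs is another way to say that its
    operator H is +- 1 on them. *)
Lemma taus_gen_metric_op G gam psi : euclidean gam -> psi^T = - psi ->
  taus gam psi *m G *m (taus gam psi)^T = bdiag (2 *: gam) (2 *: gam) <->
  taus gam psi *m gen_metric_op G = bdiag 1%:M (- 1%:M) *m taus gam psi.
Proof.
move=> eg pT; have uT := taus_unit eg pT; set T := taus gam psi in uT *.
have uTT : T^T \in unitmx by rewrite unitmx_tr.
have dT : bdiag 1%:M (- 1%:M) *m (T *m pairing *m T^T) =
    bdiag (2 *: gam) (2 *: gam).
  rewrite taus_pairing ?eg.1// bdiagM mul1mx mulNmx mul1mx.
  by rewrite -scaleNr opprK.
rewrite gen_metric_opE; split=> e.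
  have : T *m G = bdiag 1%:M (- 1%:M) *m T *m pairing.
    by apply: (can_inj (mulmxK uTT)); rewrite e -dT !mulmxA.
  by rewrite mulmxA => ->; rewrite -[LHS]mulmxA pairingK mulmx1.
rewrite -dT !mulmxA -e; congr (_ *m _).
by rewrite -!mulmxA pairingK mulmx1.
Qed.

Section Consequences.
Variables (G J : 'M[R]_(m + m)) (gam psi Jp Jm : 'M[R]_m).
Hypothesis hd : herm_data G J gam psi Jp Jm.
Let T := taus gam psi.
Let eg : euclidean gam. Proof. by case: hd. Qed.
Let pT : psi^T = - psi. Proof. by case: hd. Qed.
Let uT : T \in unitmx. Proof. exact: taus_unit. Qed.
Let TG : T *m G *m T^T = bdiag (2 *: gam) (2 *: gam). Proof. by case: hd. Qed.
Let TJ : T *m J = bdiag Jp Jm *m T. Proof. by case: hd. Qed.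

Lemma herm_data_op :
  T *m gen_metric_op G = bdiag 1%:M (- 1%:M) *m T.
Proof. exact/taus_gen_metric_op. Qed.

Lemma herm_data_tau_op :
  tau (psi + gam) *m gen_metric_op G = tau (psi + gam) /\
  tau (psi - gam) *m gen_metric_op G = - tau (psi - gam).
Proof.
have := herm_data_op; rewrite /T /taus mul_col_mx mul_block_col.
rewrite !mul0mx mul1mx mulNmx mul1mx addr0 add0r.
by move/eq_col_mx.
Qed.

Lemma bilin_taus (w : 'rV[R]_(m + m)) :
  bilin G (w *m T) (w *m T) =
  2 * bilin gam (lsubmx w) (lsubmx w) + 2 * bilin gam (rsubmx w) (rsubmx w).
Proof.
rewrite /bilin trmx_mul !mulmxA -[w *m T *m G]mulmxA -[w *m _ *m _]mulmxA TG.
rewrite -{1 2}[w]hsubmxK mul_row_block !mulmx0 addr0 add0r tr_row_mx.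
rewrite mul_row_col mxE -!scalemxAr -!scalemxAl.
by congr (_ + _); rewrite mxE.
Qed.

(** In the components (X_+, X_-) the form g has signature (m, m), with the
    two copies of W as definite subspaces. *)
Lemma gform_taus (w z : 'rV[R]_(m + m)) :
  gform (w *m T) (z *m T) =
  bilin gam (lsubmx w) (lsubmx z) - bilin gam (rsubmx w) (rsubmx z).
Proof.
rewrite gformE trmx_mul !mulmxA -[w *m T *m _]mulmxA -[w *m _ *m _]mulmxA.
rewrite taus_pairing ?eg.1// -{1}[w]hsubmxK -{1}[z]hsubmxK mul_row_block.
rewrite !mulmx0 addr0 add0r tr_row_mx mul_row_col mxE -!scalemxAr -!scalemxAl.
rewrite [X in X + _]mxE [X in _ + X]mxE mulrDr mulNr mulrN !mulrA.
by rewrite mulVf ?pnatr_eq0// !mul1r.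
Qed.

Lemma herm_data_euclidean : euclidean G.
Proof.
split.
  apply: (can_inj (mulKmx uT)).
  have uTT : T^T \in unitmx by rewrite unitmx_tr.
  apply: (can_inj (mulmxK uTT)); rewrite TG.
  have := congr1 trmx TG; rewrite !trmx_mul trmxK mulmxA => ->.
  by rewrite tr_block_mx !trmx0 linearZ /= eg.1.
move=> u u0; rewrite -(mulmxKV uT u) bilin_taus.
set w := u *m _; have w0 : w != 0.
  by apply: contra_neq u0 => w0; rewrite -(mulmxKV uT u) -/w w0 mul0mx.
have bge (x : 'rV[R]_m) : 0 <= bilin gam x x.
  have [->|x0] := eqVneq x 0; first by rewrite /bilin !mul0mx mxE.
  exact: ltW (eg.2 x x0).
have [l0|l0] := eqVneq (lsubmx w) 0.
  have r0 : rsubmx w != 0.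
    by apply: contra_neq w0 => r0; rewrite -[w]hsubmxK l0 r0 row_mx0.
  by rewrite ltr_wpDl ?mulr_ge0 ?bge// mulr_gt0// eg.2.
by rewrite ltr_pwDl ?mulr_ge0 ?bge// mulr_gt0// eg.2.
Qed.

Lemma sub_tau_plus (w : 'rV[R]_(m + m)) :
  (w *m T <= tau (psi + gam))%MS = (rsubmx w == 0).
Proof.
apply/idP/eqP => [/submxP[x]|r0]; last first.
  by rewrite -[w]hsubmxK r0 mul_row_col mul0mx addr0 submxMl.
have -> : x *m tau (psi + gam) = row_mx x 0 *m T.
  by rewrite mul_row_col mul0mx addr0.
by move/(can_inj (mulmxK uT)) => ->; rewrite row_mxKr.
Qed.

Lemma sub_tau_minus (w : 'rV[R]_(m + m)) :
  (w *m T <= tau (psi - gam))%MS = (lsubmx w == 0).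
Proof.
apply/idP/eqP => [/submxP[x]|l0]; last first.
  by rewrite -[w]hsubmxK l0 mul_row_col mul0mx add0r submxMl.
have -> : x *m tau (psi - gam) = row_mx 0 x *m T.
  by rewrite mul_row_col mul0mx add0r.
by move/(can_inj (mulmxK uT)) => ->; rewrite row_mxKl.
Qed.

Lemma bilin_gt0_le0 (x : 'rV[R]_m) : 0 <= - bilin gam x x -> x = 0.
Proof.
have [//|x0] := eqVneq x 0.
by rewrite oppr_ge0 leNgt eg.2.
Qed.

(** If B is g-positive and contains the graph of psi + gam, the part of a
    vector of B in the other graph lies again in B; it is g-negative unless
    it vanishes. *)
Lemma max_gdefinite_plus : max_gdefinite 1 (<<tau (psi + gam)>>)%MS.
Proof.
split=> [u|B Bp tB].
  rewrite genmxE -(mulmxKV uT u); set w := u *m _.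
  rewrite sub_tau_plus => /eqP r0 w0; rewrite mul1r gform_taus r0.
  rewrite {2}/bilin !mul0mx mxE subr0; apply: eg.2.
  apply: contra_neq w0 => l0.
  by rewrite -[w]hsubmxK l0 r0 row_mx0 mul0mx.
apply/rV_subP => u uB; rewrite genmxE -(mulmxKV uT u); set w := u *m _.
rewrite sub_tau_plus; apply/eqP.
pose v := row_mx (lsubmx w) 0 *m T.
have vB : (v <= B)%MS.
  by apply: submx_trans tB; rewrite genmxE sub_tau_plus row_mxKr.
have dB : (u - v <= B)%MS by rewrite addmx_sub// eqmx_opp.
have duv : u - v = row_mx 0 (rsubmx w) *m T.
  rewrite -(mulmxKV uT u) -/w /v -mulmxBl; congr (_ *m _).
  by rewrite -{1}[w]hsubmxK opp_row_mx add_row_mx subrr oppr0 addr0.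
have [d0|d0] := eqVneq (u - v) 0.
  have := duv; rewrite d0 -(mul0mx _ T) => /(can_inj (mulmxK uT)).
  by move/(congr1 rsubmx); rewrite row_mxKr linear0.
have := Bp _ dB d0; rewrite duv gform_taus row_mxKl row_mxKr mul1r.
rewrite {1}/bilin !mul0mx mxE sub0r => /ltW; exact: bilin_gt0_le0.
Qed.

Lemma max_gdefinite_minus : max_gdefinite (- 1) (<<tau (psi - gam)>>)%MS.
Proof.
split=> [u|B Bp tB].
  rewrite genmxE -(mulmxKV uT u); set w := u *m _.
  rewrite sub_tau_minus => /eqP l0 w0; rewrite mulN1r gform_taus l0.
  rewrite {1}/bilin !mul0mx mxE sub0r opprK; apply: eg.2.
  apply: contra_neq w0 => r0.
  by rewrite -[w]hsubmxK l0 r0 row_mx0 mul0mx.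
apply/rV_subP => u uB; rewrite genmxE -(mulmxKV uT u); set w := u *m _.
rewrite sub_tau_minus; apply/eqP.
pose v := row_mx 0 (rsubmx w) *m T.
have vB : (v <= B)%MS.
  by apply: submx_trans tB; rewrite genmxE sub_tau_minus row_mxKl.
have dB : (u - v <= B)%MS by rewrite addmx_sub// eqmx_opp.
have duv : u - v = row_mx (lsubmx w) 0 *m T.
  rewrite -(mulmxKV uT u) -/w /v -mulmxBl; congr (_ *m _).
  by rewrite -{1}[w]hsubmxK opp_row_mx add_row_mx subrr oppr0 addr0.
have [d0|d0] := eqVneq (u - v) 0.
  have := duv; rewrite d0 -(mul0mx _ T) => /(can_inj (mulmxK uT)).
  by move/(congr1 lsubmx); rewrite row_mxKl linear0.
have := Bp _ dB d0; rewrite duv gform_taus row_mxKl row_mxKr mulN1r.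
rewrite [X in _ - X]/bilin !mul0mx [X in _ - X]mxE subr0 => /ltW.
exact: bilin_gt0_le0.
Qed.

Lemma herm_data_split :
  gen_metric_split G <<tau (psi + gam)>>%MS <<tau (psi - gam)>>%MS.
Proof.
have bG (u v : 'rV[R]_(m + m)) :
    bilin G u v = 2 * gform (u *m gen_metric_op G) v.
  rewrite gformE mulrA divff ?pnatr_eq0// mul1r /bilin.
  by rewrite gen_metric_opE mulmxA -[_ *m pairing *m pairing]mulmxA pairingK
    mulmx1.
have [op om] := herm_data_tau_op.
have opE (u : 'rV[R]_(m + m)) : (u <= tau (psi + gam))%MS ->
    u *m gen_metric_op G = u.
  by move=> /submxP[x ->]; rewrite -mulmxA op.
have omE (u : 'rV[R]_(m + m)) : (u <= tau (psi - gam))%MS ->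
    u *m gen_metric_op G = - u.
  by move=> /submxP[x ->]; rewrite -mulmxA om mulmxN.
have rT : row_free T by rewrite row_free_unit.
have eT : (tau (psi + gam) + tau (psi - gam) :=: T)%MS by exact: addsmxE.
split.
- have e1 : (<<tau (psi + gam)>> + <<tau (psi - gam)>> :=: 1%:M)%MS.
    apply: eqmx_trans (adds_eqmx (genmxE _) (genmxE _)) _.
    apply: eqmx_trans eT _; apply/eqmxP; rewrite submx1 /= sub1mx.
    by rewrite row_full_unit.
  apply/andP; split; first exact/eqmxP.
  rewrite mxdirectE /= e1 mxrank1 !genmxE.
  have rtau a : \rank (tau a : 'M[R]_(m, m + m)) = m.
    have : row_free (tau a : 'M[R]_(m, m + m)).
      apply/row_freeP; exists (col_mx 1%:M 0).
      by rewrite /tau mul_row_col mulmx1 mulmx0 addr0.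
    by move/eqP.
  by rewrite !rtau.
- exact: max_gdefinite_plus.
- exact: max_gdefinite_minus.
- move=> u v; split; rewrite !genmxE.
  + move=> up vm; rewrite -(mulmxKV uT u) -(mulmxKV uT v) in up vm *.
    rewrite sub_tau_plus in up; rewrite sub_tau_minus in vm.
    rewrite gform_taus (eqP up) (eqP vm) /bilin trmx0 !mulmx0 !mul0mx.
    by rewrite mxE subrr.
  + move=> up vm; rewrite bG opE//.
    rewrite -(mulmxKV uT u) -(mulmxKV uT v) in up vm *.
    rewrite sub_tau_plus in up; rewrite sub_tau_minus in vm.
    rewrite gform_taus (eqP up) (eqP vm) /bilin trmx0 !mulmx0 !mul0mx.
    by rewrite mxE subrr mulr0.
  + by move=> up _; rewrite bG opE.
  + by move=> um _; rewrite bG omE// gformNl mulrN mulNr.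
Qed.

Lemma herm_data_gen_metric : gen_metric G.
Proof.
split; first exact: herm_data_euclidean.
by do 2 eexists; exact: herm_data_split.
Qed.

Lemma herm_data_WE : (Wplus G :=: tau (psi + gam))%MS /\
  (Wminus G :=: tau (psi - gam))%MS.
Proof.
have [ep em] := Wplus_minusE herm_data_euclidean herm_data_split.
by split; [exact: eqmx_trans ep (genmxE _) | exact: eqmx_trans em (genmxE _)].
Qed.

Lemma herm_data_gen_complex : gen_complex J.
Proof.
have [_ _ _ _ [Jp2 Jm2 Jpg Jmg]] := hd.
have uTT : T^T \in unitmx by rewrite unitmx_tr.
split.
  apply: (can_inj (mulKmx uT)); rewrite mulmxA TJ -mulmxA TJ mulmxA bdiagM.
  rewrite Jp2 Jm2 mulmxN mulmx1.
  by rewrite -[LHS]opprK -mulNmx opp_block_mx !opprK !oppr0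
    -scalar_mx_block mul1mx.
apply/gskewP; first by rewrite pnatr_eq0.
apply: (can_inj (mulKmx uT)); apply: (can_inj (mulmxK uTT)).
rewrite mulmxN mulNmx !mulmxA TJ -[in RHS](mulmxA (T *m pairing)).
rewrite -trmx_mul TJ trmx_mul mulmxA -[_ *m T *m pairing]mulmxA.
rewrite -[_ *m (T *m pairing) *m _]mulmxA taus_pairing ?eg.1//.
rewrite tr_block_mx !trmx0 !bdiagM opp_block_mx !oppr0.
by rewrite -!scalemxAr -!scalemxAl Jpg Jmg !scalerN.
Qed.

Lemma herm_data_hermitian : gen_hermitian G J.
Proof.
split; [exact: herm_data_gen_metric | exact: herm_data_gen_complex |].
apply: (can_inj (mulKmx uT)); rewrite [LHS]mulmxA TJ.
rewrite -[LHS]mulmxA herm_data_op [RHS]mulmxA herm_data_op -[RHS]mulmxA TJ.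
rewrite !mulmxA !bdiagM.
by rewrite !mulmxN !mulNmx !mulmx1 !mul1mx.
Qed.

(** H is 1 on W_+ and - 1 on W_-. *)
Lemma herm_data_second :
  T *m second_gcs G J = bdiag Jp (- Jm) *m T.
Proof.
rewrite /second_gcs mulmxA TJ -mulmxA herm_data_op mulmxA bdiagM.
by rewrite mulmx1 mulmxN mulmx1.
Qed.

End Consequences.
End HermitianDataTheory.

(** * Change of frame and restriction to a subspace *)

Section HermitianDataConstructions.
Context {R : realType}.

(** As J commutes with H, it preserves the graphs W_+-, on which it acts as
    J_+-; compatibility of J_+- with gam is the g-skewness of J, read off in
    the blocks of taus. *)
Lemma gen_hermitian_data (m : nat) (G J : 'M[R]_(m + m)) :
  gen_hermitian G J ->
  herm_data G J (gamma_psi G).1 (gamma_psi G).2 (Jplus G J) (Jminus G J).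
Proof.
move=> [gG [J2 Jg] JH]; have [eg pT Wp Wm] := gamma_psiP gG.
rewrite /Jplus /Jminus; move: (gamma_psi G).1 (gamma_psi G).2 eg pT Wp Wm.
move=> gam psi eg pT Wp Wm.
have tp : tau (psi + gam) *m gen_metric_op G = tau (psi + gam).
  have : (tau (psi + gam) <= Wplus G)%MS by rewrite Wp.
  by move/eigenspaceP; rewrite scale1r.
have tm : tau (psi - gam) *m gen_metric_op G = - tau (psi - gam).
  have : (tau (psi - gam) <= Wminus G)%MS by rewrite Wm.
  by move/eigenspaceP; rewrite scaleN1r.
have tauK (a : 'M[R]_m) : tau a *m col_mx 1%:M 0 = 1%:M.
  by rewrite /tau mul_row_col mulmx1 mulmx0 addr0.
have pJ : tau (psi + gam) *m J =
    (tau (psi + gam) *m J *m col_mx 1%:M 0) *m tau (psi + gam).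
  have : (tau (psi + gam) *m J <= tau (psi + gam))%MS.
    rewrite -Wp; apply/eigenspaceP.
    by rewrite scale1r -[LHS]mulmxA JH mulmxA tp.
  by move=> /submxP[D eD]; rewrite eD -[X in X *m tau _]mulmxA tauK mulmx1.
have mJ : tau (psi - gam) *m J =
    (tau (psi - gam) *m J *m col_mx 1%:M 0) *m tau (psi - gam).
  have : (tau (psi - gam) *m J <= tau (psi - gam))%MS.
    rewrite -Wm; apply/eigenspaceP.
    by rewrite scaleN1r -[LHS]mulmxA JH mulmxA tm mulNmx.
  by move=> /submxP[D eD]; rewrite eD -[X in X *m tau _]mulmxA tauK mulmx1.
move: (tau (psi + gam) *m J *m _) (tau (psi - gam) *m J *m _) pJ mJ.
move=> Jp Jm pJ mJ.
have TJ : taus gam psi *m J = bdiag Jp Jm *m taus gam psi.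
  by rewrite /taus mul_col_mx mul_block_col !mul0mx addr0 add0r pJ mJ.
have sq (a D : 'M[R]_m) : tau a *m J = D *m tau a -> D *m D = - 1%:M.
  move=> eD; rewrite -[LHS]mulmx1 -(tauK a) mulmxA -[D *m D *m _]mulmxA -eD.
  by rewrite mulmxA -eD -[_ *m J *m J]mulmxA J2 mulmxN mulmx1 mulNmx tauK.
have Jskew : J *m pairing = - (pairing *m J^T).
  by apply/gskewP => //; rewrite pnatr_eq0.
have skew : bdiag Jp Jm *m bdiag (2 *: gam) (- 2 *: gam) =
    - (bdiag (2 *: gam) (- 2 *: gam) *m (bdiag Jp Jm)^T).
  rewrite -(taus_pairing eg.1 pT) !mulmxA -TJ -[_ *m J *m pairing]mulmxA.
  rewrite Jskew mulmxN mulNmx; congr (- _).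
  by rewrite -[RHS]mulmxA -trmx_mul -TJ trmx_mul !mulmxA.
move: skew; rewrite tr_block_mx !trmx0 !bdiagM opp_block_mx !oppr0.
move/eq_block_mx => [sp _ _ sm]; split=> //.
  apply/(taus_gen_metric_op _ eg pT).
  by rewrite /taus mul_col_mx tp tm mul_block_col !mul0mx addr0 add0r
    mulNmx !mul1mx.
split; [exact: sq pJ | exact: sq mJ | |].
  apply: (@scalerI _ _ 2); first by rewrite pnatr_eq0.
  by rewrite scalemxAr sp scalerN scalemxAl.
apply: (@scalerI _ _ (- 2)); first by rewrite oppr_eq0 pnatr_eq0.
by rewrite scalemxAr sm scalerN scalemxAl.
Qed.

(** The change of components of the sum of tangent and cotangent space
    induced by the change C of components of tangent vectors. *)
Definition courant_frame (m : nat) (C : 'M[R]_m) : 'M[R]_(m + m) :=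
  block_mx C 0 0 (invmx C)^T.

Section Frame.
Variables (m : nat) (C : 'M[R]_m).
Hypothesis uC : C \in unitmx.

Lemma courant_frame_unit : courant_frame C \in unitmx.
Proof. by apply: bdiag_unit => //; rewrite unitmx_tr unitmx_inv. Qed.

Lemma taus_frame (gam psi : 'M[R]_m) :
  taus (invmx C *m gam *m (invmx C)^T) (invmx C *m psi *m (invmx C)^T) =
  bdiag (invmx C) (invmx C) *m taus gam psi *m courant_frame C.
Proof.
rewrite /taus mul_block_col !mul0mx addr0 add0r mul_col_mx.
have tauE (a : 'M[R]_m) : invmx C *m tau a *m courant_frame C =
    tau (invmx C *m a *m (invmx C)^T).
  rewrite /tau mul_mx_row mul_row_block !mulmx0 addr0 add0r mulmx1.
  by rewrite mulVmx.
rewrite !tauE; congr (col_mx (tau _) (tau _)).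
  by rewrite mulmxDr mulmxDl.
by rewrite mulmxBr mulmxBl.
Qed.

Lemma herm_data_frame (G J : 'M[R]_(m + m)) (gam psi Jp Jm : 'M[R]_m) :
  herm_data G J gam psi Jp Jm ->
  herm_data
    (invmx (courant_frame C) *m G *m (invmx (courant_frame C))^T)
    (invmx (courant_frame C) *m J *m courant_frame C)
    (invmx C *m gam *m (invmx C)^T) (invmx C *m psi *m (invmx C)^T)
    (invmx C *m Jp *m C) (invmx C *m Jm *m C).
Proof.
move=> [eg pT TG TJ [Jp2 Jm2 Jpg Jmg]]; have uF := courant_frame_unit.
have sq (D : 'M[R]_m) : D *m D = - 1%:M ->
    invmx C *m D *m C *m (invmx C *m D *m C) = - 1%:M.
  move=> D2; rewrite !mulmxA mulmxK// -[_ *m D *m D]mulmxA D2.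
  by rewrite mulmxN mulNmx mulmx1 mulVmx.
have sk (D : 'M[R]_m) : D *m gam = - (gam *m D^T) ->
    invmx C *m D *m C *m (invmx C *m gam *m (invmx C)^T) =
    - (invmx C *m gam *m (invmx C)^T *m (invmx C *m D *m C)^T).
  move=> Dg; rewrite !trmx_mul !mulmxA mulmxK// -[_ *m D *m gam]mulmxA Dg.
  rewrite mulmxN mulNmx; congr (- _).
  rewrite -[_ *m (invmx C)^T *m C^T]mulmxA -trmx_mul mulmxV// trmx1 mulmx1.
  by rewrite !mulmxA.
split; rewrite ?taus_frame.
- split=> [|u u0]; first by rewrite !trmx_mul trmxK eg.1 mulmxA.
  have -> : bilin (invmx C *m gam *m (invmx C)^T) u u =
      bilin gam (u *m invmx C) (u *m invmx C).
    by rewrite /bilin trmx_mul !mulmxA.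
  apply: eg.2; apply: contra_neq u0 => uC0.
  by rewrite -(mulmxKV uC u) uC0 mul0mx.
- by rewrite !trmx_mul trmxK pT mulmxA mulmxN mulNmx.
- rewrite !trmx_mul !mulmxA mulmxK//.
  rewrite -[_ *m (invmx (courant_frame C))^T *m (courant_frame C)^T]mulmxA.
  rewrite -trmx_mul mulmxV// trmx1 mulmx1.
  rewrite -[_ *m G]mulmxA -[_ *m (_ *m G) *m _]mulmxA TG.
  rewrite tr_block_mx !trmx0 !bdiagM.
  by rewrite -!scalemxAr -!scalemxAl.
- rewrite !mulmxA mulmxK// -[_ *m taus gam psi *m J]mulmxA TJ.
  by rewrite !mulmxA !bdiagM !mulmxK.
- by split; [exact: sq | exact: sq | exact: sk | exact: sk].
Qed.

(** Changes of frame are isometries of g, which is why taking H, and hence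
    the second structure, commutes with them. *)
Lemma courant_frame_pairing :
  (courant_frame C)^T *m pairing *m courant_frame C = pairing.
Proof.
rewrite /courant_frame /pairing tr_block_mx !trmx0 trmxK !mulmx_block.
rewrite !mul0mx !mulmx0 !mulmx1 !addr0 !add0r !mul0mx mulVmx//.
by rewrite -trmx_mul mulVmx// trmx1.
Qed.

Lemma second_gcs_frame (G J : 'M[R]_(m + m)) :
  second_gcs (invmx (courant_frame C) *m G *m (invmx (courant_frame C))^T)
    (invmx (courant_frame C) *m J *m courant_frame C) =
  invmx (courant_frame C) *m second_gcs G J *m courant_frame C.
Proof.
have uF := courant_frame_unit; have FKF := courant_frame_pairing.
set F := courant_frame C in uF FKF *.
rewrite /second_gcs !gen_metric_opE !mulmxA mulmxK// -[RHS]mulmxA.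
rewrite -[_ *m _^T *m pairing]mulmxA; congr (_ *m _).
have uFT : F^T \in unitmx by rewrite unitmx_tr.
by apply: (can_inj (mulKmx uFT)); rewrite !mulmxA FKF -trmx_mul mulVmx// trmx1
  mul1mx.
Qed.

End Frame.

Definition metric_of (m : nat) (gam psi : 'M[R]_m) : 'M[R]_(m + m) :=
  invmx (taus gam psi) *m bdiag (2 *: gam) (2 *: gam)
    *m (invmx (taus gam psi))^T.

Definition endo_of (m : nat) (gam psi Jp Jm : 'M[R]_m) : 'M[R]_(m + m) :=
  invmx (taus gam psi) *m bdiag Jp Jm *m taus gam psi.

Section Recover.
Variables (m : nat) (G J : 'M[R]_(m + m)) (gam psi Jp Jm : 'M[R]_m).
Hypothesis hd : herm_data G J gam psi Jp Jm.
Let uT : taus gam psi \in unitmx.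
Proof. by case: hd => eg pT _ _ _; exact: taus_unit. Qed.

Lemma herm_data_metric : G = metric_of gam psi.
Proof.
have [_ _ TG _ _] := hd.
rewrite /metric_of -TG !mulmxA mulVmx// mul1mx -[RHS]mulmxA.
by rewrite -trmx_mul mulVmx// trmx1 mulmx1.
Qed.

Lemma herm_data_endo : J = endo_of gam psi Jp Jm.
Proof. by have [_ _ _ TJ _] := hd; rewrite /endo_of -mulmxA -TJ mulKmx. Qed.

(** The pair (gam, psi) is a rational function of G, hence smooth when G is. *)
Lemma herm_data_gam_psi :
  gam = invmx (drsubmx G) /\ psi = invmx (drsubmx G) *m dlsubmx G.
Proof.
have [eg pT TG _ _] := hd; have ug := euclidean_unit eg.
move: TG; rewrite /taus col_mx_form => /eq_block_mx[pp pm mp mm].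
(* The rows of tau_+ - tau_- and tau_+ + tau_- single out the blocks of G. *)
have tauB : tau (psi + gam) - tau (psi - gam) = row_mx 0 (2 *: gam).
  rewrite /tau opp_row_mx add_row_mx subrr opprB.
  by rewrite addrC addrA subrK scaler_nat mulr2n.
have tauD : tau (psi + gam) + tau (psi - gam) = row_mx 2%:M (2 *: psi).
  rewrite /tau add_row_mx addrACA subrr addr0 scaler_nat mulr2n.
  by rewrite -raddfD.
have two (a b : 'M[R]_m) : 2 *: a = 2 *: b -> a = b.
  by apply: scalerI; rewrite pnatr_eq0.
have ed : gam *m drsubmx G = 1%:M.
  have : row_mx 0 (2 *: gam) *m G *m (row_mx 0 (2 *: gam))^T =
      2 *: (2 *: gam).
    rewrite -tauB linearB /= !mulmxBl !mulmxBr pp pm mp mm subr0 sub0r opprK.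
    by rewrite [RHS]scaler_nat mulr2n.
  rewrite -{1}[G]submxK mul_row_block !mul0mx !add0r tr_row_mx mul_row_col.
  rewrite trmx0 mulmx0 add0r linearZ /= eg.1 -scalemxAr => /two.
  rewrite -!scalemxAl => /two.
  by rewrite -{3}[gam]mul1mx => /(can_inj (mulmxK ug)).
have ud : drsubmx G \in unitmx by have [] := mulmx1_unit ed.
have egam : gam = invmx (drsubmx G).
  by rewrite -[LHS]mulmx1 -(mulmxV ud) mulmxA ed mul1mx.
split=> //; rewrite -egam.
have : row_mx 0 (2 *: gam) *m G *m (row_mx 2%:M (2 *: psi))^T = 0.
  rewrite -tauB -tauD linearD /= !mulmxBl !mulmxDr pp pm mp mm addr0 add0r.
  by rewrite subrr.
rewrite -{1}[G]submxK mul_row_block !mul0mx !add0r tr_row_mx mul_row_col.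
rewrite tr_scalar_mx linearZ /= pT -!scalemxAl mul_mx_scalar ed.
rewrite mul1mx -scalerDr scalerN -scalerBr.
by move/eqP; rewrite !scaler_eq0 pnatr_eq0 /= subr_eq0 => /eqP ->.
Qed.

Lemma herm_data_Jpm :
  Jp = tau (psi + gam) *m J *m col_mx 1%:M 0 /\
  Jm = tau (psi - gam) *m J *m col_mx 1%:M 0.
Proof.
have [_ _ _ TJ _] := hd; move: TJ.
rewrite /taus mul_col_mx mul_block_col !mul0mx addr0 add0r => /eq_col_mx[-> ->].
have tauK (a : 'M[R]_m) : tau a *m col_mx 1%:M 0 = 1%:M.
  by rewrite /tau mul_row_col mulmx1 mulmx0 addr0.
by rewrite -!mulmxA !tauK !mulmx1.
Qed.

End Recover.

Lemma taus_vector (m : nat) (gam psi : 'M[R]_m) :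
  taus gam psi *m col_mx 1%:M 0 = col_mx 1%:M 1%:M.
Proof. by rewrite mul_col_mx !mul_row_col !mulmx1 !mulmx0 !addr0. Qed.

Lemma taus_covector (m : nat) (gam psi : 'M[R]_m) :
  taus gam psi *m col_mx 0 1%:M = col_mx (psi + gam) (psi - gam).
Proof. by rewrite mul_col_mx !mul_row_col !mulmx1 !mulmx0 !add0r. Qed.

Section Restriction.
Variables (n m : nat) (A : 'M[R]_(n, m)).
Hypothesis fA : row_free A.

(** For D preserving the row space of A, the endomorphism induced on it. It
    is written with the orthogonal projection for gam, so that it depends
    smoothly on A, gam and D. *)
Definition restrict_endo (gam D : 'M[R]_m) : 'M[R]_n :=
  A *m D *m gam *m A^T *m invmx (A *m gam *m A^T).

Lemma euclidean_restrict (gam : 'M[R]_m) : euclidean gam ->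
  euclidean (A *m gam *m A^T).
Proof.
move=> eg; split=> [|u u0]; first by rewrite !trmx_mul trmxK eg.1 mulmxA.
have -> : bilin (A *m gam *m A^T) u u = bilin gam (u *m A) (u *m A).
  by rewrite /bilin trmx_mul !mulmxA.
apply: eg.2; apply: contra_neq u0 => uA0.
by apply: (row_free_inj fA); rewrite uA0 mul0mx.
Qed.

Lemma restrict_endoP (gam D : 'M[R]_m) : euclidean gam ->
  (A *m D <= A)%MS -> restrict_endo gam D *m A = A *m D.
Proof.
move=> eg /submxP[E eE]; have ug := euclidean_unit (euclidean_restrict eg).
by rewrite /restrict_endo eE -[E *m A *m _]mulmxA -[E *m _ *m _]mulmxA mulmxK.
Qed.

(** As A has full row rank, the relation J' A = A J transports the square
    and the skewness of J to its restriction J'. *)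
Lemma herm_data_restrict (G J : 'M[R]_(m + m)) (gam psi Jp Jm : 'M[R]_m) :
  herm_data G J gam psi Jp Jm ->
  (A *m Jp <= A)%MS -> (A *m Jm <= A)%MS ->
  let gam' := A *m gam *m A^T in let psi' := A *m psi *m A^T in
  let Jp' := restrict_endo gam Jp in let Jm' := restrict_endo gam Jm in
  herm_data (metric_of gam' psi') (endo_of gam' psi' Jp' Jm')
    gam' psi' Jp' Jm'.
Proof.
move=> [eg pT _ _ [Jp2 Jm2 Jpg Jmg]] Ap Am gam' psi' Jp' Jm'.
have eg' : euclidean gam' by exact: euclidean_restrict.
have pT' : psi'^T = - psi'.
  by rewrite /psi' !trmx_mul trmxK pT mulmxA mulmxN mulNmx.
have uT := taus_unit eg' pT'.
have eJp := restrict_endoP eg Ap; have eJm := restrict_endoP eg Am.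
have sq (D' : 'M[R]_n) D : D' *m A = A *m D -> D *m D = - 1%:M ->
    D' *m D' = - 1%:M.
  move=> eD D2; apply: (row_free_inj fA).
  by rewrite -mulmxA eD mulmxA eD -mulmxA D2 mulmxN mulmx1 mulNmx mul1mx.
have sk (D' : 'M[R]_n) D : D' *m A = A *m D -> D *m gam = - (gam *m D^T) ->
    D' *m gam' = - (gam' *m D'^T).
  move=> eD Dg; rewrite /gam' !mulmxA eD -[A *m D *m gam]mulmxA Dg.
  rewrite mulmxN mulNmx; congr (- _).
  by rewrite -!mulmxA -!trmx_mul eD.
split=> //.
- rewrite /metric_of !mulmxA mulmxV// mul1mx -[LHS]mulmxA -trmx_mul.
  by rewrite mulmxV// trmx1 mulmx1.
- by rewrite /endo_of !mulmxA mulmxV// mul1mx.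
- by split; [exact: sq eJp Jp2 | exact: sq eJm Jm2
            | exact: sk eJp Jpg | exact: sk eJm Jmg].
Qed.

(** The map that sends the vector with components (X_+, X_-) on the subspace
    to the vector with components (X_+ A, X_- A) in the ambient space. It is
    a section of the relation which defines pullbacks. *)
Definition lift_mx (gam psi : 'M[R]_m) : 'M[R]_(n + n, m + m) :=
  invmx (taus (A *m gam *m A^T) (A *m psi *m A^T))
    *m block_mx A 0 0 A *m taus gam psi.

Section Lift.
Variables (gam psi : 'M[R]_m).
Hypotheses (eg : euclidean gam) (pT : psi^T = - psi).
Let T' := taus (A *m gam *m A^T) (A *m psi *m A^T).

Lemma taus_restrict_unit : T' \in unitmx.
Proof.
apply: taus_unit; first exact: euclidean_restrict.
by rewrite !trmx_mul trmxK pT mulmxA mulmxN mulNmx.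
Qed.

Lemma lift_vector : lift_mx gam psi *m col_mx 1%:M 0 = col_mx 1%:M 0 *m A.
Proof.
have uT := taus_restrict_unit; apply: (can_inj (mulKmx uT)).
rewrite /lift_mx !mulmxA mulmxV// mul1mx -[LHS]mulmxA.
rewrite /T' !taus_vector mul_block_col !mul0mx addr0 add0r !mulmx1.
by rewrite mul_col_mx !mul1mx.
Qed.

(** Restricting the covector part of the lift to the subspace gives back the
    original covector, because the restrictions of psi +- gam are those used
    in the definition of tau'_+-. *)
Lemma lift_covector :
  lift_mx gam psi *m col_mx 0 1%:M *m A^T = col_mx 0 1%:M.
Proof.
have uT := taus_restrict_unit; apply: (can_inj (mulKmx uT)).
rewrite /lift_mx !mulmxA mulmxV// mul1mx -[_ *m taus _ _ *m _]mulmxA.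
rewrite !taus_covector mul_block_col !mul0mx addr0 add0r mul_col_mx.
by rewrite !mulmxDr !mulmxDl !mulmxN mulNmx.
Qed.

Lemma lift_endo (J : 'M[R]_(m + m)) (J' : 'M[R]_(n + n)) (Jp Jm : 'M[R]_m)
    (Jp' Jm' : 'M[R]_n) :
  taus gam psi *m J = bdiag Jp Jm *m taus gam psi ->
  T' *m J' = bdiag Jp' Jm' *m T' ->
  Jp' *m A = A *m Jp -> Jm' *m A = A *m Jm ->
  J' *m lift_mx gam psi = lift_mx gam psi *m J.
Proof.
move=> TJ TJ' ep em; have uT := taus_restrict_unit.
apply: (can_inj (mulKmx uT)); rewrite /lift_mx -/T' !mulmxA TJ'.
rewrite !mulmxK// mulmxV// mul1mx -[RHS]mulmxA TJ mulmxA.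
by rewrite !mulmx_block !mul0mx !mulmx0 !addr0 !add0r ep em.
Qed.

End Lift.
End Restriction.

End HermitianDataConstructions.

(** * Holomorphic subspaces and the associated decomposition *)

Section ComplexStructures.
Context {R : realType}.
Local Notation C := R[i].

Lemma toCM (p q r : nat) (A : 'M[R]_(p, q)) (B : 'M[R]_(q, r)) :
  toC (A *m B) = toC A *m toC B.
Proof. exact: map_mxM. Qed.

Lemma conj_toC (p q : nat) (A : 'M[R]_(p, q)) : conjmx (toC A) = toC A.
Proof. by apply/matrixP => i j; rewrite !mxE conjc_real. Qed.

Lemma conjc_mxK (p q : nat) (A : 'M[C]_(p, q)) : conjmx (conjmx A) = A.
Proof. by apply/matrixP => i j; rewrite !mxE conjcK. Qed.

Lemma conjc_mxM (p q r : nat) (A : 'M[C]_(p, q)) (B : 'M[C]_(q, r)) :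
  conjmx (A *m B) = conjmx A *m conjmx B.
Proof. exact: map_mxM. Qed.

Lemma conjc_mxZ (p q : nat) (a : C) (A : 'M[C]_(p, q)) :
  conjmx (a *: A) = conjc a *: conjmx A.
Proof. exact: map_mxZ. Qed.

Lemma conjmx_sub (p q r : nat) (A : 'M[C]_(p, r)) (B : 'M[C]_(q, r)) :
  (conjmx A <= conjmx B)%MS = (A <= B)%MS.
Proof. exact: map_submx. Qed.

Lemma sub_conjmx (p q r : nat) (A : 'M[C]_(p, r)) (B : 'M[C]_(q, r)) :
  (A <= conjmx B)%MS = (conjmx A <= B)%MS.
Proof. by rewrite -{1}(conjc_mxK A) conjmx_sub. Qed.

Lemma eqmx_rV (F : fieldType) (p q r : nat) (A : 'M[F]_(p, r))
    (B : 'M[F]_(q, r)) :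
  (forall u : 'rV_r, (u <= A)%MS = (u <= B)%MS) -> (A :=: B)%MS.
Proof.
by move=> AB; apply/eqmxP/andP; split; apply/rV_subP => u; rewrite AB.
Qed.

Lemma eqmx_conj (p q r : nat) (A : 'M[C]_(p, r)) (B : 'M[C]_(q, r)) :
  (A :=: B)%MS -> (conjmx A :=: conjmx B)%MS.
Proof. by move=> AB; apply: eqmx_rV => u; rewrite !sub_conjmx AB. Qed.

Lemma eqmx_toC (p q r : nat) (A : 'M[R]_(p, r)) (B : 'M[R]_(q, r)) :
  (A :=: B)%MS -> (toC A :=: toC B)%MS.
Proof.
by move=> AB; apply/eqmxP; rewrite !map_submx; apply/eqmxP.
Qed.

Lemma mulCii : 'i%C * 'i%C = -1 :> C.
Proof. by rewrite -expr2 sqr_i. Qed.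

Lemma twoC : (2 : C) != 0.
Proof. by rewrite pnatr_eq0. Qed.

Lemma neqCi : 'i%C != 0 :> C.
Proof. by apply/eqP => /eqP; rewrite eq_complex /= oner_eq0 andbF. Qed.

Lemma i_eigenP (n : nat) (J : 'M[R]_n) (u : 'rV[C]_n) :
  reflect (u *m toC J = 'i%C *: u) (u <= i_eigenspace J)%MS.
Proof. exact: eigenspaceP. Qed.

Lemma conj_i_eigenP (n : nat) (J : 'M[R]_n) (u : 'rV[C]_n) :
  reflect (u *m toC J = - 'i%C *: u) (u <= conjmx (i_eigenspace J))%MS.
Proof.
have ci : conjc ('i%C : C) = - 'i%C.
  by apply/eqP; rewrite eq_complex /= oppr0 !eqxx.
rewrite sub_conjmx; apply: (iffP (i_eigenP _ _)) => e.
  by rewrite -(conjc_mxK u) -conj_toC -conjc_mxM e conjc_mxZ ci.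
by rewrite -conj_toC -conjc_mxM e conjc_mxZ -ci conjcK.
Qed.

Section Square.
Variables (n : nat) (J : 'M[R]_n).
Hypothesis J2 : J *m J = - 1%:M.
Let E := i_eigenspace J.

Lemma toC_square : toC J *m toC J = - 1%:M.
Proof. by rewrite -toCM J2 map_mxN map_mx1. Qed.

Lemma i_eigen_proj (w : 'rV[C]_n) :
  (2^-1 *: (w - 'i%C *: (w *m toC J)) <= E)%MS.
Proof.
apply/i_eigenP; rewrite -scalemxAl mulmxBl -scalemxAl -mulmxA toC_square.
rewrite mulmxN mulmx1 scalerN opprK scalerA [in RHS]mulrC -scalerA.
congr (_ *: _).
by rewrite scalerBr scalerA mulCii scaleN1r opprK addrC.
Qed.

Lemma conj_i_eigen_proj (w : 'rV[C]_n) :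
  (2^-1 *: (w + 'i%C *: (w *m toC J)) <= conjmx E)%MS.
Proof.
apply/conj_i_eigenP; rewrite -scalemxAl mulmxDl -scalemxAl -mulmxA toC_square.
rewrite mulmxN mulmx1 scalerN scalerA [in RHS]mulrC -scalerA.
congr (_ *: _).
by rewrite scalerDr scalerA mulNr mulCii opprK scale1r scaleNr addrC.
Qed.

(** The two summands are the projections of w onto the i- and the
    -i-eigenspace. *)
Lemma i_eigen_split (w : 'rV[C]_n) :
  w = 2^-1 *: (w - 'i%C *: (w *m toC J)) + 2^-1 *: (w + 'i%C *: (w *m toC J)).
Proof.
rewrite -scalerDr addrACA addNr addr0 -mulr2n -[w *+ 2]scaler_nat scalerA.
by rewrite mulVf ?twoC// scale1r.
Qed.

Lemma i_eigen_full : (E + conjmx E :=: 1%:M)%MS.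
Proof.
apply/eqmxP; rewrite submx1 /=; apply/rV_subP => w _.
rewrite (i_eigen_split w) addmx_sub//.
  by rewrite (submx_trans (i_eigen_proj w))// addsmxSl.
by rewrite (submx_trans (conj_i_eigen_proj w))// addsmxSr.
Qed.

Lemma i_eigen_cap : (E :&: conjmx E = 0)%MS.
Proof.
apply/eqP/rowV0P => w; rewrite sub_capmx => /andP[/i_eigenP e /conj_i_eigenP].
rewrite e scaleNr => /eqP.
rewrite -addr_eq0 -mulr2n -[_ *+ 2]scaler_nat !scaler_eq0.
by rewrite (negPf twoC) (negPf neqCi) /= => /eqP.
Qed.

Lemma rank_conjmx (p q : nat) (A : 'M[C]_(p, q)) : \rank (conjmx A) = \rank A.
Proof. exact: mxrank_map. Qed.

(** The two conjugate eigenspaces are complementary and have the same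
    dimension. *)
Lemma rank_i_eigen : (\rank E + \rank E = n)%N.
Proof.
have := mxrank_sum_cap E (conjmx E).
by rewrite i_eigen_cap mxrank0 addn0 i_eigen_full mxrank1 rank_conjmx.
Qed.

End Square.

Section GenComplex.
Variables (m : nat) (K : 'M[R]_(m + m)).
Hypothesis gK : gen_complex K.
Let E := i_eigenspace K.
Let K2 : K *m K = - 1%:M. Proof. by case: gK. Qed.

Lemma toC_pairing : toC (pairing : 'M[R]_(m + m)) = pairing.
Proof. by rewrite /pairing map_block_mx !map_mx0 !map_mx1. Qed.

Lemma gskew_toC (u v : 'rV[C]_(m + m)) :
  gform (u *m toC K) v = - gform u (v *m toC K).
Proof.
have [_ sK] := gK; have two : (2 : R) != 0 by rewrite pnatr_eq0.
move/(gskewP _ two)/(congr1 (fun A => toC A)): sK.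
rewrite map_mxN !toCM toC_pairing -map_trmx => /(gskewP _ twoC).
exact.
Qed.

Lemma i_eigen_isotropic : isotropic E.
Proof.
move=> u v /i_eigenP uE /i_eigenP vE; have := gskew_toC u v.
rewrite uE vE gformZl gformZr => /esym/eqP.
by rewrite eqNr mulf_eq0 (negPf neqCi) => /eqP.
Qed.

Lemma conj_i_eigen_isotropic : isotropic (conjmx E).
Proof.
move=> u v /conj_i_eigenP uE /conj_i_eigenP vE; have := gskew_toC u v.
rewrite uE vE gformZl gformZr => /esym/eqP.
by rewrite eqNr mulf_eq0 oppr_eq0 (negPf neqCi) => /eqP.
Qed.

(** The -i-part of w is orthogonal to the i-eigenspace by assumption and to
    the -i-eigenspace by isotropy, hence zero. *)
Lemma i_eigen_orth (w : 'rV[C]_(m + m)) :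
  (forall u, (u <= E)%MS -> gform w u = 0) -> (w <= E)%MS.
Proof.
move=> wE; have e := i_eigen_split K w.
have pE := i_eigen_proj K2 w; have cE := conj_i_eigen_proj K2 w.
set p := 2^-1 *: _ in e pE; set c := 2^-1 *: _ in e cE.
suff c0 : c = 0 by rewrite e c0 addr0.
apply: (gform_nondegenerate twoC) => v; rewrite (i_eigen_split K v) gformDr.
rewrite (conj_i_eigen_isotropic cE (conj_i_eigen_proj K2 v)) addr0.
have vE := i_eigen_proj K2 v; set q := 2^-1 *: _ in vE *.
have := wE q vE; rewrite {1}e gformDl.
by rewrite (i_eigen_isotropic pE vE) add0r.
Qed.

Lemma i_eigen_dirac : dirac E.
Proof.
split=> [|B iB EB]; first exact: i_eigen_isotropic.
apply/rV_subP => w wB; apply: i_eigen_orth => u uE; apply: iB => //.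
exact: submx_trans EB.
Qed.

End GenComplex.

Lemma eqmx_dirac (m p q : nat) (A : 'M[C]_(p, m + m)) (B : 'M[C]_(q, m + m)) :
  (A :=: B)%MS -> dirac A -> dirac B.
Proof.
move=> AB [iA mA]; split=> [u v|D iD]; first by rewrite -!AB; exact: iA.
by rewrite -!AB; exact: mA.
Qed.

Section Components.
Variables (m : nat) (gam psi : 'M[R]_m).
Hypotheses (eg : euclidean gam) (pT : psi^T = - psi).
Let T := taus gam psi.

Lemma toC_taus_unit : toC T \in unitmx.
Proof. by rewrite map_unitmx; exact: taus_unit. Qed.

Lemma mul_toC_taus (w : 'rV[C]_(m + m)) :
  w *m toC T = lsubmx w *m toC (tau (psi + gam))
    + rsubmx w *m toC (tau (psi - gam)).
Proof. by rewrite -{1}[w]hsubmxK /T /taus map_col_mx mul_row_col. Qed.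

Lemma sub_plus (A : 'M[C]_m) (w : 'rV[C]_(m + m)) :
  (w *m toC T <= A *m toC (tau (psi + gam)))%MS =
  (lsubmx w <= A)%MS && (rsubmx w == 0).
Proof.
have uT := toC_taus_unit; apply/idP/andP => [/submxP[x]|[lA /eqP r0]].
  have -> : x *m (A *m toC (tau (psi + gam))) = row_mx (x *m A) 0 *m toC T.
    by rewrite mul_toC_taus row_mxKl row_mxKr mul0mx addr0 mulmxA.
  move/(can_inj (mulmxK uT)) => ->.
  by rewrite row_mxKl row_mxKr submxMl eqxx.
by rewrite mul_toC_taus r0 mul0mx addr0 submxMr.
Qed.

Lemma sub_minus (A : 'M[C]_m) (w : 'rV[C]_(m + m)) :
  (w *m toC T <= A *m toC (tau (psi - gam)))%MS =
  (rsubmx w <= A)%MS && (lsubmx w == 0).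
Proof.
have uT := toC_taus_unit; apply/idP/andP => [/submxP[x]|[lA /eqP r0]].
  have -> : x *m (A *m toC (tau (psi - gam))) = row_mx 0 (x *m A) *m toC T.
    by rewrite mul_toC_taus row_mxKl row_mxKr mul0mx add0r mulmxA.
  move/(can_inj (mulmxK uT)) => ->.
  by rewrite row_mxKl row_mxKr submxMl eqxx.
by rewrite mul_toC_taus r0 mul0mx add0r submxMr.
Qed.

Lemma sub_i_eigen (K : 'M[R]_(m + m)) (Kp Km : 'M[R]_m)
    (w : 'rV[C]_(m + m)) :
  T *m K = bdiag Kp Km *m T ->
  (w *m toC T <= i_eigenspace K)%MS =
  (lsubmx w <= i_eigenspace Kp)%MS && (rsubmx w <= i_eigenspace Km)%MS.
Proof.
move=> TK; have uT := toC_taus_unit.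
have -> : (w *m toC T <= i_eigenspace K)%MS =
    (w *m toC (bdiag Kp Km) == 'i%C *: w).
  apply/i_eigenP/eqP; rewrite -mulmxA -toCM TK toCM mulmxA scalemxAl.
    by move/(can_inj (mulmxK uT)).
  by move->.
rewrite map_block_mx !map_mx0 -{1 2}[w]hsubmxK mul_row_block !mulmx0.
rewrite addr0 add0r scale_row_mx.
apply/eqP/andP => [/eq_row_mx[l r]|[/i_eigenP -> /i_eigenP ->]//].
by split; apply/i_eigenP.
Qed.

(** An endomorphism that preserves W_+ and W_- has its eigenspaces in each
    of them separately. *)
Lemma i_eigen_components (K : 'M[R]_(m + m)) (Kp Km : 'M[R]_m) :
  T *m K = bdiag Kp Km *m T ->
  (i_eigenspace K :=: i_eigenspace Kp *m toC (tau (psi + gam))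
    + i_eigenspace Km *m toC (tau (psi - gam)))%MS.
Proof.
move=> TK; have uT := toC_taus_unit; apply/eqmxP/andP; split.
  apply/rV_subP => u; rewrite -(mulmxKV uT u); set w := u *m _.
  rewrite (sub_i_eigen _ TK) mul_toC_taus => /andP[wp wm].
  by rewrite addmx_sub_adds// submxMr.
rewrite addsmx_sub; apply/andP; split; apply/rV_subP => u.
  rewrite -(mulmxKV uT u) sub_plus (sub_i_eigen _ TK) => /andP[-> /eqP ->].
  by rewrite sub0mx.
rewrite -(mulmxKV uT u) sub_minus (sub_i_eigen _ TK) => /andP[-> /eqP ->].
by rewrite sub0mx.
Qed.

End Components.

Section Decomposition.
Variables (m : nat) (G J : 'M[R]_(m + m)) (gam psi Jp Jm : 'M[R]_m).
Hypothesis hd : herm_data G J gam psi Jp Jm.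
Let eg : euclidean gam. Proof. by case: hd. Qed.
Let pT : psi^T = - psi. Proof. by case: hd. Qed.
Let Jp2 : Jp *m Jp = - 1%:M. Proof. by case: hd => _ _ _ _ []. Qed.
Let Jm2 : Jm *m Jm = - 1%:M. Proof. by case: hd => _ _ _ _ []. Qed.

Lemma toC_WplusE : (toC (Wplus G) :=: 1%:M *m toC (tau (psi + gam)))%MS.
Proof. by rewrite mul1mx; apply: eqmx_toC; have [] := herm_data_WE hd. Qed.

Lemma toC_WminusE : (toC (Wminus G) :=: 1%:M *m toC (tau (psi - gam)))%MS.
Proof. by rewrite mul1mx; apply: eqmx_toC; have [] := herm_data_WE hd. Qed.

Lemma LplusE :
  (Lplus G J :=: i_eigenspace Jp *m toC (tau (psi + gam)))%MS.
Proof.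
have uT := toC_taus_unit eg pT; have [_ _ _ TJ _] := hd.
apply: eqmx_rV => u; rewrite sub_capmx toC_WplusE -(mulmxKV uT u).
set w := u *m _; rewrite !sub_plus// (sub_i_eigen eg pT _ TJ) submx1 /=.
case r0: (rsubmx w == 0); last by rewrite !andbF.
by rewrite (eqP r0) sub0mx !andbT.
Qed.

Lemma LminusE :
  (Lminus G J :=: i_eigenspace Jm *m toC (tau (psi - gam)))%MS.
Proof.
have uT := toC_taus_unit eg pT; have [_ _ _ TJ _] := hd.
apply: eqmx_rV => u; rewrite sub_capmx toC_WminusE -(mulmxKV uT u).
set w := u *m _; rewrite !sub_minus// (sub_i_eigen eg pT _ TJ) submx1 /=.
case l0: (lsubmx w == 0); last by rewrite !andbF.
by rewrite (eqP l0) sub0mx !andbT.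
Qed.

Lemma conj_LplusE : (conjmx (Lplus G J) :=:
  conjmx (i_eigenspace Jp) *m toC (tau (psi + gam)))%MS.
Proof.
by apply: eqmx_trans (eqmx_conj LplusE) _; rewrite conjc_mxM conj_toC.
Qed.

Lemma conj_LminusE : (conjmx (Lminus G J) :=:
  conjmx (i_eigenspace Jm) *m toC (tau (psi - gam)))%MS.
Proof.
by apply: eqmx_trans (eqmx_conj LminusE) _; rewrite conjc_mxM conj_toC.
Qed.

Lemma Lplus_conj : (Lplus G J + conjmx (Lplus G J) :=: toC (Wplus G))%MS.
Proof.
apply: eqmx_trans (adds_eqmx LplusE conj_LplusE) _.
apply: eqmx_trans (eqmx_sym (addsmxMr _ _ _)) _.
apply: eqmx_trans (eqmxMr _ (i_eigen_full Jp2)) _.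
exact: eqmx_sym toC_WplusE.
Qed.

Lemma Lminus_conj : (Lminus G J + conjmx (Lminus G J) :=: toC (Wminus G))%MS.
Proof.
apply: eqmx_trans (adds_eqmx LminusE conj_LminusE) _.
apply: eqmx_trans (eqmx_sym (addsmxMr _ _ _)) _.
apply: eqmx_trans (eqmxMr _ (i_eigen_full Jm2)) _.
exact: eqmx_sym toC_WminusE.
Qed.

Lemma herm_data_second_complex : gen_complex (second_gcs G J).
Proof.
have T2 := herm_data_second hd.
have [_ _ _ TJ [_ _ Jpg Jmg]] := hd.
have hd2 : herm_data G (second_gcs G J) gam psi Jp (- Jm).
  have [_ _ TG _ _] := hd; split=> //; split=> //.
    by rewrite mulNmx mulmxN opprK.
  have -> : (- Jm)^T = - Jm^T by rewrite linearN.
  by rewrite mulNmx Jmg mulmxN.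
exact: herm_data_gen_complex hd2.
Qed.

Lemma i_eigenN (n : nat) (D : 'M[R]_n) :
  (i_eigenspace (- D) :=: conjmx (i_eigenspace D))%MS.
Proof.
apply: eqmx_rV => u; apply/i_eigenP/conj_i_eigenP; rewrite map_mxN mulmxN.
  by move/(canRL opprK) => ->; rewrite scaleNr.
by move->; rewrite scaleNr opprK.
Qed.

Lemma Lplus_Lminus : (Lplus G J + Lminus G J :=: i_eigenspace J)%MS.
Proof.
have [_ _ _ TJ _] := hd.
apply: eqmx_trans (adds_eqmx LplusE LminusE) _.
exact: eqmx_sym (i_eigen_components eg pT TJ).
Qed.

Lemma Lplus_conj_Lminus :
  (Lplus G J + conjmx (Lminus G J) :=: i_eigenspace (second_gcs G J))%MS.
Proof.
apply: eqmx_trans (adds_eqmx LplusE conj_LminusE) _.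
apply: eqmx_sym.
apply: eqmx_trans (i_eigen_components eg pT (herm_data_second hd)) _.
apply: adds_eqmx; first exact: eqmx_refl.
by apply: eqmxMr; exact: i_eigenN.
Qed.

(** The four summands are the images under tau_+- of the eigenspaces of
    J_+-, so directness is a count of dimensions. *)
Lemma herm_data_decomposition :
  gen_hermitian_decomposition (Lplus G J) (Lminus G J).
Proof.
have uT := toC_taus_unit eg pT.
have full : (Lplus G J + Lminus G J + conjmx (Lplus G J)
    + conjmx (Lminus G J) :=: 1%:M)%MS.
  apply/eqmxP; rewrite submx1 /=; apply/rV_subP => u _.
  rewrite -(mulmxKV uT u) mul_toC_taus; set w := u *m _.
  have pl (x : 'rV_m) : (x *m toC (tau (psi + gam)) <=
      Lplus G J + conjmx (Lplus G J))%MS.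
    by rewrite Lplus_conj toC_WplusE mul1mx submxMl.
  have mi (x : 'rV_m) : (x *m toC (tau (psi - gam)) <=
      Lminus G J + conjmx (Lminus G J))%MS.
    by rewrite Lminus_conj toC_WminusE mul1mx submxMl.
  apply: addmx_sub.
    apply: submx_trans (pl _) _; rewrite addsmx_sub.
    by rewrite -!addsmxA addsmxSl addsmxC -!addsmxA addsmxC -!addsmxA addsmxSl.
  apply: submx_trans (mi _) _; rewrite addsmx_sub addsmxSr andbT.
  by rewrite [X in (_ <= X + _ + _)%MS]addsmxC -!addsmxA addsmxSl.
have rtau a : row_free (toC (tau a : 'M[R]_(m, m + m))).
  apply/row_freeP; exists (toC (col_mx 1%:M 0)).
  by rewrite -toCM /tau mul_row_col mulmx1 mulmx0 addr0 map_mx1.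
split.
- apply/andP; split; first exact/eqmxP.
  rewrite mxdirectE /= full mxrank1 !rank_conjmx LplusE LminusE.
  rewrite !(mxrankMfree _ (rtau _)) -addnA addnACA.
  apply/eqP; congr (_ + _)%N; symmetry; first exact: rank_i_eigen Jp2.
  exact: rank_i_eigen Jm2.
- apply: eqmx_dirac (eqmx_sym Lplus_Lminus) _; apply: i_eigen_dirac.
  exact: herm_data_gen_complex hd.
- apply: eqmx_dirac (eqmx_sym Lplus_conj_Lminus) _; apply: i_eigen_dirac.
  exact: herm_data_second_complex.
- exists G; split; [exact: herm_data_gen_metric hd | |].
    exact: Lplus_conj.
  exact: Lminus_conj.
Qed.

End Decomposition.

End ComplexStructures.

(** * Pullback of the decomposition to a subspace *)

Section Pullback.
Context {R : realType} {n m : nat}.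
Local Notation C := R[i].
Variables (A : 'M[R]_(n, m)) (fA : row_free A).
Variables (G J : 'M[R]_(m + m)) (gam psi Jp Jm : 'M[R]_m).
Hypothesis hd : herm_data G J gam psi Jp Jm.

(** In a graph the covector part is determined by the vector part, so a
    vector of the pullback is determined by its image in the ambient space. *)
Lemma pullback_eigen (E : 'M[C]_m) (L : 'M[C]_(m + m)) (a : 'M[R]_m)
    (v : 'rV[C]_(n + n)) :
  (L :=: E *m toC (tau a))%MS ->
  (v <= pullback (toC A) L)%MS <->
  exists2 X : 'rV[C]_n, (X *m toC A <= E)%MS &
    v = X *m toC (tau (A *m a *m A^T)).
Proof.
move=> LE; have tauE (p : nat) (b : 'M[R]_p) (X : 'rV[C]_p) :
    X *m toC (tau b) = row_mx X (X *m toC b).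
  by rewrite /tau map_row_mx mul_mx_row map_mx1 mulmx1.
rewrite pullbackP; split=> [[X [eta []]]|[X XE ->]].
  rewrite LE => /submxP[x]; rewrite mulmxA tauE => /eq_row_mx[XA ->] ->.
  exists X; first by rewrite XA submxMl.
  by rewrite tauE !toCM -!mulmxA map_trmx mulmxA -XA !mulmxA.
exists X, (X *m toC A *m toC a); split; last first.
  by rewrite tauE !toCM map_trmx !mulmxA.
by rewrite LE -tauE submxMr.
Qed.

(** The complex vectors of the subspace that are holomorphic for D in the
    ambient space. *)
Definition preimage_eigen (D : 'M[R]_m) : 'M[C]_n :=
  kermx (toC A *m cokermx (i_eigenspace D)).

Lemma sub_preimage_eigen (D : 'M[R]_m) (X : 'rV[C]_n) :
  (X <= preimage_eigen D)%MS = (X *m toC A <= i_eigenspace D)%MS.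
Proof.
rewrite [RHS]submxE; apply/sub_kermxP/eqP => e; first by rewrite -mulmxA.
by rewrite mulmxA.
Qed.

Lemma pullback_tauE (L : 'M[C]_(m + m)) (D a : 'M[R]_m) :
  (L :=: i_eigenspace D *m toC (tau a))%MS ->
  (pullback (toC A) L :=:
   preimage_eigen D *m toC (tau (A *m a *m A^T)))%MS.
Proof.
move=> LE; apply: eqmx_rV => v; apply/idP/idP.
  move/(pullback_eigen _ LE) => [X XE ->]; apply: submxMr.
  by rewrite sub_preimage_eigen.
move/submxP => [x ->]; apply/(pullback_eigen _ LE).
exists (x *m preimage_eigen D); last by rewrite mulmxA.
by rewrite -sub_preimage_eigen submxMl.
Qed.

Section Rank.
Variable D : 'M[R]_m.
Let Z := preimage_eigen D.

Lemma preimage_eigen_cap : (Z :&: conjmx Z = 0)%MS.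
Proof.
apply/eqP/rowV0P => X; rewrite sub_capmx sub_conjmx !sub_preimage_eigen.
move=> /andP[XZ cXZ].
have fAC : row_free (toC A) by rewrite row_free_map.
apply: (row_free_inj fAC); rewrite mul0mx.
apply/eqP; rewrite -submx0 -(@i_eigen_cap _ _ D) sub_capmx XZ sub_conjmx.
by rewrite conjc_mxM conj_toC.
Qed.

Lemma rank_preimage_eigen : (\rank Z + \rank Z <= n)%N.
Proof.
have := mxrank_sum_cap Z (conjmx Z).
rewrite preimage_eigen_cap mxrank0 addn0 rank_conjmx => <-.
exact: rank_leq_row.
Qed.

(** If the holomorphic vectors fill half of the dimension, every vector of
    the subspace is the sum of a holomorphic and an antiholomorphic one, and
    D multiplies these by i and - i. *)
Lemma preimage_eigen_invariant : D *m D = - 1%:M ->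
  (\rank Z + \rank Z = n)%N -> (A *m D :=: A)%MS.
Proof.
move=> D2 rZ.
have full : (1%:M <= Z + conjmx Z)%MS.
  rewrite sub1mx /row_full; have := mxrank_sum_cap Z (conjmx Z).
  by rewrite preimage_eigen_cap mxrank0 addn0 rank_conjmx rZ => ->.
have AD : (A *m D <= A)%MS.
  rewrite -(map_submx (real_complex R)) map_mxM; apply/rV_subP => u.
  move=> /submxP[X ->].
  have /sub_addsmxP[[a b] /= ->] := submx_trans (submx1 X) full.
  have aZ : (a *m Z <= Z)%MS by exact: submxMl.
  have bZ : (b *m conjmx Z <= conjmx Z)%MS by exact: submxMl.
  move: (a *m Z) (b *m conjmx Z) aZ bZ => p q pZ qZ.
  rewrite mulmxDl addmx_sub//.
    move: pZ; rewrite sub_preimage_eigen => /i_eigenP.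
    by rewrite mulmxA => ->; rewrite scalemx_sub// submxMl.
  have /conj_i_eigenP : (q *m toC A <= conjmx (i_eigenspace D))%MS.
    rewrite sub_conjmx conjc_mxM conj_toC -sub_preimage_eigen.
    by rewrite -sub_conjmx.
  by rewrite mulmxA => ->; rewrite scalemx_sub// submxMl.
apply/eqmxP; rewrite AD /=.
have eA : A = - (A *m D *m D) by rewrite -mulmxA D2 mulmxN mulmx1 opprK.
by rewrite {1}eA eqmx_opp submxMr.
Qed.

End Rank.

(** The four summands span a space of dimension 2n, and the dimensions of
    the two pullbacks are at most n / 2 each. *)
Lemma decomposition_invariant :
  gen_hermitian_decomposition
    (pullback (toC A) (Lplus G J)) (pullback (toC A) (Lminus G J)) ->
  (A *m Jp :=: A)%MS /\ (A *m Jm :=: A)%MS.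
Proof.
have [_ _ _ _ [Jp2 Jm2 _ _]] := hd.
case=> /andP[/eqmxP full _] _ _ _.
set Lp := pullback _ _ in full; set Lm := pullback _ (Lminus _ _) in full.
have rp : (\rank Lp <= \rank (preimage_eigen Jp))%N.
  by rewrite (pullback_tauE (LplusE hd)) mxrankM_maxl.
have rm : (\rank Lm <= \rank (preimage_eigen Jm))%N.
  by rewrite (pullback_tauE (LminusE hd)) mxrankM_maxl.
have := rank_preimage_eigen Jp; have := rank_preimage_eigen Jm.
have nn : (n + n <= \rank Lp + \rank Lm + \rank Lp + \rank Lm)%N.
  rewrite -[X in (X <= _)%N](mxrank1 C) -full.
  rewrite (leq_trans (mxrank_adds_leqif _ _).1)// rank_conjmx leq_add2r.
  rewrite (leq_trans (mxrank_adds_leqif _ _).1)// rank_conjmx leq_add2r.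
  exact: (mxrank_adds_leqif _ _).1.
move=> Zm Zp; split; apply: preimage_eigen_invariant => //; lia.
Qed.

Lemma pullback_restrict (D : 'M[R]_m) (E : 'M[R]_n)
    (L : 'M[C]_(m + m)) (a : 'M[R]_m) :
  (L :=: i_eigenspace D *m toC (tau a))%MS -> E *m A = A *m D ->
  (pullback (toC A) L :=: i_eigenspace E *m toC (tau (A *m a *m A^T)))%MS.
Proof.
move=> LE EA; have fAC : row_free (toC A) by rewrite row_free_map.
have ZE : (preimage_eigen D :=: i_eigenspace E)%MS.
  apply: eqmx_rV => X; rewrite sub_preimage_eigen; apply/i_eigenP/i_eigenP.
    rewrite -mulmxA -toCM -EA toCM mulmxA scalemxAl => e.
    exact: row_free_inj fAC _ _ e.
  by rewrite -mulmxA -toCM -EA toCM mulmxA => ->; rewrite scalemxAl.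
exact: eqmx_trans (pullback_tauE LE) (eqmxMr _ ZE).
Qed.

Lemma pullback_LE :
  (A *m Jp <= A)%MS -> (A *m Jm <= A)%MS ->
  let gam' := A *m gam *m A^T in let psi' := A *m psi *m A^T in
  let Jp' := restrict_endo A gam Jp in let Jm' := restrict_endo A gam Jm in
  let G' := metric_of gam' psi' in let J' := endo_of gam' psi' Jp' Jm' in
  (Lplus G' J' :=: pullback (toC A) (Lplus G J))%MS /\
  (Lminus G' J' :=: pullback (toC A) (Lminus G J))%MS.
Proof.
move=> Ap Am gam' psi' Jp' Jm' G' J'.
have [eg _ _ _ _] := hd.
have hd' := herm_data_restrict fA hd Ap Am.
have ep := restrict_endoP fA eg Ap; have em := restrict_endoP fA eg Am.
have dp : A *m (psi + gam) *m A^T = psi' + gam' by rewrite mulmxDr mulmxDl.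
have dm : A *m (psi - gam) *m A^T = psi' - gam' by rewrite mulmxBr mulmxBl.
split; apply: eqmx_sym.
  apply: eqmx_trans (pullback_restrict (LplusE hd) ep) _.
  by rewrite dp; exact: eqmx_sym (LplusE hd').
apply: eqmx_trans (pullback_restrict (LminusE hd) em) _.
by rewrite dm; exact: eqmx_sym (LminusE hd').
Qed.

End Pullback.

Lemma eqmx_decomposition (R : realType) (m : nat)
    (Lp Lm Lp' Lm' : 'M[R[i]]_(m + m)) :
  (Lp :=: Lp')%MS -> (Lm :=: Lm')%MS ->
  gen_hermitian_decomposition Lp Lm -> gen_hermitian_decomposition Lp' Lm'.
Proof.
move=> ep em; have cp := eqmx_conj ep; have cm := eqmx_conj em.
have sum4 : (Lp + Lm + conjmx Lp + conjmx Lm :=: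
    Lp' + Lm' + conjmx Lp' + conjmx Lm')%MS.
  by do 3 (apply: adds_eqmx => //).
case=> /andP[/eqmxP full dir] d1 d2 [G [gG Gp Gm]]; split.
- apply/andP; split.
    by apply/eqmxP; apply: eqmx_trans (eqmx_sym sum4) full.
  move: dir; rewrite !mxdirectE /= sum4 ep em.
  by rewrite cp cm.
- by apply: eqmx_dirac d1; exact: adds_eqmx.
- by apply: eqmx_dirac d2; exact: adds_eqmx.
- exists G; split=> //.
    by apply: eqmx_trans Gp; apply: adds_eqmx; exact: eqmx_sym.
  by apply: eqmx_trans Gm; apply: adds_eqmx; exact: eqmx_sym.
Qed.

(** * Complex-valued smooth functions *)

Section ComplexFunctions.
Context {R : realType} {m : nat}.
Local Notation C := R[i].
Implicit Types (U : set 'rV[R]_m) (f g : 'rV[R]_m -> C) (k : 'I_m)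
  (x : 'rV[R]_m).

Definition csmooth_on U f :=
  smooth_on U (fun y => complex.Re (f y)) /\
  smooth_on U (fun y => complex.Im (f y)).

Lemma ReM (a b : C) : complex.Re (a * b) =
  complex.Re a * complex.Re b - complex.Im a * complex.Im b.
Proof. by case: a b => [a1 a2] [b1 b2]. Qed.

Lemma ImM (a b : C) : complex.Im (a * b) =
  complex.Re a * complex.Im b + complex.Im a * complex.Re b.
Proof. by case: a b => [a1 a2] [b1 b2]. Qed.

Lemma ReD (a b : C) : complex.Re (a + b) = complex.Re a + complex.Re b.
Proof. by case: a b => [a1 a2] [b1 b2]. Qed.

Lemma ImD (a b : C) : complex.Im (a + b) = complex.Im a + complex.Im b.
Proof. by case: a b => [a1 a2] [b1 b2]. Qed.

Lemma csmooth_on_cst U (c : C) : csmooth_on U (fun=> c).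
Proof. by split; exact: smooth_on_cst. Qed.

Lemma csmooth_on_real U (f : 'rV[R]_m -> R) : smooth_on U f ->
  csmooth_on U (fun y => real_complex R (f y)).
Proof. move=> sf; split; [exact: sf | exact: smooth_on_cst]. Qed.

Lemma csmooth_onD U f g : open U -> csmooth_on U f -> csmooth_on U g ->
  csmooth_on U (fun y => f y + g y).
Proof.
move=> oU [rf jf] [rg jg]; split.
  apply: (eq_smooth_on oU _ (smooth_onD oU rf rg)) => y _.
  by rewrite ReD.
apply: (eq_smooth_on oU _ (smooth_onD oU jf jg)) => y _.
by rewrite ImD.
Qed.

Lemma csmooth_onM U f g : open U -> csmooth_on U f -> csmooth_on U g ->
  csmooth_on U (fun y => f y * g y).
Proof.
move=> oU [rf jf] [rg jg]; split.
  apply: (eq_smooth_on oU _ (smooth_onD oU (smooth_onM oU rf rg)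
    (smooth_onN oU (smooth_onM oU jf jg)))) => y _.
  by rewrite ReM.
apply: (eq_smooth_on oU _ (smooth_onD oU (smooth_onM oU rf jg)
  (smooth_onM oU jf rg))) => y _.
by rewrite ImM.
Qed.

Lemma eq_csmooth_on U f g : open U -> {in U, f =1 g} ->
  csmooth_on U f -> csmooth_on U g.
Proof.
move=> oU fg [rf jf]; split.
  by apply: (eq_smooth_on oU _ rf) => y Uy; rewrite fg.
by apply: (eq_smooth_on oU _ jf) => y Uy; rewrite fg.
Qed.

Lemma csmooth_on_sum U (I : Type) (r : seq I) (P : pred I)
    (F : I -> 'rV[R]_m -> C) : open U ->
  (forall i, csmooth_on U (F i)) ->
  csmooth_on U (fun x => \sum_(i <- r | P i) F i x).
Proof.
move=> oU sF; elim: r => [|i r IH].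
  apply: (eq_csmooth_on oU _ (@csmooth_on_cst U 0)) => x _.
  by rewrite big_nil.
have sF' : csmooth_on U (fun x => if P i then F i x +
    \sum_(j <- r | P j) F j x else \sum_(j <- r | P j) F j x).
  case: (P i); [exact: csmooth_onD oU (sF i) IH | exact: IH].
by apply: (eq_csmooth_on oU _ sF') => x _; rewrite big_cons.
Qed.

Lemma csmooth_on_prod U (I : Type) (r : seq I) (P : pred I)
    (F : I -> 'rV[R]_m -> C) : open U ->
  (forall i, csmooth_on U (F i)) ->
  csmooth_on U (fun x => \prod_(i <- r | P i) F i x).
Proof.
move=> oU sF; elim: r => [|i r IH].
  apply: (eq_csmooth_on oU _ (@csmooth_on_cst U 1)) => x _.
  by rewrite big_nil.
have sF' : csmooth_on U (fun x => if P i then F i x *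
    \prod_(j <- r | P j) F j x else \prod_(j <- r | P j) F j x).
  case: (P i); [exact: csmooth_onM oU (sF i) IH | exact: IH].
by apply: (eq_csmooth_on oU _ sF') => x _; rewrite big_cons.
Qed.

Lemma smooth_cmxP (p q : nat) U (f : 'rV[R]_m -> 'M[C]_(p, q)) :
  smooth_cmx U f <-> forall i j, csmooth_on U (fun y => f y i j).
Proof.
have ReE i j : (fun y => map_mx (@complex.Re R) (f y) i j) =
    (fun y => complex.Re (f y i j)) by apply/funext => y; rewrite mxE.
have ImE i j : (fun y => map_mx (@complex.Im R) (f y) i j) =
    (fun y => complex.Im (f y i j)) by apply/funext => y; rewrite mxE.
split=> [[rf jf] i j|sf].
  by split; [rewrite -ReE; exact: rf | rewrite -ImE; exact: jf].
split=> i j; first by rewrite ReE; exact: (sf i j).1.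
by rewrite ImE; exact: (sf i j).2.
Qed.

Lemma smooth_cmxM U (p q r : nat) (f : 'rV[R]_m -> 'M[C]_(p, q))
    (g : 'rV[R]_m -> 'M[C]_(q, r)) : open U ->
  smooth_cmx U f -> smooth_cmx U g -> smooth_cmx U (fun x => f x *m g x).
Proof.
move=> oU /smooth_cmxP sf /smooth_cmxP sg; apply/smooth_cmxP => i j.
have sfg : csmooth_on U (fun x => \sum_k f x i k * g x k j).
  apply: (csmooth_on_sum _ _ (F := fun l x => f x i l * g x l j) oU) => l.
  exact: csmooth_onM oU (sf i l) (sg l j).
by apply: (eq_csmooth_on oU _ sfg) => x _; rewrite mxE.
Qed.

Lemma smooth_cmxD U (p q : nat) (f g : 'rV[R]_m -> 'M[C]_(p, q)) : open U ->
  smooth_cmx U f -> smooth_cmx U g -> smooth_cmx U (fun x => f x + g x).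
Proof.
move=> oU /smooth_cmxP sf /smooth_cmxP sg; apply/smooth_cmxP => i j.
by apply: (eq_csmooth_on oU _ (csmooth_onD oU (sf i j) (sg i j))) => x _;
  rewrite mxE.
Qed.

Lemma smooth_cmxZ U (p q : nat) (a : C) (f : 'rV[R]_m -> 'M[C]_(p, q)) :
  open U -> smooth_cmx U f -> smooth_cmx U (fun x => a *: f x).
Proof.
move=> oU /smooth_cmxP sf; apply/smooth_cmxP => i j.
have saf : csmooth_on U (fun x => a * f x i j).
  exact: csmooth_onM oU (csmooth_on_cst U a) (sf i j).
by apply: (eq_csmooth_on oU _ saf) => x _; rewrite mxE.
Qed.

Lemma smooth_cmx_cst U (p q : nat) (A : 'M[C]_(p, q)) : smooth_cmx U (fun=> A).
Proof. by apply/smooth_cmxP => i j; exact: csmooth_on_cst. Qed.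

Lemma smooth_cmx_toC U (p q : nat) (f : 'rV[R]_m -> 'M[R]_(p, q)) : open U ->
  smooth_mx U f -> smooth_cmx U (fun x => toC (f x)).
Proof.
move=> oU sf; apply/smooth_cmxP => i j.
apply: (eq_csmooth_on oU _ (csmooth_on_real (sf i j))) => x _.
by rewrite mxE.
Qed.

Lemma csmooth_det U (p : nat) (f : 'rV[R]_m -> 'M[C]_p) : open U ->
  smooth_cmx U f -> csmooth_on U (fun x => \det (f x)).
Proof.
move=> oU /smooth_cmxP sf; apply: (csmooth_on_sum _ _
  (F := fun (s : 'S_p) x => (-1) ^+ s * \prod_i f x i (s i)) oU) => s.
have sp : csmooth_on U (fun x => \prod_i f x i (s i)).
  by apply: (csmooth_on_prod _ _ (F := fun i x => f x i (s i)) oU) => i.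
exact: csmooth_onM oU (csmooth_on_cst U ((-1) ^+ s)) sp.
Qed.

Definition cderivable (k : 'I_m) f (x : 'rV[R]_m) :=
  derivable (fun y => complex.Re (f y)) x (delta_mx 0 k) /\
  derivable (fun y => complex.Im (f y)) x (delta_mx 0 k).

Lemma csmooth_cderivable U f k x : U x -> csmooth_on U f -> cderivable k f x.
Proof.
move=> Ux [rf jf].
by split; [exact: (smooth_onC0 rf Ux).2 | exact: (smooth_onC0 jf Ux).2].
Qed.

Lemma cpartial_cst k (c : C) x : cpartial k (fun=> c) x = 0.
Proof. by rewrite /cpartial !derive_cst. Qed.

Lemma cderivable_cst k (c : C) x : cderivable k (fun=> c) x.
Proof. by split; exact: derivable_cst. Qed.

Lemma cderivableD k f g x : cderivable k f x -> cderivable k g x ->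
  cderivable k (fun y => f y + g y) x.
Proof.
move=> [rf jf] [rg jg].
have reE : (fun y => complex.Re (f y + g y)) =
    (fun y => complex.Re (f y)) + (fun y => complex.Re (g y)).
  by apply/funext => y; rewrite ReD.
have imE : (fun y => complex.Im (f y + g y)) =
    (fun y => complex.Im (f y)) + (fun y => complex.Im (g y)).
  by apply/funext => y; rewrite ImD.
rewrite /cderivable reE imE.
exact: conj (derivableD rf rg) (derivableD jf jg).
Qed.

Lemma cpartialD k f g x : cderivable k f x -> cderivable k g x ->
  cpartial k (fun y => f y + g y) x = cpartial k f x + cpartial k g x.
Proof.
move=> [rf jf] [rg jg].
have reE : (fun y => complex.Re (f y + g y)) =
    (fun y => complex.Re (f y)) + (fun y => complex.Re (g y)).
  by apply/funext => y; rewrite ReD.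
have imE : (fun y => complex.Im (f y + g y)) =
    (fun y => complex.Im (f y)) + (fun y => complex.Im (g y)).
  by apply/funext => y; rewrite ImD.
by rewrite /cpartial reE imE (deriveD rf rg) (deriveD jf jg).
Qed.

Lemma cderivableM k f g x : cderivable k f x -> cderivable k g x ->
  cderivable k (fun y => f y * g y) x.
Proof.
move=> [rf jf] [rg jg].
have reE : (fun y => complex.Re (f y * g y)) =
    (fun y => complex.Re (f y)) * (fun y => complex.Re (g y)) -
    (fun y => complex.Im (f y)) * (fun y => complex.Im (g y)).
  by apply/funext => y; rewrite ReM.
have imE : (fun y => complex.Im (f y * g y)) =
    (fun y => complex.Re (f y)) * (fun y => complex.Im (g y)) +
    (fun y => complex.Im (f y)) * (fun y => complex.Re (g y)).
  by apply/funext => y; rewrite ImM.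
rewrite /cderivable reE imE.
exact: conj (derivableB (derivableM rf rg) (derivableM jf jg))
  (derivableD (derivableM rf jg) (derivableM jf rg)).
Qed.

Lemma cpartialM k f g x : cderivable k f x -> cderivable k g x ->
  cpartial k (fun y => f y * g y) x =
  f x * cpartial k g x + g x * cpartial k f x.
Proof.
move=> [rf jf] [rg jg].
have reE : (fun y => complex.Re (f y * g y)) =
    (fun y => complex.Re (f y)) * (fun y => complex.Re (g y)) -
    (fun y => complex.Im (f y)) * (fun y => complex.Im (g y)).
  by apply/funext => y; rewrite ReM.
have imE : (fun y => complex.Im (f y * g y)) =
    (fun y => complex.Re (f y)) * (fun y => complex.Im (g y)) +
    (fun y => complex.Im (f y)) * (fun y => complex.Re (g y)).
  by apply/funext => y; rewrite ImM.
rewrite /cpartial reE imE (deriveB (derivableM rf rg) (derivableM jf jg)).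
rewrite (deriveD (derivableM rf jg) (derivableM jf rg)).
rewrite (deriveM rf rg) (deriveM jf jg) (deriveM rf jg) (deriveM jf rg).
clear.
move: ('D__ _ x) ('D__ _ x) ('D__ _ x) ('D__ _ x) => a b c d.
case: (f x) (g x) => [f1 f2] [g1 g2] /=; apply/eqP.
by rewrite eq_complex /= /GRing.scale /=; apply/andP; split; apply/eqP; ring.
Qed.

Lemma cderivable_sum k (I : Type) (r : seq I) (F : I -> 'rV[R]_m -> C) x :
  (forall i, cderivable k (F i) x) ->
  cderivable k (fun y => \sum_(i <- r) F i y) x /\
  cpartial k (fun y => \sum_(i <- r) F i y) x =
  \sum_(i <- r) cpartial k (F i) x.
Proof.
move=> dF; elim: r => [|i r [IHd IHp]].
  have -> : (fun y => \sum_(i <- [::]) F i y) = fun=> 0.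
    by apply/funext => y; rewrite big_nil.
  by rewrite big_nil cpartial_cst; split=> //; exact: cderivable_cst.
have -> : (fun y => \sum_(j <- i :: r) F j y) =
    fun y => F i y + \sum_(j <- r) F j y.
  by apply/funext => y; rewrite big_cons.
split; first exact: cderivableD (dF i) IHd.
by rewrite (cpartialD (dF i) IHd) IHp big_cons.
Qed.

Lemma cpartial_real k (f : 'rV[R]_m -> R) x :
  cpartial k (fun y => real_complex R (f y)) x = real_complex R (partial k f x).
Proof. by rewrite /cpartial /= derive_cst. Qed.

Lemma eq_cpartial U f g k x : open U -> U x -> {in U, f =1 g} ->
  cpartial k f x = cpartial k g x.
Proof.
move=> oU Ux fg; rewrite /cpartial; congr Complex.
  by apply: (eq_partial _ oU Ux) => y Uy; rewrite fg.
by apply: (eq_partial _ oU Ux) => y Uy; rewrite fg.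
Qed.

End ComplexFunctions.

(** * The Courant bracket and the torsion of a generalized complex structure *)

Section CourantFormula.
Context {R : realType} {m : nat}.
Local Notation C := R[i].
Implicit Types (k : 'I_m) (x : 'rV[R]_m).

Definition crow_partial (p : nat) k (s : 'rV[R]_m -> 'rV[C]_p) x : 'rV[C]_p :=
  \row_l cpartial k (fun y => s y 0 l) x.

Definition mx_partial (p q : nat) k (K : 'rV[R]_m -> 'M[R]_(p, q)) x :
    'M[R]_(p, q) :=
  \matrix_(a, b) partial k (fun y => K y a b) x.

Definition crow_dir (p : nat) (X : 'rV[C]_m) (s : 'rV[R]_m -> 'rV[C]_p) x :
    'rV[C]_p :=
  \sum_k X 0 k *: crow_partial k s x.

Definition mx_dir (p q : nat) (X : 'rV[C]_m) (K : 'rV[R]_m -> 'M[R]_(p, q)) x :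
    'M[C]_(p, q) :=
  \sum_k X 0 k *: toC (mx_partial k K x).

Definition crow_derivable (p : nat) (s : 'rV[R]_m -> 'rV[C]_p) x :=
  forall k l, cderivable k (fun y => s y 0 l) x.

Lemma cpartial_pairing (p : nat) (u v : 'rV[R]_m -> 'rV[C]_p) k x :
  crow_derivable u x -> crow_derivable v x ->
  cderivable k (fun y => (u y *m (v y)^T) 0 0) x /\
  cpartial k (fun y => (u y *m (v y)^T) 0 0) x =
  (u x *m (crow_partial k v x)^T + crow_partial k u x *m (v x)^T) 0 0.
Proof.
move=> du dv.
have -> : (fun y => (u y *m (v y)^T) 0 0) =
    (fun y => \sum_l u y 0 l * v y 0 l).
  by apply/funext => y; rewrite mxE; apply: eq_bigr => l _; rewrite mxE.
have dM l : cderivable k (fun y => u y 0 l * v y 0 l) x.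
  exact: cderivableM (du k l) (dv k l).
have [dS ->] := cderivable_sum (index_enum 'I_p) dM; split; first exact: dS.
rewrite [RHS]mxE; rewrite [X in _ = X + _]mxE [X in _ = _ + X]mxE -big_split.
apply: eq_bigr => l _ /=; rewrite (cpartialM (du k l) (dv k l)) !mxE.
by congr (_ + _); rewrite mulrC.
Qed.

(** One of the two summands of 2g(u, v). *)
Definition covec_eval (u v : 'rV[C]_(m + m)) : C :=
  (lsubmx u *m (rsubmx v)^T) 0 0.

Lemma gform_covec_eval (u v : 'rV[C]_(m + m)) :
  gform u v = 2^-1 * (covec_eval v u + covec_eval u v).
Proof. by rewrite /gform mxE. Qed.

(** The terms of the two Lie derivatives and of the exterior derivative in
    which vector fields are differentiated against covectors combine into a
    single covector, expressed through g. *)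
Lemma courantE (s t : 'rV[R]_m -> 'rV[C]_(m + m)) x :
  crow_derivable s x -> crow_derivable t x ->
  courant s t x =
  crow_dir (lsubmx (s x)) t x - crow_dir (lsubmx (t x)) s x
  + row_mx 0 (\row_k (gform (crow_partial k s x) (t x)
                      - gform (crow_partial k t x) (s x))).
Proof.
move=> ds dt.
have lE (u : 'rV[R]_m -> 'rV[C]_(m + m)) k :
    lsubmx (crow_partial k u x) = crow_partial k (fun y => lsubmx (u y)) x.
  apply/rowP => l; rewrite !mxE; congr (cpartial k _ x).
  by apply/funext => y; rewrite mxE.
have rE (u : 'rV[R]_m -> 'rV[C]_(m + m)) k :
    rsubmx (crow_partial k u x) = crow_partial k (fun y => rsubmx (u y)) x.
  apply/rowP => l; rewrite !mxE; congr (cpartial k _ x).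
  by apply/funext => y; rewrite mxE.
have dl (u : 'rV[R]_m -> 'rV[C]_(m + m)) : crow_derivable u x ->
    crow_derivable (fun y => lsubmx (u y)) x.
  move=> du k l; have := du k (lshift m l).
  by congr (cderivable k _ x); apply/funext => y; rewrite mxE.
have dr (u : 'rV[R]_m -> 'rV[C]_(m + m)) : crow_derivable u x ->
    crow_derivable (fun y => rsubmx (u y)) x.
  move=> du k l; have := du k (rshift m l).
  by congr (cderivable k _ x); apply/funext => y; rewrite mxE.
rewrite -[RHS]hsubmxK; congr row_mx.
  rewrite linearD linearB /= row_mxKl addr0.
  rewrite /crow_dir ![lsubmx (\sum_(_ < _) _)]linear_sum /=.
  apply/rowP => l; rewrite !mxE big_split sumrN /= !summxE.
  congr (_ - _); apply: eq_bigr => k _; rewrite linearZ /= lE !mxE.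
    by [].
  by [].
rewrite linearD linearB /= row_mxKr.
rewrite /crow_dir ![rsubmx (\sum_(_ < _) _)]linear_sum /=.
apply/rowP => l; rewrite !mxE !big_split /= !summxE.
have extE : cpartial l (fun y => (lsubmx (t y) *m (rsubmx (s y))^T
      - lsubmx (s y) *m (rsubmx (t y))^T) 0 0) x =
    (covec_eval (t x) (crow_partial l s x)
     + covec_eval (crow_partial l t x) (s x))
    - (covec_eval (s x) (crow_partial l t x)
       + covec_eval (crow_partial l s x) (t x)).
  have [d1 e1] := cpartial_pairing l (dl t dt) (dr s ds).
  have [d2 e2] := cpartial_pairing l (dl s ds) (dr t dt).
  have -> : (fun y => (lsubmx (t y) *m (rsubmx (s y))^T
      - lsubmx (s y) *m (rsubmx (t y))^T) 0 0) =
      (fun y => (lsubmx (t y) *m (rsubmx (s y))^T) 0 0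
        + -1 * (lsubmx (s y) *m (rsubmx (t y))^T) 0 0).
    by apply/funext => y; rewrite mxE [X in _ + X]mxE mulN1r.
  have d3 := cderivableM (cderivable_cst l (-1) x) d2.
  rewrite (cpartialD d1 d3) (cpartialM (cderivable_cst l (-1) x) d2) e1 e2.
  rewrite cpartial_cst mulr0 addr0 mulN1r /covec_eval !lE !rE.
  by congr (_ - _); rewrite mxE.
rewrite extE; clear extE.
have e1 : \sum_j lsubmx (s x) 0 j * cpartial j (fun y => rsubmx (t y) 0 l) x =
    \sum_j rsubmx (lsubmx (s x) 0 j *: crow_partial j t x) 0 l.
  by apply: eq_bigr => j _; rewrite linearZ /= rE !mxE.
have e2 : \sum_j lsubmx (t x) 0 j * cpartial j (fun y => rsubmx (s y) 0 l) x =
    \sum_j rsubmx (lsubmx (t x) 0 j *: crow_partial j s x) 0 l.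
  by apply: eq_bigr => j _; rewrite linearZ /= rE !mxE.
have e3 : \sum_j rsubmx (t x) 0 j * cpartial l (fun y => lsubmx (s y) 0 j) x =
    covec_eval (crow_partial l s x) (t x).
  by rewrite /covec_eval mxE lE; apply: eq_bigr => j _; rewrite !mxE mulrC.
have e4 : \sum_j rsubmx (s x) 0 j * cpartial l (fun y => lsubmx (t y) 0 j) x =
    covec_eval (crow_partial l t x) (s x).
  by rewrite /covec_eval mxE lE; apply: eq_bigr => j _; rewrite !mxE mulrC.
rewrite e1 e2 e3 e4 !gform_covec_eval; clear.
move: (\sum_j _) (\sum_j _) => p q.
move: (covec_eval (t x) _) (covec_eval (crow_partial l t x) _)
  (covec_eval (s x) _) (covec_eval (crow_partial l s x) _) => a b c d.
by field.
Qed.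

End CourantFormula.

Section MatrixPartial.
Context {R : realType} {m : nat}.
Implicit Types (k : 'I_m) (x : 'rV[R]_m) (U : set 'rV[R]_m).

Definition mx_derivable (p q : nat) k (K : 'rV[R]_m -> 'M[R]_(p, q)) x :=
  forall a b, derivable (fun y => K y a b) x (delta_mx 0 k).

Lemma smooth_mx_derivable (p q : nat) U k (K : 'rV[R]_m -> 'M[R]_(p, q)) x :
  U x -> smooth_mx U K -> mx_derivable k K x.
Proof. by move=> Ux sK a b; have [_] := smooth_onC0 (sK a b) Ux. Qed.

Lemma mx_derivable_cst (p q : nat) k (A : 'M[R]_(p, q)) x :
  mx_derivable k (fun=> A) x.
Proof. by move=> a b; exact: derivable_cst. Qed.

Lemma mx_partial_cst (p q : nat) k (A : 'M[R]_(p, q)) x :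
  mx_partial k (fun=> A) x = 0.
Proof. by apply/matrixP => a b; rewrite !mxE /partial derive_cst. Qed.

Lemma mx_partialM (p q r : nat) k (f : 'rV[R]_m -> 'M[R]_(p, q))
    (g : 'rV[R]_m -> 'M[R]_(q, r)) x :
  mx_derivable k f x -> mx_derivable k g x ->
  mx_partial k (fun y => f y *m g y) x =
  mx_partial k f x *m g x + f x *m mx_partial k g x.
Proof.
move=> df dg; apply/matrixP => a b; rewrite [LHS]mxE.
have -> : (fun y => (f y *m g y) a b) =
    \sum_(l < q) ((fun y => f y a l) * (fun y => g y l b)).
  by apply/funext => y; rewrite fct_sumE mxE.
have dM l : derivable ((fun y => f y a l) * (fun y => g y l b)) x
    (delta_mx 0 k) by exact: (derivableM (df a l) (dg l b)).
rewrite /partial (derive_sum dM) [RHS]mxE [X in _ = X + _]mxE.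
rewrite [X in _ = _ + X]mxE -big_split; apply: eq_bigr => l _.
rewrite (deriveM (df a l) (dg l b)) !mxE /= addrC.
by congr (_ + _); exact: mulrC.
Qed.

Lemma mx_partial_tr (p q : nat) k (f : 'rV[R]_m -> 'M[R]_(p, q)) x :
  mx_partial k (fun y => (f y)^T) x = (mx_partial k f x)^T.
Proof.
apply/matrixP => a b; rewrite !mxE; congr (partial k _ x).
by apply/funext => y; rewrite mxE.
Qed.

Lemma mx_derivable_tr (p q : nat) k (f : 'rV[R]_m -> 'M[R]_(p, q)) x :
  mx_derivable k f x -> mx_derivable k (fun y => (f y)^T) x.
Proof.
move=> df a b.
have -> : (fun y => (f y)^T a b) = (fun y => f y b a).
  by apply/funext => y; rewrite mxE.
exact: df.
Qed.

Lemma eq_mx_partial (p q : nat) U k (f g : 'rV[R]_m -> 'M[R]_(p, q)) x :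
  open U -> U x -> {in U, f =1 g} -> mx_partial k f x = mx_partial k g x.
Proof.
move=> oU Ux fg; apply/matrixP => a b; rewrite !mxE.
by apply: (eq_partial _ oU Ux) => y Uy; rewrite fg.
Qed.

End MatrixPartial.
Arguments smooth_mx_derivable {R m p q U} k {K x}.
Arguments mx_derivable_cst {R m p q} k A x.
Arguments mx_derivable_tr {R m p q k f x}.

Section Integrability.
Context {R : realType} {m : nat}.
Local Notation C := R[i].
Implicit Types (k : 'I_m) (x : 'rV[R]_m) (U : set 'rV[R]_m).

(** Up to a factor, the function (u1, u2, u3) |-> g([u1, u2], u3) on the
    i-eigenbundle of K. *)
Definition torsion (K : 'rV[R]_m -> 'M[R]_(m + m)) x
    (u1 u2 u3 : 'rV[C]_(m + m)) : C :=
  gform (u2 *m mx_dir (lsubmx u1) K x) u3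
  + gform (u3 *m mx_dir (lsubmx u2) K x) u1
  + gform (u1 *m mx_dir (lsubmx u3) K x) u2.

Lemma gform0l (p : nat) (v : 'rV[C]_(p + p)) : gform 0 v = 0.
Proof. by rewrite gformE !mul0mx mxE mulr0. Qed.

Lemma gform_suml (p : nat) (I : Type) (r : seq I) (F : I -> 'rV[C]_(p + p)) v :
  gform (\sum_(i <- r) F i) v = \sum_(i <- r) gform (F i) v.
Proof.
elim: r => [|i r IH]; first by rewrite !big_nil gform0l.
by rewrite !big_cons gformDl IH.
Qed.

Lemma gform_crow_dir (p : nat) (X : 'rV[C]_m)
    (s : 'rV[R]_m -> 'rV[C]_(p + p)) x v :
  gform (crow_dir X s x) v = \sum_k X 0 k * gform (crow_partial k s x) v.
Proof. by rewrite gform_suml; apply: eq_bigr => k _; rewrite gformZl. Qed.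

Lemma gform_mx_dir (p q : nat) (X : 'rV[C]_m)
    (K : 'rV[R]_m -> 'M[R]_(q, p + p)) x (u : 'rV[C]_q) v :
  gform (u *m mx_dir X K x) v =
  \sum_k X 0 k * gform (u *m toC (mx_partial k K x)) v.
Proof.
rewrite /mx_dir mulmx_sumr gform_suml; apply: eq_bigr => k _.
by rewrite -scalemxAr gformZl.
Qed.

Lemma gform_covector (rho : 'rV[C]_m) (w : 'rV[C]_(m + m)) :
  gform (row_mx 0 rho) w = 2^-1 * \sum_k lsubmx w 0 k * rho 0 k.
Proof.
rewrite gform_covec_eval {2}/covec_eval row_mxKl mul0mx [X in _ + X]mxE addr0.
rewrite /covec_eval row_mxKr mxE; congr (_ * _).
by apply: eq_bigr => k _; congr (_ * _); rewrite mxE.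
Qed.

(** The comparison of the bracket with the torsion, one direction of
    differentiation at a time. *)
Lemma sum_combination (z : C) (a b c d e f : 'I_m -> C) :
  (forall k, z * a k - z * b k + z * (2^-1 * c k) = d k + e k + f k) ->
  z * (\sum_k a k) - z * (\sum_k b k) + z * (2^-1 * \sum_k c k) =
  \sum_k d k + \sum_k e k + \sum_k f k.
Proof.
move=> h; rewrite -!big_split -mulrBr -mulrDr -sumrB mulr_sumr -big_split.
rewrite mulr_sumr; apply: eq_bigr => k _ /=.
by rewrite mulrDr mulrBr h.
Qed.

Section Field.
Variables (U : set 'rV[R]_m) (K : 'rV[R]_m -> 'M[R]_(m + m)).
Hypotheses (oU : open U) (sK : smooth_mx U K)
  (gK : forall x, U x -> gen_complex (K x)).

(** The derivative of the equation s K = i s. *)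
Lemma i_eigen_section_partial (s : 'rV[R]_m -> 'rV[C]_(m + m)) k x :
  U x -> crow_derivable s x ->
  (forall y, U y -> (s y <= i_eigenspace (K y))%MS) ->
  crow_partial k s x *m toC (K x) + s x *m toC (mx_partial k K x) =
  'i%C *: crow_partial k s x.
Proof.
move=> Ux ds sE; apply/rowP => l.
have dK j : cderivable k (fun y => real_complex R (K y j l)) x.
  split; first exact: (smooth_mx_derivable k Ux sK j l).
  exact: derivable_cst.
have dM j : cderivable k (fun y => s y 0 j * real_complex R (K y j l)) x.
  exact: cderivableM (ds k j) (dK j).
have [_ eS] := cderivable_sum (index_enum 'I_(m + m)) dM.
have : cpartial k (fun y => \sum_j s y 0 j * real_complex R (K y j l)) x =
    cpartial k (fun y => 'i%C * s y 0 l) x.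
  apply: (eq_cpartial _ oU Ux) => y; rewrite inE => Uy.
  have /i_eigenP/rowP/(_ l) := sE y Uy; rewrite !mxE => <-.
  by apply: eq_bigr => j _; rewrite mxE.
rewrite eS (cpartialM (cderivable_cst k 'i%C x) (ds k l)) cpartial_cst.
rewrite mulr0 addr0 => e; rewrite [RHS]mxE [X in _ = _ * X]mxE -e.
rewrite [LHS]mxE [X in X + _]mxE [X in _ + X]mxE -big_split.
apply: eq_bigr => j _; rewrite (cpartialM (ds k j) (dK j)) cpartial_real.
by rewrite !mxE addrC mulrC.
Qed.

Lemma gskew_partial k x (u v : 'rV[C]_(m + m)) : U x ->
  gform (u *m toC (mx_partial k K x)) v =
  - gform u (v *m toC (mx_partial k K x)).
Proof.
move=> Ux; have two : (2 : R) != 0 by rewrite pnatr_eq0.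
have dK := smooth_mx_derivable k Ux sK.
have e : {in U, (fun y => K y *m pairing) =1
    (fun y => - pairing *m (K y)^T)}.
  move=> y; rewrite inE => Uy; have [_ sk] := gK Uy.
  by rewrite mulNmx; apply/(gskewP _ two).
have := eq_mx_partial k oU Ux e.
rewrite (mx_partialM dK (mx_derivable_cst _ _ _)).
rewrite (mx_partialM (mx_derivable_cst _ _ _) (mx_derivable_tr dK)).
rewrite !mx_partial_cst mulmx0 mul0mx addr0 add0r mx_partial_tr mulNmx.
move/(congr1 (fun A => toC A)).
rewrite map_mxN !toCM toC_pairing -map_trmx => /(gskewP _ twoC).
exact.
Qed.

(** On the i-eigenbundle, g(ds, v) is determined by the value of s and the
    derivative of K: ds fails to be a section of the bundle by a term in dK. *)
Lemma gform_partial k x (s : 'rV[R]_m -> 'rV[C]_(m + m)) (v : 'rV[C]_(m + m)) :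
  U x -> crow_derivable s x ->
  (forall y, U y -> (s y <= i_eigenspace (K y))%MS) ->
  (v <= i_eigenspace (K x))%MS ->
  2 * 'i%C * gform (crow_partial k s x) v =
  gform (s x *m toC (mx_partial k K x)) v.
Proof.
move=> Ux ds sE /i_eigenP vK; have := i_eigen_section_partial k Ux ds sE.
move/(canRL (addKr _)) => ->.
rewrite gformDl gformNl (gskew_toC (gK Ux)) vK gformZr gformZl opprK.
by rewrite -mulrA mulr_natl mulr2n.
Qed.

(** All derivatives of the sections in the formula for the bracket are
    tested against vectors of the i-eigenbundle, so they can be replaced by
    derivatives of K. *)
Lemma gform_courant x (s t : 'rV[R]_m -> 'rV[C]_(m + m)) (w : 'rV[C]_(m + m)) :
  U x -> crow_derivable s x -> crow_derivable t x ->
  (forall y, U y -> (s y <= i_eigenspace (K y))%MS) ->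
  (forall y, U y -> (t y <= i_eigenspace (K y))%MS) ->
  (w <= i_eigenspace (K x))%MS ->
  2 * 'i%C * gform (courant s t x) w = torsion K x (s x) (t x) w.
Proof.
move=> Ux ds dt sE tE wE; rewrite (courantE ds dt) !gformDl gformNl.
rewrite (gform_crow_dir (lsubmx (s x)) t) (gform_crow_dir (lsubmx (t x)) s).
rewrite gform_covector /torsion (gform_mx_dir (lsubmx (s x))).
rewrite (gform_mx_dir (lsubmx (t x))) (gform_mx_dir (lsubmx w)).
rewrite !mulrDr mulrN.
apply: sum_combination => k; rewrite [(\row__ _) _ _]mxE.
have e1 := gform_partial k Ux dt tE wE; have e2 := gform_partial k Ux ds sE wE.
have e3 := gform_partial k Ux ds sE (tE x Ux).
have e4 := gform_partial k Ux dt tE (sE x Ux).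
have s1 : gform (w *m toC (mx_partial k K x)) (s x) =
    - gform (s x *m toC (mx_partial k K x)) w.
  exact: etrans (gskew_partial k w (s x) Ux) (congr1 -%R (gformC _ _)).
have s2 : gform (t x *m toC (mx_partial k K x)) (s x) =
    - gform (s x *m toC (mx_partial k K x)) (t x).
  exact: etrans (gskew_partial k (t x) (s x) Ux) (congr1 -%R (gformC _ _)).
rewrite s1; rewrite s2 in e4.
rewrite -e1 -e2 -e3 in e4 *.
move: (gform (crow_partial k t x) w) (gform (crow_partial k s x) w)
  (gform (crow_partial k s x) (t x)) (gform (crow_partial k t x) (s x))
  (lsubmx (s x) 0 k) (lsubmx (t x) 0 k) (lsubmx w 0 k) e4.
clear=> p q r z X Y Z e4.
have i0 := @neqCi R; have two := @twoC R.
have -> : z = - r.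
  by apply: (mulfI i0); apply: (mulfI two); rewrite !mulrN !mulrA.
by field.
Qed.

End Field.
End Integrability.

(** * Closedness under the Courant bracket as vanishing of the torsion *)

Section ClosednessCriterion.
Context {R : realType} {m : nat}.
Local Notation C := R[i].
Variables (U : set 'rV[R]_m) (K : 'rV[R]_m -> 'M[R]_(m + m)).
Hypotheses (oU : open U) (sK : smooth_mx U K)
  (gK : forall x, U x -> gen_complex (K x)).

Lemma smooth_crow_derivable (p : nat) (s : 'rV[R]_m -> 'rV[C]_p) x :
  U x -> smooth_cmx U s -> crow_derivable s x.
Proof.
by move=> Ux /smooth_cmxP ss k l; exact: csmooth_cderivable Ux (ss 0 l).
Qed.

Lemma closed_torsion :
  (forall s t : 'rV[R]_m -> 'rV[C]_(m + m),
     smooth_cmx U s -> smooth_cmx U t ->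
     (forall x, U x -> (s x <= i_eigenspace (K x))%MS) ->
     (forall x, U x -> (t x <= i_eigenspace (K x))%MS) ->
     forall x, U x -> (courant s t x <= i_eigenspace (K x))%MS) ->
  forall x u1 u2 u3, U x ->
  (u1 <= i_eigenspace (K x))%MS -> (u2 <= i_eigenspace (K x))%MS ->
  (u3 <= i_eigenspace (K x))%MS -> torsion K x u1 u2 u3 = 0.
Proof.
move=> closed x u1 u2 u3 Ux u1E u2E u3E.
pose sec (u : 'rV[C]_(m + m)) (y : 'rV[R]_m) :=
  2^-1 *: (u + (- 'i%C) *: (u *m toC (K y))).
have secS u : smooth_cmx U (sec u).
  exact: (smooth_cmxZ 2^-1 oU (smooth_cmxD oU (smooth_cmx_cst U u)
    (smooth_cmxZ (- 'i%C) oU (smooth_cmxM oU (smooth_cmx_cst U u)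
      (smooth_cmx_toC oU sK))))).
have secE u y : U y -> (sec u y <= i_eigenspace (K y))%MS.
  move=> Uy; have [K2 _] := gK Uy.
  by rewrite /sec scaleNr; exact: i_eigen_proj K2 u.
have secx u : (u <= i_eigenspace (K x))%MS -> sec u x = u.
  move=> /i_eigenP uE; rewrite /sec uE scalerA mulNr mulCii opprK scale1r.
  by rewrite -mulr2n -[u *+ 2]scaler_nat scalerA mulVf ?twoC// scale1r.
have c12 := closed _ _ (secS u1) (secS u2) (secE u1) (secE u2) x Ux.
have := gform_courant oU sK gK Ux (smooth_crow_derivable Ux (secS u1))
  (smooth_crow_derivable Ux (secS u2)) (secE u1) (secE u2) u3E.
rewrite !secx// => <-.
by rewrite (i_eigen_isotropic (gK Ux) c12 u3E) mulr0.
Qed.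

Lemma torsion_closed :
  (forall x u1 u2 u3, U x ->
  (u1 <= i_eigenspace (K x))%MS -> (u2 <= i_eigenspace (K x))%MS ->
  (u3 <= i_eigenspace (K x))%MS -> torsion K x u1 u2 u3 = 0) ->
  forall s t : 'rV[R]_m -> 'rV[C]_(m + m),
    smooth_cmx U s -> smooth_cmx U t ->
    (forall x, U x -> (s x <= i_eigenspace (K x))%MS) ->
    (forall x, U x -> (t x <= i_eigenspace (K x))%MS) ->
    forall x, U x -> (courant s t x <= i_eigenspace (K x))%MS.
Proof.
move=> tors0 s t ss st sE tE x Ux; apply: (i_eigen_orth (gK Ux)) => w wE.
have := gform_courant oU sK gK Ux (smooth_crow_derivable Ux ss)
  (smooth_crow_derivable Ux st) sE tE wE.
rewrite (tors0 _ _ _ _ Ux (sE x Ux) (tE x Ux) wE) => /eqP.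
have z0 : 2 * 'i%C != 0 :> C by exact: mulf_neq0 (@twoC R) (@neqCi R).
by rewrite mulf_eq0 (negPf z0) => /eqP.
Qed.

End ClosednessCriterion.

Section Directional.
Context {R : realType} {n : nat}.
Local Notation C := R[i].
Implicit Types (X : 'rV[C]_n) (x : 'rV[R]_n).

Lemma mx_dirM (p q r : nat) (f : 'rV[R]_n -> 'M[R]_(p, q))
    (g : 'rV[R]_n -> 'M[R]_(q, r)) X x :
  (forall k, mx_derivable k f x) -> (forall k, mx_derivable k g x) ->
  mx_dir X (fun y => f y *m g y) x =
  mx_dir X f x *m toC (g x) + toC (f x) *m mx_dir X g x.
Proof.
move=> df dg; rewrite /mx_dir mulmx_suml mulmx_sumr -big_split.
apply: eq_bigr => k _ /=; rewrite (mx_partialM (df k) (dg k)).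
by rewrite map_mxD !toCM scalerDr scalemxAl scalemxAr.
Qed.

Lemma mx_dir_cst (p q : nat) (A : 'M[R]_(p, q)) X x :
  mx_dir X (fun=> A) x = 0.
Proof.
by rewrite /mx_dir big1// => k _; rewrite mx_partial_cst map_mx0 scaler0.
Qed.

Lemma mx_dir_tr (p q : nat) (f : 'rV[R]_n -> 'M[R]_(p, q)) X x :
  mx_dir X (fun y => (f y)^T) x = (mx_dir X f x)^T.
Proof.
rewrite /mx_dir linear_sum /=; apply: eq_bigr => k _.
by rewrite mx_partial_tr linearZ /= map_trmx.
Qed.

Lemma eq_mx_dir (p q : nat) (U : set 'rV[R]_n)
    (f g : 'rV[R]_n -> 'M[R]_(p, q)) X x :
  open U -> U x -> {in U, f =1 g} -> mx_dir X f x = mx_dir X g x.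
Proof.
by move=> oU Ux fg; apply: eq_bigr => k _; rewrite (eq_mx_partial k oU Ux fg).
Qed.

(** The chain rule, in the form in which the derivative of the ambient
    structure appears in that of the induced one. *)
Lemma mx_dir_comp (m p q : nat) (U : set 'rV[R]_n) (V : set 'rV[R]_m)
    (F : 'rV[R]_n -> 'rV[R]_m) (K : 'rV[R]_m -> 'M[R]_(p, q)) X x :
  open U -> open V -> (forall y, U y -> V (F y)) -> smooth_mx V K ->
  smooth_mx U F -> U x ->
  mx_dir X (fun y => K (F y)) x = mx_dir (X *m toC (jacobian F x)) K (F x).
Proof.
move=> oU oV UV sK sF Ux.
have pE k : toC (mx_partial k (fun y => K (F y)) x) =
    \sum_j toC (jacobian F x) k j *: toC (mx_partial j K (F x)).
  apply/matrixP => a b; rewrite summxE [LHS]mxE [X in real_complex _ X]mxE.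
  rewrite (partial_comp k oU oV UV (sK a b) sF Ux) rmorph_sum.
  apply: eq_bigr => j _; have := jacobianE k j oU Ux sF.
  by move: (jacobian F x) => A eA; rewrite !mxE rmorphM mulrC eA.
rewrite /mx_dir; under eq_bigr do rewrite pE scaler_sumr.
rewrite exchange_big; apply: eq_bigr => j _ /=.
by rewrite mxE scaler_suml; apply: eq_bigr => k _; rewrite scalerA.
Qed.

(** The second derivative of F is a symmetric bilinear map. *)
Lemma mx_dir_jacobian_sym (m : nat) (U : set 'rV[R]_n)
    (F : 'rV[R]_n -> 'rV[R]_m) (X Y : 'rV[C]_n) x :
  open U -> U x -> smooth_mx U F ->
  Y *m mx_dir X (jacobian F) x = X *m mx_dir Y (jacobian F) x.
Proof.
move=> oU Ux sF.
have pE k j l : mx_partial k (jacobian F) x j l =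
    partial k (partial j (fun y => F y 0 l)) x.
  rewrite mxE; apply: (eq_partial _ oU Ux) => y; rewrite inE => Uy.
  exact: jacobianE oU Uy sF.
apply/rowP => l; rewrite /mx_dir !mulmx_sumr !summxE.
have E (Z W : 'rV[C]_n) :
    \sum_i (Z *m (W 0 i *: toC (mx_partial i (jacobian F) x))) 0 l =
    \sum_i \sum_j W 0 i * (Z 0 j *
      real_complex R (partial i (partial j (fun y => F y 0 l)) x)).
  apply: eq_bigr => i _; rewrite -scalemxAr mxE mxE mulr_sumr.
  by apply: eq_bigr => j _; rewrite [toC _ _ _]mxE pE.
rewrite !E exchange_big /=; apply: eq_bigr => i _; apply: eq_bigr => j _.
by rewrite mulrCA (smooth_on_schwarz _ _ oU Ux (sF 0 l)).
Qed.

End Directional.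

(** * Behaviour of the torsion under an isometric lift *)

Section LiftedObstruction.
Context {R : realType} {n m : nat}.
Local Notation C := R[i].
Variables (U : set 'rV[R]_n) (V : set 'rV[R]_m) (F : 'rV[R]_n -> 'rV[R]_m).
Variables (K' : 'rV[R]_n -> 'M[R]_(n + n)) (K : 'rV[R]_m -> 'M[R]_(m + m)).
Variable (L : 'rV[R]_n -> 'M[R]_(n + n, m + m)).
Hypotheses (oU : open U) (oV : open V) (UV : forall y, U y -> V (F y)).
Hypotheses (sF : smooth_mx U F) (sK' : smooth_mx U K') (sK : smooth_mx V K)
  (sL : smooth_mx U L).
Hypothesis gK : forall y, V y -> gen_complex (K y).
Hypothesis KL : forall y, U y -> K' y *m L y = L y *m K (F y).
Hypothesis Lvec : forall y, U y ->
  L y *m col_mx 1%:M 0 = col_mx 1%:M 0 *m jacobian F y.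
Hypothesis Lcov : forall y, U y ->
  L y *m col_mx 0 1%:M *m (jacobian F y)^T = col_mx 0 1%:M.

Lemma lsubmxE (p : nat) (w : 'rV[C]_(p + p)) :
  lsubmx w = w *m toC (col_mx 1%:M 0).
Proof.
by rewrite map_col_mx map_mx1 map_mx0 -{2}[w]hsubmxK mul_row_col mulmx1 mulmx0
  addr0.
Qed.

Lemma rsubmxE (p : nat) (w : 'rV[C]_(p + p)) :
  rsubmx w = w *m toC (col_mx 0 1%:M).
Proof.
by rewrite map_col_mx map_mx1 map_mx0 -{2}[w]hsubmxK mul_row_col mulmx1 mulmx0
  add0r.
Qed.

Section AtPoint.
Variables (x : 'rV[R]_n) (Ux : U x).
Let A := toC (jacobian F x).
Let Lx := toC (L x).
Let dA (X : 'rV[C]_n) := mx_dir X (jacobian F) x.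
Let dL (X : 'rV[C]_n) := mx_dir X L x.

Let derF k : mx_derivable k (jacobian F) x.
Proof. exact: (smooth_mx_derivable k Ux (smooth_jacobian oU sF)). Qed.
Let derL k : mx_derivable k L x.
Proof. exact: (smooth_mx_derivable k Ux sL). Qed.

Lemma lift_lsub (u : 'rV[C]_(n + n)) : lsubmx (u *m Lx) = lsubmx u *m A.
Proof. by rewrite !lsubmxE -!mulmxA -!toCM Lvec. Qed.

Lemma lift_rsub (u : 'rV[C]_(n + n)) : rsubmx (u *m Lx) *m A^T = rsubmx u.
Proof. by rewrite !rsubmxE /A map_trmx -!mulmxA -!toCM mulmxA Lcov. Qed.

Lemma lift_gform (u v : 'rV[C]_(n + n)) : gform (u *m Lx) (v *m Lx) = gform u v.
Proof.
have cov (p q : 'rV[C]_(n + n)) :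
    covec_eval (p *m Lx) (q *m Lx) = covec_eval p q.
  rewrite /covec_eval lift_lsub -mulmxA; congr ((_ *m _) 0 0).
  by rewrite -[A]trmxK -trmx_mul lift_rsub.
by rewrite !gform_covec_eval !cov.
Qed.

Lemma lift_dir_lsub X (u : 'rV[C]_(n + n)) :
  lsubmx (u *m dL X) = lsubmx u *m dA X.
Proof.
have e : {in U, (fun y => L y *m col_mx 1%:M 0) =1
    (fun y => col_mx 1%:M 0 *m jacobian F y)}.
  by move=> y; rewrite inE => /Lvec.
have := eq_mx_dir X oU Ux e.
rewrite (mx_dirM _ (@derL) (fun k => mx_derivable_cst k _ x)).
rewrite (mx_dirM _ (fun k => mx_derivable_cst k _ x) (@derF)).
rewrite !mx_dir_cst mulmx0 mul0mx addr0 add0r => {}e.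
by rewrite !lsubmxE -!mulmxA e.
Qed.

(** The derivative of the relation between the covector part of the lift and
    the Jacobian matrix; the second derivatives of F enter here. *)
Lemma lift_dir_rsub X (u : 'rV[C]_(n + n)) :
  rsubmx (u *m dL X) *m A^T = - (rsubmx (u *m Lx) *m (dA X)^T).
Proof.
have e : {in U, (fun y => L y *m col_mx 0 1%:M *m (jacobian F y)^T) =1
    (fun=> col_mx 0 1%:M)}.
  by move=> y; rewrite inE => /Lcov.
have := eq_mx_dir X oU Ux e; rewrite mx_dir_cst.
have derLc k : mx_derivable k (fun y => L y *m col_mx 0 1%:M) x.
  have sLc := smooth_mxM oU sL (@smooth_mx_cst R n U _ _ (col_mx 0 1%:M)).
  exact: (smooth_mx_derivable k Ux sLc).
have derFT k : mx_derivable k (fun y => (jacobian F y)^T) x.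
  exact: (mx_derivable_tr (@derF k)).
rewrite (mx_dirM _ derLc derFT).
rewrite (mx_dirM _ (@derL) (fun k => mx_derivable_cst k _ x)).
rewrite mx_dir_cst mulmx0 addr0 mx_dir_tr => /eqP; rewrite addr_eq0 => /eqP {}e.
rewrite !rsubmxE /A map_trmx.
transitivity (u *m (mx_dir X L x *m toC (col_mx 0 1%:M)
  *m toC (jacobian F x)^T)); first by rewrite !mulmxA.
by rewrite e mulmxN toCM !mulmxA.
Qed.

(** The derivative of the relation K' L = L K. *)
Lemma lift_endo_dir X :
  mx_dir X K' x *m Lx + toC (K' x) *m dL X =
  dL X *m toC (K (F x)) + Lx *m mx_dir (X *m A) K (F x).
Proof.
have e : {in U, (fun y => K' y *m L y) =1 (fun y => L y *m K (F y))}.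
  by move=> y; rewrite inE => /KL.
have := eq_mx_dir X oU Ux e.
rewrite (mx_dirM _ (fun k => smooth_mx_derivable k Ux sK') (@derL)).
have sKF : smooth_mx U (fun y => K (F y)).
  exact: smooth_mx_comp oU oV UV sK sF.
rewrite (mx_dirM _ (@derL) (fun k => smooth_mx_derivable k Ux sKF)).
by rewrite (mx_dir_comp _ oU oV UV sK sF Ux).
Qed.

(** The second derivative of F along X and Y, evaluated by the covector part
    of the lift of u. *)
Let hess (X Y : 'rV[C]_n) (u : 'rV[C]_(n + n)) : C :=
  (Y *m dA X *m (rsubmx (u *m Lx))^T) 0 0.

Lemma hess_sym X Y u : hess X Y u = hess Y X u.
Proof. by rewrite /hess (mx_dir_jacobian_sym X Y oU Ux sF). Qed.

(** Differentiating the lift changes the vector part by a second derivative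
    of F and the covector part by its transpose, whence the difference of
    two terms. *)
Lemma gform_dir_lift X (u v : 'rV[C]_(n + n)) :
  2 * gform (u *m dL X) (v *m Lx) =
  hess X (lsubmx u) v - hess X (lsubmx v) u.
Proof.
rewrite gform_covec_eval mulrA divff ?twoC// mul1r addrC; congr (_ + _).
  by rewrite /covec_eval lift_dir_lsub.
rewrite /covec_eval lift_lsub -mulmxA -[A]trmxK -trmx_mul lift_dir_rsub.
by rewrite linearN /= mulmxN trmx_mul trmxK mulmxA mxE.
Qed.

(** The two terms with K' and K besides those with their derivatives act as
    i and - i on eigenvectors and add up to 2i times the derivative of the
    lift. *)
Lemma gform_endo_lift X (u v : 'rV[C]_(n + n)) :
  (u <= i_eigenspace (K' x))%MS -> (v <= i_eigenspace (K' x))%MS ->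
  gform (u *m mx_dir X K' x) v =
  gform (u *m Lx *m mx_dir (X *m A) K (F x)) (v *m Lx)
  - 'i%C * (hess X (lsubmx u) v - hess X (lsubmx v) u).
Proof.
move=> /i_eigenP uE /i_eigenP vE.
have vLE : v *m Lx *m toC (K (F x)) = 'i%C *: (v *m Lx).
  by rewrite -mulmxA -toCM -KL// toCM mulmxA vE scalemxAl.
rewrite -gform_dir_lift -lift_gform -[u *m _ *m Lx]mulmxA.
have /(canRL (addrK _)) -> := lift_endo_dir X.
rewrite mulmxBr mulmxDr !mulmxA uE gformDl gformNl gformDl.
rewrite (gskew_toC (gK (UV Ux))) vLE gformZr -scalemxAl gformZl.
set b := gform (u *m Lx *m _) _; set a := gform (u *m dL X) _.
by clearbody a b; ring.
Qed.

Lemma lift_eigen (u : 'rV[C]_(n + n)) : (u <= i_eigenspace (K' x))%MS ->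
  (u *m Lx <= i_eigenspace (K (F x)))%MS.
Proof.
move=> /i_eigenP uE; apply/i_eigenP.
by rewrite -mulmxA -toCM -KL// toCM mulmxA uE scalemxAl.
Qed.

Lemma cyclic_cancel (p q r a b c z : C) :
  p - z * (a - b) + (q - z * (c - a)) + (r - z * (b - c)) = p + q + r.
Proof. by ring. Qed.

(** Each of the three terms of the torsion contributes a difference of
    second derivatives of F, and the cyclic sum of these differences
    vanishes by symmetry. *)
Lemma torsion_lift (u1 u2 u3 : 'rV[C]_(n + n)) :
  (u1 <= i_eigenspace (K' x))%MS -> (u2 <= i_eigenspace (K' x))%MS ->
  (u3 <= i_eigenspace (K' x))%MS ->
  torsion K' x u1 u2 u3 = torsion K (F x) (u1 *m Lx) (u2 *m Lx) (u3 *m Lx).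
Proof.
move=> u1E u2E u3E; rewrite /torsion !lift_lsub.
rewrite (gform_endo_lift (lsubmx u1) u2E u3E).
rewrite (gform_endo_lift (lsubmx u2) u3E u1E).
rewrite (gform_endo_lift (lsubmx u3) u1E u2E).
rewrite (hess_sym (lsubmx u2) (lsubmx u1)) (hess_sym (lsubmx u3) (lsubmx u1)).
rewrite (hess_sym (lsubmx u3) (lsubmx u2)).
exact: cyclic_cancel.
Qed.

End AtPoint.
End LiftedObstruction.

(** * Charts and the chain rule *)

Section Charts.
Context {R : realType}.

Definition rep (n m : nat) (N M : topologicalType) (f : N -> M)
    (c : chart R n N) (d : chart R m M) (x : 'rV[R]_n) : 'rV[R]_m :=
  d (f (chart_inv c x)).

Definition overlap (n m : nat) (N M : topologicalType) (f : N -> M)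
    (c : chart R n N) (d : chart R m M) : set 'rV[R]_n :=
  chart_cod c `&` [set x | chart_dom d (f (chart_inv c x))].

Lemma overlap_open (n m : nat) (N M : topologicalType) (f : N -> M)
    (c : chart R n N) (d : chart R m M) :
  continuous f -> open (overlap f c d).
Proof.
move=> cf; rewrite openE => x [cx dx]; apply: filterI.
  exact: (open_nbhs_nbhs (conj (@chart_cod_open _ _ _ c) cx)).
have cfc : {for x, continuous (fun y => f (chart_inv c y))}.
  apply: (@continuous_comp _ _ _ (chart_inv c) f x).
    exact: chart_inv_continuous.
  exact: cf.
apply: (cfc); exact: (open_nbhs_nbhs (conj (@chart_dom_open _ _ _ d) dx)).
Qed.

Lemma smooth_map_id (m : nat) (M : manifold R m) : smooth_map (@id M).
Proof.
split; first by move=> x; exact: cvg_id.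
by move=> c d ac ad; exact: atlas_compatible.
Qed.

Lemma smooth_rep (n m : nat) (N : manifold R n) (M : manifold R m)
    (f : N -> M) (c : chart R n N) (d : chart R m M) :
  smooth_map f -> atlas c -> atlas d -> smooth_mx (overlap f c d) (rep f c d).
Proof. by move=> [_ sf] ac ad; exact: sf. Qed.

(** The chart d in the middle drops out of the composition near x, because
    the two representatives are composed on a set where d is defined. *)
Lemma jacobian_rep_comp (n m k : nat) (N : manifold R n) (M : manifold R m)
    (P : manifold R k) (f : N -> M) (g : M -> P)
    (c : chart R n N) (d : chart R m M) (e : chart R k P) (x : 'rV[R]_n) :
  smooth_map f -> smooth_map g -> atlas c -> atlas d -> atlas e ->
  chart_cod c x -> chart_dom d (f (chart_inv c x)) ->
  chart_dom e (g (f (chart_inv c x))) ->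
  jacobian (rep (g \o f) c e) x =
  jacobian (rep f c d) x *m jacobian (rep g d e) (rep f c d x).
Proof.
move=> sf sg ac ad ae cx dx ex.
pose W := overlap f c d `&` overlap (g \o f) c e.
have cf := sf.1; have cg := sg.1.
have oW : open W.
  apply: openI; first exact: overlap_open.
  by apply: overlap_open => y; apply: continuous_comp; [exact: cf | exact: cg].
have Wx : W x by [].
have oV : open (overlap g d e) by exact: overlap_open.
have WV y : W y -> overlap g d e (rep f c d y).
  move=> [[cy dy] [_ ey]]; split; first exact: chart_funP.
  by rewrite /rep /= chart_funK.
have sF : smooth_mx W (rep f c d).
  by apply: smooth_mx_sub (smooth_rep sf ac ad); exact: subIsetl.
have sG := smooth_rep sg ad ae.
have gfE : {in W, rep g d e \o rep f c d =1 rep (g \o f) c e}.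
  by move=> y; rewrite inE => -[[cy dy] _]; rewrite /rep /= chart_funK.
have sGF : smooth_mx W (rep g d e \o rep f c d).
  exact: smooth_mx_comp oW oV WV sG sF.
rewrite -(eq_jacobian oW Wx gfE sGF); apply: jacobian_comp.
  exact: smooth_mx_differentiable oW Wx sF.
exact: smooth_mx_differentiable oV (WV x Wx) sG.
Qed.

Lemma chart_atP (m : nat) (M : manifold R m) (p : M) :
  atlas (chart_at p) /\ chart_dom (chart_at p) p.
Proof. exact: (svalP (cid (atlas_cover p))). Qed.

Lemma chart_at_cod (m : nat) (M : manifold R m) (p : M) :
  chart_cod (chart_at p) (chart_at p p).
Proof. by apply: chart_funP; have [] := chart_atP p. Qed.

Lemma chart_atK (m : nat) (M : manifold R m) (p : M) :
  chart_inv (chart_at p) (chart_at p p) = p.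
Proof. by apply: chart_funK; have [] := chart_atP p. Qed.

(** The matrix C for which frame c p is courant_frame C. *)
Definition transition_mx (m : nat) (M : manifold R m) (c : chart R m M)
    (p : M) : 'M[R]_m :=
  jacobian (rep id (chart_at p) c) (chart_at p p).

(** The changes of coordinates in the two directions are inverse to each
    other. *)
Lemma transition_mx_unit (m : nat) (M : manifold R m) (c : chart R m M)
    (p : M) : atlas c -> chart_dom c p -> transition_mx c p \in unitmx.
Proof.
move=> ac cp; have [a0 d0] := chart_atP p.
have sid := smooth_map_id M.
have := @jacobian_rep_comp _ _ _ M M M id id (chart_at p) c (chart_at p)
  (chart_at p p) sid sid a0 ac a0 (chart_at_cod p).
rewrite chart_atK => /(_ cp d0).
have idE : {in chart_cod (chart_at p),
    id =1 rep (id \o id) (chart_at p) (chart_at p)}.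
  by move=> y; rewrite inE => cy; rewrite /rep /= chart_invK.
have sI : smooth_mx (chart_cod (chart_at p)) (@id 'rV[R]_m).
  apply: eq_smooth_mx (smooth_mx_sub _ (smooth_rep sid a0 a0)).
  - exact: chart_cod_open.
  - by move=> y; rewrite inE => cy; rewrite /rep /= chart_invK.
  - by move=> y cy; split=> //; exact: chart_invP.
have eI := eq_jacobian (@chart_cod_open _ _ _ _) (chart_at_cod p) idE sI.
move=> /esym e; have {eI}e := etrans (etrans e (esym eI)) (jacobian_id _).
exact: (mulmx1_unit e).1.
Qed.

Lemma jacobian_tangent_map (n m : nat) (N : manifold R n) (M : manifold R m)
    (f : N -> M) (c : chart R n N) (d : chart R m M) (x : 'rV[R]_n) :
  smooth_map f -> atlas c -> atlas d -> overlap f c d x ->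
  let p := chart_inv c x in
  jacobian (rep f c d) x =
  invmx (transition_mx c p) *m tangent_map f p *m transition_mx d (f p).
Proof.
move=> sf ac ad [cx dx] p; have [an dn] := chart_atP p.
have [am dm] := chart_atP (f p); have cp : chart_dom c p := chart_invP cx.
have sidN := smooth_map_id N; have sidM := smooth_map_id M.
have uc := transition_mx_unit ac cp.
have e1 := @jacobian_rep_comp _ _ _ N N M id f (chart_at p) c d (chart_at p p)
  sidN sf an ac ad (chart_at_cod p).
rewrite chart_atK in e1; have {}e1 := e1 cp dx.
have e2 := @jacobian_rep_comp _ _ _ N M M f id (chart_at p) (chart_at (f p)) d
  (chart_at p p) sf sidM an am ad (chart_at_cod p).
rewrite chart_atK in e2; have {}e2 := e2 dm dx.
have rx : rep id (chart_at p) c (chart_at p p) = x.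
  by rewrite /rep chart_atK chart_invK.
have ry : rep f (chart_at p) (chart_at (f p)) (chart_at p p) =
    chart_at (f p) (f p) by rewrite /rep chart_atK.
rewrite rx in e1; rewrite ry in e2.
apply: (can_inj (mulKmx uc)); rewrite !mulmxA mulmxV// mul1mx.
exact: etrans (esym e1) e2.
Qed.

End Charts.

(** * Naturality and smoothness of restricted structures *)

Section Naturality.
Context {R : realType}.
Local Notation C := R[i].

Definition restrict_metric (n m : nat) (A : 'M[R]_(n, m)) (gam psi : 'M[R]_m) :
    'M[R]_(n + n) :=
  metric_of (A *m gam *m A^T) (A *m psi *m A^T).

Definition restrict_complex (n m : nat) (A : 'M[R]_(n, m))
    (gam psi Jp Jm : 'M[R]_m) : 'M[R]_(n + n) :=
  endo_of (A *m gam *m A^T) (A *m psi *m A^T)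
    (restrict_endo A gam Jp) (restrict_endo A gam Jm).

Section ChangeOfFrame.
Variables (n m : nat) (A : 'M[R]_(n, m)) (B : 'M[R]_n) (D : 'M[R]_m).
Variables (G J : 'M[R]_(m + m)) (gam psi Jp Jm : 'M[R]_m).
Hypotheses (fA : row_free A) (uB : B \in unitmx) (uD : D \in unitmx).
Hypothesis hd : herm_data G J gam psi Jp Jm.
Hypotheses (Ap : (A *m Jp <= A)%MS) (Am : (A *m Jm <= A)%MS).
Let A' := invmx B *m A *m D.

Lemma change_row_free : row_free A'.
Proof.
have fB : row_free (invmx B) by rewrite row_free_unit unitmx_inv.
have fD : row_free D by rewrite row_free_unit.
by rewrite /A' /row_free !mxrankMfree//; exact: fB.
Qed.

Lemma change_invariant (E : 'M[R]_m) : (A *m E <= A)%MS ->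
  (A' *m (invmx D *m E *m D) <= A')%MS.
Proof.
move=> /submxP[Z eZ].
have -> : A' *m (invmx D *m E *m D) = (invmx B *m Z *m B) *m A'.
  rewrite /A' !mulmxA !mulmxK//.
  by rewrite -[_ *m A *m E]mulmxA eZ !mulmxA.
exact: submxMl.
Qed.

Lemma change_form (b : 'M[R]_m) :
  invmx B *m (A *m b *m A^T) *m (invmx B)^T =
  A' *m (invmx D *m b *m (invmx D)^T) *m A'^T.
Proof.
rewrite /A' !trmx_mul !mulmxA mulmxK//; congr (_ *m _ *m _).
by rewrite -[RHS]mulmxA -trmx_mul mulmxV// trmx1 mulmx1.
Qed.

(** Both sides are the endomorphism induced by E on the row space of A',
    which is determined by its composition with A'. *)
Lemma change_restrict_endo (E : 'M[R]_m) : (A *m E <= A)%MS ->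
  invmx B *m restrict_endo A gam E *m B =
  restrict_endo A' (invmx D *m gam *m (invmx D)^T) (invmx D *m E *m D).
Proof.
move=> AE; have [eg _ _ _ _] := hd; have fA' := change_row_free.
have [eg' _ _ _ _] := herm_data_frame uD hd.
apply: (row_free_inj fA').
rewrite (restrict_endoP fA' eg' (change_invariant AE)).
have := restrict_endoP fA eg AE; move: (restrict_endo A gam E) => Z eZ.
by rewrite /A' !mulmxA !mulmxK// -[_ *m Z *m A]mulmxA eZ !mulmxA.
Qed.

(** Restricting a structure commutes with changes of frame, so the induced
    structure can be computed in any pair of charts. *)
Lemma restrict_frame :
  let gam' := invmx D *m gam *m (invmx D)^T in
  let psi' := invmx D *m psi *m (invmx D)^T in
  invmx (courant_frame B) *m restrict_metric A gam psi
    *m (invmx (courant_frame B))^T = restrict_metric A' gam' psi' /\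
  invmx (courant_frame B) *m restrict_complex A gam psi Jp Jm
    *m courant_frame B =
  restrict_complex A' gam' psi' (invmx D *m Jp *m D) (invmx D *m Jm *m D).
Proof.
move=> gam' psi'.
have hB := herm_data_frame uB (herm_data_restrict fA hd Ap Am).
have eG := herm_data_metric hB; have eJ := herm_data_endo hB.
rewrite /restrict_metric /restrict_complex eG eJ !change_form.
by rewrite (change_restrict_endo Ap) (change_restrict_endo Am).
Qed.

End ChangeOfFrame.

Lemma sub_mul_unit (F : fieldType) (p : nat) (u : 'rV[F]_p) (E A : 'M[F]_p) :
  A \in unitmx -> (u <= E *m A)%MS = (u *m invmx A <= E)%MS.
Proof.
move=> uA; apply/idP/idP => [/submxP[w ->]|uE].
  by rewrite mulmxA mulmxK// submxMl.
by rewrite -(mulmxKV uA u) submxMr.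
Qed.

Lemma i_eigen_frame (p : nat) (K F : 'M[R]_p) : F \in unitmx ->
  (i_eigenspace K *m toC F :=: i_eigenspace (invmx F *m K *m F))%MS.
Proof.
move=> uF; have uFC : toC F \in unitmx by rewrite map_unitmx.
apply: eqmx_rV => u; rewrite (sub_mul_unit _ _ uFC) -map_invmx.
apply/i_eigenP/i_eigenP; rewrite !toCM !mulmxA.
  by move=> ->; rewrite -scalemxAl -mulmxA -toCM mulVmx// map_mx1 mulmx1.
move=> e; apply: (can_inj (mulmxK uFC)); rewrite e -scalemxAl -mulmxA -toCM.
by rewrite mulVmx// map_mx1 mulmx1.
Qed.

Lemma tau_frame (m : nat) (D a : 'M[R]_m) : D \in unitmx ->
  tau a *m courant_frame D = D *m tau (invmx D *m a *m (invmx D)^T).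
Proof.
move=> uD; rewrite /tau mul_mx_row mul_row_block !mulmx0 addr0 add0r mulmx1.
by rewrite mul1mx !mulmxA mulmxV// mul1mx.
Qed.

Lemma L_frame (m : nat) (D a E : 'M[R]_m) : D \in unitmx ->
  (i_eigenspace E *m toC (tau a) *m toC (courant_frame D) :=:
   i_eigenspace (invmx D *m E *m D)
     *m toC (tau (invmx D *m a *m (invmx D)^T)))%MS.
Proof.
move=> uD; set a' := invmx D *m a *m _.
have -> : i_eigenspace E *m toC (tau a) *m toC (courant_frame D) =
    i_eigenspace E *m toC D *m toC (tau a').
  by rewrite -[LHS]mulmxA -toCM (tau_frame _ uD) toCM mulmxA.
exact: (eqmxMr _ (i_eigen_frame E uD)).
Qed.

End Naturality.

Section SmoothData.
Context {R : realType} {m : nat}.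
Implicit Types (U : set 'rV[R]_m).

Lemma smooth_dsub (p q r s : nat) U (f : 'rV[R]_m -> 'M[R]_(p + r, q + s)) :
  open U -> smooth_mx U f ->
  smooth_mx U (fun y => drsubmx (f y)) /\ smooth_mx U (fun y => dlsubmx (f y)).
Proof.
move=> oU sf; split=> i j.
  apply: (eq_smooth_on oU _ (sf (rshift p i) (rshift q j))) => y _.
  by rewrite !mxE.
apply: (eq_smooth_on oU _ (sf (rshift p i) (lshift s j))) => y _.
by rewrite !mxE.
Qed.

Lemma smooth_tau U (n : nat) (b : 'rV[R]_m -> 'M[R]_n) :
  open U -> smooth_mx U b -> smooth_mx U (fun y => tau (b y)).
Proof. move=> oU; exact: (smooth_row_mx oU (smooth_mx_cst 1%:M)). Qed.

Lemma smooth_taus U (n : nat) (g p : 'rV[R]_m -> 'M[R]_n) :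
  open U -> smooth_mx U g -> smooth_mx U p ->
  smooth_mx U (fun y => taus (g y) (p y)).
Proof.
move=> oU sg sp.
exact: (smooth_col_mx oU (smooth_tau oU (smooth_mxD oU sp sg))
  (smooth_tau oU (smooth_mxD oU sp (smooth_mxN oU sg)))).
Qed.

Lemma smooth_bdiag U (p q r s : nat) (f : 'rV[R]_m -> 'M[R]_(p, r))
    (g : 'rV[R]_m -> 'M[R]_(q, s)) : open U ->
  smooth_mx U f -> smooth_mx U g -> smooth_mx U (fun y => bdiag (f y) (g y)).
Proof.
move=> oU sf sg.
exact: (smooth_col_mx oU (smooth_row_mx oU sf (smooth_mx_cst 0))
  (smooth_row_mx oU (smooth_mx_cst 0) sg)).
Qed.

Section Fields.
Variables (U : set 'rV[R]_m) (n : nat).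
Variables (g p Kp Km : 'rV[R]_m -> 'M[R]_n).
Hypotheses (oU : open U) (sg : smooth_mx U g) (sp : smooth_mx U p)
  (sKp : smooth_mx U Kp) (sKm : smooth_mx U Km).
Hypothesis uT : forall y, U y -> taus (g y) (p y) \in unitmx.

Lemma smooth_metric_of : smooth_mx U (fun y => metric_of (g y) (p y)).
Proof.
have siT := smooth_invmx oU uT (smooth_taus oU sg sp).
have s2g := smooth_mxZ 2 oU sg.
exact: (smooth_mxM oU (smooth_mxM oU siT (smooth_bdiag oU s2g s2g))
  (smooth_mx_tr oU siT)).
Qed.

Lemma smooth_endo_of :
  smooth_mx U (fun y => endo_of (g y) (p y) (Kp y) (Km y)).
Proof.
have sT := smooth_taus oU sg sp; have siT := smooth_invmx oU uT sT.
exact: (smooth_mxM oU (smooth_mxM oU siT (smooth_bdiag oU sKp sKm)) sT).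
Qed.

End Fields.

Lemma smooth_second_gcs U (n : nat) (G J : 'rV[R]_m -> 'M[R]_(n + n)) :
  open U -> smooth_mx U G -> smooth_mx U J ->
  smooth_mx U (fun y => second_gcs (G y) (J y)).
Proof.
move=> oU sG sJ.
exact: (smooth_mxM oU sJ (smooth_mxM oU sG (smooth_mx_cst pairing))).
Qed.

End SmoothData.

(** * Structures in a chart *)

Section LocalFrames.
Context {R : realType} {m : nat}.
Local Notation C := R[i].

Lemma i_eigen_projmx (n : nat) (D : 'M[R]_n) : D *m D = - 1%:M ->
  (i_eigenspace D :=: (1%:M + (- 'i%C) *: toC D)%R)%MS.
Proof.
move=> D2; apply: eqmx_rV => u; apply/idP/idP => [/i_eigenP uD|/submxP[w ->]].
  apply/submxP; exists (2^-1 *: u); rewrite mulmxDr mulmx1 -scalemxAr.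
  rewrite -scalemxAl uD !scalerA -scalerDl [_ * 'i%C]mulrAC mulNr mulCii.
  rewrite opprK mul1r -[_ + _]mulr2n -[_ *+ 2]mulr_natr mulVf ?twoC//.
  by rewrite scale1r.
apply/i_eigenP; rewrite mulmxDr mulmx1 -scalemxAr mulmxDl -scalemxAl -mulmxA.
rewrite (toC_square D2) mulmxN mulmx1 scalerDr scalerA mulrN mulCii opprK.
by rewrite scale1r scaleNr scalerN opprK addrC.
Qed.

Lemma open_positive (U : set 'rV[R]_m) (f : 'rV[R]_m -> R) :
  open U -> (forall y, U y -> {for y, continuous f}) ->
  open (U `&` [set y | 0 < f y]).
Proof.
move=> oU cf; rewrite openE => y [Uy fy]; apply: filterI.
  exact: (open_nbhs_nbhs (conj oU Uy)).
apply: (cf y Uy [set t : R | 0 < t]).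
by apply: open_nbhs_nbhs; split=> //; exact: open_gt.
Qed.

(** Choose rows of a multiple Q *m P that form a basis at x; they remain
    independent nearby by continuity of a minor, and span the image because
    the rank is constant. *)
Lemma constant_rank_frame (U : set 'rV[R]_m) (p q : nat)
    (P : 'rV[R]_m -> 'M[C]_(p, q)) (x : 'rV[R]_m) :
  open U -> U x -> smooth_cmx U P ->
  (forall y, U y -> \rank (P y) = \rank (P x)) ->
  exists (V : set 'rV[R]_m) (k : nat) (F : 'rV[R]_m -> 'M[C]_(k, q)),
    [/\ open V, V x, V `<=` U, smooth_cmx V F &
        forall y, V y -> row_free (F y) /\ (F y :=: P y)%MS].
Proof.
move=> oU Ux sP rP.
have /submxP[Q eQ] : (row_base (P x) <= P x)%MS by rewrite eq_row_base.
have /row_freeP[B eB] := row_base_free (P x).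
have sQP : smooth_cmx U (fun y => Q *m P y).
  exact: (smooth_cmxM oU (smooth_cmx_cst U Q) sP).
have sQPB : smooth_cmx U (fun y => Q *m P y *m B).
  exact: (smooth_cmxM oU sQP (smooth_cmx_cst U B)).
have [sre _] := csmooth_det oU sQPB.
(* At x this determinant is 1, so V is a neighbourhood of x on which the rows
   of Q *m P y stay independent. *)
pose V := U `&` [set y | 0 < complex.Re (\det (Q *m P y *m B))].
have VU : V `<=` U by exact: subIsetl.
have oV : open V.
  by apply: open_positive oU _ => y Uy; have [] := smooth_onC0 sre Uy.
exists V, (\rank (P x)), (fun y => Q *m P y); split=> //.
- by split=> //=; rewrite -eQ eB det1 /= ltr01.
- case: sQP => sr si; split; exact: smooth_mx_sub VU _.
move=> y [Uy /= dy].
have rk : \rank (Q *m P y) = \rank (P x).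
  apply/eqP; rewrite eqn_leq rank_leq_row /=.
  have : Q *m P y *m B \in unitmx.
    rewrite unitmxE unitfE; apply: contraTneq dy => ->.
    by rewrite /= ltxx.
  by rewrite -row_free_unit => /eqP {1}<-; exact: mxrankM_maxl.
split; first by rewrite /row_free rk.
apply/eqmxP; rewrite submxMl /=.
by rewrite -(geq_leqif (mxrank_leqif_sup (submxMl Q (P y)))) rk rP.
Qed.

(** The eigenspace is the image of the projector 1 - iD, up to a factor, and
    has dimension n / 2 at all points. *)
Lemma i_eigen_tau_frame (U : set 'rV[R]_m) (n : nat)
    (D a : 'rV[R]_m -> 'M[R]_n) (x : 'rV[R]_m) :
  open U -> U x -> smooth_mx U D -> smooth_mx U a ->
  (forall y, U y -> D y *m D y = - 1%:M) ->
  exists (V : set 'rV[R]_m) (k : nat) (F : 'rV[R]_m -> 'M[C]_(k, n + n)),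
    [/\ open V, V x, V `<=` U, smooth_cmx V F &
        forall y, V y -> row_free (F y) /\
          (F y :=: i_eigenspace (D y) *m toC (tau (a y)))%MS].
Proof.
move=> oU Ux sD sa D2.
pose P y : 'M[C]_(n, n + n) :=
  (1%:M + (- 'i%C) *: toC (D y)) *m toC (tau (a y)).
have PE y : U y -> (P y :=: i_eigenspace (D y) *m toC (tau (a y)))%MS.
  by move=> Uy; apply: eqmxMr; apply: eqmx_sym; exact: i_eigen_projmx (D2 y Uy).
have sP : smooth_cmx U P.
  have s1 := smooth_cmxD oU (smooth_cmx_cst U (1%:M : 'M[C]_n))
    (smooth_cmxZ (- 'i%C) oU (smooth_cmx_toC oU sD)).
  exact: (smooth_cmxM oU s1 (smooth_cmx_toC oU (smooth_tau oU sa))).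
have rtau (b : 'M[R]_n) : row_free (toC (tau b)).
  apply/row_freeP; exists (toC (col_mx 1%:M 0)).
  by rewrite -toCM /tau mul_row_col mulmx1 mulmx0 addr0 map_mx1.
have rP y : U y -> (\rank (P y) + \rank (P y) = n)%N.
  move=> Uy; rewrite (PE y Uy) (mxrankMfree _ (rtau _)).
  exact: rank_i_eigen (D2 y Uy).
have [|V [k [F [oV Vx VU sF FP]]]] := constant_rank_frame oU Ux sP.
  by move=> y Uy; have := rP y Uy; have := rP x Ux; lia.
exists V, k, F; split=> // y Vy; have [rF FE] := FP y Vy.
by split=> //; exact: eqmx_trans FE (PE y (VU y Vy)).
Qed.

End LocalFrames.

Section LocalData.
Context {R : realType} {m : nat} {M : manifold R m}.
Local Notation C := R[i].
Variables (S : almost_gen_hermitian M) (d : chart R m M).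
Hypothesis ad : atlas d.

Definition loc_metric (z : 'rV[R]_m) : 'M[R]_(m + m) :=
  let p := chart_inv d z in
  invmx (frame d p) *m agh_G S p *m (invmx (frame d p))^T.

Definition loc_complex (z : 'rV[R]_m) : 'M[R]_(m + m) :=
  let p := chart_inv d z in invmx (frame d p) *m agh_J S p *m frame d p.

(** The pair (gamma, psi) is chosen separately at each point; recomputing it
    from the local components of G shows that it is smooth. *)
Definition loc_gam (z : 'rV[R]_m) : 'M[R]_m := invmx (drsubmx (loc_metric z)).

Definition loc_psi (z : 'rV[R]_m) : 'M[R]_m :=
  invmx (drsubmx (loc_metric z)) *m dlsubmx (loc_metric z).

Definition loc_Jp (z : 'rV[R]_m) : 'M[R]_m :=
  tau (loc_psi z + loc_gam z) *m loc_complex z *m col_mx 1%:M 0.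

Definition loc_Jm (z : 'rV[R]_m) : 'M[R]_m :=
  tau (loc_psi z - loc_gam z) *m loc_complex z *m col_mx 1%:M 0.

Section AtPoint.
Variables (z : 'rV[R]_m) (dz : chart_cod d z).
Let p := chart_inv d z.
Let D := transition_mx d p.

Lemma loc_transition_unit : D \in unitmx.
Proof. by apply: transition_mx_unit ad _; exact: chart_invP. Qed.

Let gp := gamma_psi (agh_G S p).
Let Jp := Jplus (agh_G S p) (agh_J S p).
Let Jm := Jminus (agh_G S p) (agh_J S p).

Lemma herm_data_point : herm_data (agh_G S p) (agh_J S p) gp.1 gp.2 Jp Jm.
Proof. exact: gen_hermitian_data (agh_hermitian S p). Qed.

(** The data computed from the local components are the transforms of those
    at the point, by uniqueness. *)
Lemma loc_dataE : [/\ loc_gam z = invmx D *m gp.1 *m (invmx D)^T,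
  loc_psi z = invmx D *m gp.2 *m (invmx D)^T,
  loc_Jp z = invmx D *m Jp *m D & loc_Jm z = invmx D *m Jm *m D].
Proof.
have h := herm_data_frame loc_transition_unit herm_data_point.
have [eg ep] := herm_data_gam_psi h; have [ejp ejm] := herm_data_Jpm h.
have egl : loc_gam z = invmx D *m gp.1 *m (invmx D)^T by rewrite eg.
have epl : loc_psi z = invmx D *m gp.2 *m (invmx D)^T by rewrite ep.
by split; rewrite // /loc_Jp /loc_Jm egl epl ?ejp ?ejm.
Qed.

Lemma loc_herm_data : herm_data (loc_metric z) (loc_complex z)
  (loc_gam z) (loc_psi z) (loc_Jp z) (loc_Jm z).
Proof.
have [-> -> -> ->] := loc_dataE.
exact: (herm_data_frame loc_transition_unit herm_data_point).
Qed.

Lemma local_Lplus : (local_bundle (Lplus_bundle S) d z :=: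
  i_eigenspace (loc_Jp z) *m toC (tau (loc_psi z + loc_gam z)))%MS.
Proof.
have [-> -> -> _] := loc_dataE; rewrite -mulmxDl -mulmxDr.
apply: eqmx_trans (eqmxMr _ (LplusE herm_data_point)) _.
exact: (L_frame _ _ loc_transition_unit).
Qed.

Lemma local_Lminus : (local_bundle (Lminus_bundle S) d z :=:
  i_eigenspace (loc_Jm z) *m toC (tau (loc_psi z - loc_gam z)))%MS.
Proof.
have [-> -> _ ->] := loc_dataE; rewrite -mulmxBl -mulmxBr.
apply: eqmx_trans (eqmxMr _ (LminusE herm_data_point)) _.
exact: (L_frame _ _ loc_transition_unit).
Qed.

Lemma local_i_eigen (K : M -> 'M[R]_(m + m)) :
  (local_bundle (fun q => i_eigenspace (K q)) d z :=:
   i_eigenspace (invmx (frame d p) *m K p *m frame d p))%MS.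
Proof.
apply: i_eigen_frame; apply: courant_frame_unit.
exact: loc_transition_unit.
Qed.

Lemma loc_second :
  invmx (frame d p) *m second_gcs (agh_G S p) (agh_J S p) *m frame d p =
  second_gcs (loc_metric z) (loc_complex z).
Proof. by rewrite (second_gcs_frame loc_transition_unit). Qed.

End AtPoint.

Let oU : open (chart_cod d) := @chart_cod_open _ _ _ d.

Lemma smooth_loc_metric : smooth_mx (chart_cod d) loc_metric.
Proof. exact: agh_smoothG. Qed.

Lemma smooth_loc_complex : smooth_mx (chart_cod d) loc_complex.
Proof. exact: agh_smoothJ. Qed.

Lemma loc_metric_dr_unit z : chart_cod d z ->
  drsubmx (loc_metric z) \in unitmx.
Proof.
move=> dz; have [eg _ _ _ _] := loc_herm_data dz.
by have := euclidean_unit eg; rewrite unitmx_inv.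
Qed.

Lemma smooth_loc_gam : smooth_mx (chart_cod d) loc_gam.
Proof.
have [sdr _] := smooth_dsub oU smooth_loc_metric.
exact: (smooth_invmx oU loc_metric_dr_unit sdr).
Qed.

Lemma smooth_loc_psi : smooth_mx (chart_cod d) loc_psi.
Proof.
have [_ sdl] := smooth_dsub oU smooth_loc_metric.
exact: (smooth_mxM oU smooth_loc_gam sdl).
Qed.

Lemma smooth_loc_Jp : smooth_mx (chart_cod d) loc_Jp.
Proof.
have st := smooth_tau oU (smooth_mxD oU smooth_loc_psi smooth_loc_gam).
exact: (smooth_mxM oU (smooth_mxM oU st smooth_loc_complex)
  (smooth_mx_cst (col_mx 1%:M 0))).
Qed.

Lemma smooth_loc_Jm : smooth_mx (chart_cod d) loc_Jm.
Proof.
have st := smooth_tau oU (smooth_mxD oU smooth_loc_psi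
  (smooth_mxN oU smooth_loc_gam)).
exact: (smooth_mxM oU (smooth_mxM oU st smooth_loc_complex)
  (smooth_mx_cst (col_mx 1%:M 0))).
Qed.

End LocalData.

Section SmoothSubbundles.
Context {R : realType} {m : nat} {M : manifold R m}.
Variable S : almost_gen_hermitian M.

Lemma smooth_Lplus_bundle : smooth_subbundle (Lplus_bundle S).
Proof.
move=> c ac x cx; have oU := @chart_cod_open _ _ _ c.
have [|V [k [F [oV Vx VU sF FP]]]] := i_eigen_tau_frame oU cx
    (smooth_loc_Jp S ac)
    (smooth_mxD oU (smooth_loc_psi S ac) (smooth_loc_gam S ac)).
  by move=> y cy; have [_ _ _ _ []] := loc_herm_data S ac cy.
exists V, k, F; split=> // y Vy; have [rF FE] := FP y Vy; split=> //.
exact: eqmx_trans FE (eqmx_sym (local_Lplus S ac (VU y Vy))).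
Qed.

Lemma smooth_Lminus_bundle : smooth_subbundle (Lminus_bundle S).
Proof.
move=> c ac x cx; have oU := @chart_cod_open _ _ _ c.
have [|V [k [F [oV Vx VU sF FP]]]] := i_eigen_tau_frame oU cx
    (smooth_loc_Jm S ac)
    (smooth_mxD oU (smooth_loc_psi S ac) (smooth_mxN oU (smooth_loc_gam S ac))).
  by move=> y cy; have [_ _ _ _ []] := loc_herm_data S ac cy.
exists V, k, F; split=> // y Vy; have [rF FE] := FP y Vy; split=> //.
exact: eqmx_trans FE (eqmx_sym (local_Lminus S ac (VU y Vy))).
Qed.

Lemma eqmx_smooth_subbundle (E E' : M -> 'M[R[i]]_(m + m)) :
  (forall p, (E p :=: E' p)%MS) -> smooth_subbundle E -> smooth_subbundle E'.
Proof.
move=> EE sE c ac x cx; have [V [k [F [oV Vx VU sF FP]]]] := sE c ac x cx.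
exists V, k, F; split=> // y Vy; have [rF FE] := FP y Vy; split=> //.
by apply: eqmx_trans FE _; apply: eqmxMr; exact: EE.
Qed.

End SmoothSubbundles.

(** * The induced structure on a submanifold *)

Section InducedStructure.
Context {R : realType} {n m : nat} {N : manifold R n} {M : manifold R m}.
Local Notation C := R[i].
Variables (S : almost_gen_hermitian M) (iota : N -> M).
Hypothesis hN : submanifold iota.
Let A x := tangent_map iota x.
Let gam x := (gamma_psi (agh_G S (iota x))).1.
Let psi x := (gamma_psi (agh_G S (iota x))).2.
Let Jp x := Jplus (agh_G S (iota x)) (agh_J S (iota x)).
Let Jm x := Jminus (agh_G S (iota x)) (agh_J S (iota x)).
Hypotheses (AJp : forall x, (A x *m Jp x <= A x)%MS)
  (AJm : forall x, (A x *m Jm x <= A x)%MS).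

Definition induced_metric (x : N) : 'M[R]_(n + n) :=
  restrict_metric (A x) (gam x) (psi x).

Definition induced_complex (x : N) : 'M[R]_(n + n) :=
  restrict_complex (A x) (gam x) (psi x) (Jp x) (Jm x).

Let siota : smooth_map iota. Proof. by case: hN. Qed.
Let fA x : row_free (A x). Proof. by case: hN. Qed.
Let hdM x : herm_data (agh_G S (iota x)) (agh_J S (iota x))
  (gam x) (psi x) (Jp x) (Jm x).
Proof. exact: gen_hermitian_data (agh_hermitian S _). Qed.

Lemma induced_hermitian x :
  gen_hermitian (induced_metric x) (induced_complex x).
Proof.
have hI := herm_data_restrict (fA x) (hdM x) (AJp x) (AJm x).
exact: (herm_data_hermitian hI).
Qed.

Section InCharts.
Variables (c : chart R n N) (d : chart R m M).
Hypotheses (ac : atlas c) (ad : atlas d).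
Let W := overlap iota c d.
Let F := rep iota c d.
Let B y := jacobian F y.
Let g y := loc_gam S d (F y).
Let p y := loc_psi S d (F y).
Let Kp y := loc_Jp S d (F y).
Let Km y := loc_Jm S d (F y).

Lemma overlap_iota_open : open W.
Proof. by apply: overlap_open; case: siota. Qed.

Lemma rep_cod y : W y -> chart_cod d (F y).
Proof. by move=> [_ dy]; exact: chart_funP. Qed.

Section AtPoint.
Variables (y : 'rV[R]_n) (Wy : W y).
Let q := chart_inv c y.

Let uc : transition_mx c q \in unitmx.
Proof. by case: Wy => cy _; exact: transition_mx_unit ac (chart_invP cy). Qed.
Let ud : transition_mx d (iota q) \in unitmx.
Proof. by case: Wy => _ dy; exact: transition_mx_unit ad dy. Qed.

Let BE : B y = invmx (transition_mx c q) *m A q *m transition_mx d (iota q).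
Proof. exact: jacobian_tangent_map. Qed.

Let locE : [/\ g y = invmx (transition_mx d (iota q)) *m gam q
    *m (invmx (transition_mx d (iota q)))^T,
  p y = invmx (transition_mx d (iota q)) *m psi q
    *m (invmx (transition_mx d (iota q)))^T,
  Kp y = invmx (transition_mx d (iota q)) *m Jp q
    *m transition_mx d (iota q) &
  Km y = invmx (transition_mx d (iota q)) *m Jm q
    *m transition_mx d (iota q)].
Proof.
have := loc_dataE S ad (rep_cod Wy); rewrite /F /rep chart_funK//.
by case: Wy.
Qed.

Lemma local_row_free : row_free (B y).
Proof. by rewrite BE; exact: change_row_free. Qed.

Lemma local_invariant_plus : (B y *m Kp y <= B y)%MS.
Proof. by have [_ _ -> _] := locE; rewrite BE; exact: change_invariant. Qed.

Lemma local_invariant_minus : (B y *m Km y <= B y)%MS.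
Proof. by have [_ _ _ ->] := locE; rewrite BE; exact: change_invariant. Qed.

(** In charts c and d the induced structure is the restriction of the
    ambient one along the Jacobian matrix of the inclusion, a formula in
    which everything is smooth. *)
Lemma local_inducedE :
  invmx (frame c q) *m induced_metric q *m (invmx (frame c q))^T =
    restrict_metric (B y) (g y) (p y) /\
  invmx (frame c q) *m induced_complex q *m frame c q =
    restrict_complex (B y) (g y) (p y) (Kp y) (Km y).
Proof.
have [-> -> -> ->] := locE; rewrite BE.
exact: (restrict_frame (fA q) uc ud (hdM q) (AJp q) (AJm q)).
Qed.

Lemma local_ambient_data : herm_data (loc_metric S d (F y))
  (loc_complex S d (F y)) (g y) (p y) (Kp y) (Km y).
Proof. exact: (loc_herm_data S ad (rep_cod Wy)). Qed.

Lemma local_induced_data :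
  herm_data (restrict_metric (B y) (g y) (p y))
    (restrict_complex (B y) (g y) (p y) (Kp y) (Km y))
    (B y *m g y *m (B y)^T) (B y *m p y *m (B y)^T)
    (restrict_endo (B y) (g y) (Kp y)) (restrict_endo (B y) (g y) (Km y)).
Proof.
exact: (herm_data_restrict local_row_free local_ambient_data
  local_invariant_plus local_invariant_minus).
Qed.

End AtPoint.

Let oW : open W := overlap_iota_open.
Let oV : open (chart_cod d) := @chart_cod_open _ _ _ d.

Let sF : smooth_mx W F. Proof. exact: smooth_rep. Qed.
Let sB : smooth_mx W B. Proof. exact: (smooth_jacobian oW sF). Qed.
Let sBT := smooth_mx_tr oW sB.
Let sg : smooth_mx W g.
Proof. exact: (smooth_mx_comp oW oV rep_cod (smooth_loc_gam S ad) sF). Qed.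
Let sp : smooth_mx W p.
Proof. exact: (smooth_mx_comp oW oV rep_cod (smooth_loc_psi S ad) sF). Qed.
Let sKp : smooth_mx W Kp.
Proof. exact: (smooth_mx_comp oW oV rep_cod (smooth_loc_Jp S ad) sF). Qed.
Let sKm : smooth_mx W Km.
Proof. exact: (smooth_mx_comp oW oV rep_cod (smooth_loc_Jm S ad) sF). Qed.

Let sform (b : 'rV[R]_n -> 'M[R]_m) : smooth_mx W b ->
  smooth_mx W (fun y => B y *m b y *m (B y)^T).
Proof. by move=> sb; exact: (smooth_mxM oW (smooth_mxM oW sB sb) sBT). Qed.

Let uT' y : W y ->
  taus (B y *m g y *m (B y)^T) (B y *m p y *m (B y)^T) \in unitmx.
Proof.
by move=> Wy; have [eg pT _ _ _] := local_induced_data Wy; exact: taus_unit.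
Qed.

Let ug' y : W y -> B y *m g y *m (B y)^T \in unitmx.
Proof.
by move=> Wy; have [eg _ _ _ _] := local_induced_data Wy; exact: euclidean_unit.
Qed.

Let sendo (b : 'rV[R]_n -> 'M[R]_m) : smooth_mx W b ->
  smooth_mx W (fun y => restrict_endo (B y) (g y) (b y)).
Proof.
move=> sb; have si := smooth_invmx oW ug' (sform sg).
exact: (smooth_mxM oW (smooth_mxM oW (smooth_mxM oW (smooth_mxM oW sB sb) sg)
  sBT) si).
Qed.

Lemma smooth_local_metric :
  smooth_mx W (fun y => restrict_metric (B y) (g y) (p y)).
Proof. exact: (smooth_metric_of oW (sform sg) (sform sp) uT'). Qed.

Lemma smooth_local_complex :
  smooth_mx W (fun y => restrict_complex (B y) (g y) (p y) (Kp y) (Km y)).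
Proof.
exact: (smooth_endo_of oW (sform sg) (sform sp) (sendo sKp) (sendo sKm) uT').
Qed.

Lemma smooth_local_lift : smooth_mx W (fun y => lift_mx (B y) (g y) (p y)).
Proof.
have siT := smooth_invmx oW uT' (smooth_taus oW (sform sg) (sform sp)).
exact: (smooth_mxM oW (smooth_mxM oW siT (smooth_bdiag oW sB sB))
  (smooth_taus oW sg sp)).
Qed.

(** The lift satisfies the relations under which torsion is carried to
    torsion. *)
Lemma torsion_restrict (K' : 'rV[R]_n -> 'M[R]_(n + n))
    (K : 'rV[R]_m -> 'M[R]_(m + m)) x u1 u2 u3 :
  W x -> smooth_mx W K' -> smooth_mx (chart_cod d) K ->
  (forall z, chart_cod d z -> gen_complex (K z)) ->
  (forall y, W y -> K' y *m lift_mx (B y) (g y) (p y) =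
                    lift_mx (B y) (g y) (p y) *m K (F y)) ->
  (forall z v1 v2 v3, chart_cod d z -> (v1 <= i_eigenspace (K z))%MS ->
     (v2 <= i_eigenspace (K z))%MS -> (v3 <= i_eigenspace (K z))%MS ->
     torsion K z v1 v2 v3 = 0) ->
  (u1 <= i_eigenspace (K' x))%MS -> (u2 <= i_eigenspace (K' x))%MS ->
  (u3 <= i_eigenspace (K' x))%MS -> torsion K' x u1 u2 u3 = 0.
Proof.
move=> Wx sK' sK gK KL tors0 u1E u2E u3E.
have Lvec y : W y -> lift_mx (B y) (g y) (p y) *m col_mx 1%:M 0 =
    col_mx 1%:M 0 *m B y.
  move=> Wy; have [eg pT _ _ _] := local_ambient_data Wy.
  exact: (lift_vector (local_row_free Wy) eg pT).
have Lcov y : W y -> lift_mx (B y) (g y) (p y) *m col_mx 0 1%:M *m (B y)^T =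
    col_mx 0 1%:M.
  move=> Wy; have [eg pT _ _ _] := local_ambient_data Wy.
  exact: (lift_covector (local_row_free Wy) eg pT).
rewrite (torsion_lift oW oV rep_cod sF sK' sK smooth_local_lift gK KL
  Lvec Lcov Wx u1E u2E u3E).
by apply: (tors0 _ _ _ _ (rep_cod Wx));
  exact: (lift_eigen (F := F) (K := K) KL Wx).
Qed.

Lemma lift_complex y : W y ->
  restrict_complex (B y) (g y) (p y) (Kp y) (Km y)
    *m lift_mx (B y) (g y) (p y) =
  lift_mx (B y) (g y) (p y) *m loc_complex S d (F y).
Proof.
move=> Wy; have hM := local_ambient_data Wy; have hI := local_induced_data Wy.
have [eg pT _ TJ _] := hM; have [_ _ _ TJ' _] := hI.
have f := local_row_free Wy.
apply: (lift_endo f eg pT TJ TJ').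
  exact: (restrict_endoP f eg (local_invariant_plus Wy)).
exact: (restrict_endoP f eg (local_invariant_minus Wy)).
Qed.

Lemma lift_second y : W y ->
  second_gcs (restrict_metric (B y) (g y) (p y))
    (restrict_complex (B y) (g y) (p y) (Kp y) (Km y))
    *m lift_mx (B y) (g y) (p y) =
  lift_mx (B y) (g y) (p y)
    *m second_gcs (loc_metric S d (F y)) (loc_complex S d (F y)).
Proof.
move=> Wy; have hM := local_ambient_data Wy; have hI := local_induced_data Wy.
have [eg pT _ _ _] := hM; have f := local_row_free Wy.
apply: (lift_endo f eg pT (herm_data_second hM) (herm_data_second hI)).
  exact: (restrict_endoP f eg (local_invariant_plus Wy)).
rewrite mulNmx mulmxN; congr (- _).
exact: (restrict_endoP f eg (local_invariant_minus Wy)).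
Qed.

End InCharts.

Lemma induced_smoothG : smooth_form induced_metric.
Proof.
move=> c ac i j; apply: smooth_on_local => x cx.
pose q := chart_inv c x; have [ad dq] := chart_atP (iota q).
exists (overlap iota c (chart_at (iota q))); split; first by [].
have e : {in overlap iota c (chart_at (iota q)),
    (fun y => restrict_metric (jacobian (rep iota c (chart_at (iota q))) y)
       (loc_gam S (chart_at (iota q)) (rep iota c (chart_at (iota q)) y))
       (loc_psi S (chart_at (iota q)) (rep iota c (chart_at (iota q)) y))) =1
    (fun y => invmx (frame c (chart_inv c y)) *m induced_metric (chart_inv c y)
       *m (invmx (frame c (chart_inv c y)))^T)}.
  by move=> y; rewrite inE => Wy; have [-> _] := local_inducedE ac ad Wy.
have oW : open (overlap iota c (chart_at (iota q))) by exact: overlap_iota_open.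
exact: (eq_smooth_mx oW e (smooth_local_metric ac ad) i j).
Qed.

Lemma induced_smoothJ : smooth_endomorphism induced_complex.
Proof.
move=> c ac i j; apply: smooth_on_local => x cx.
pose q := chart_inv c x; have [ad dq] := chart_atP (iota q).
exists (overlap iota c (chart_at (iota q))); split; first by [].
have e : {in overlap iota c (chart_at (iota q)),
    (fun y => restrict_complex (jacobian (rep iota c (chart_at (iota q))) y)
       (loc_gam S (chart_at (iota q)) (rep iota c (chart_at (iota q)) y))
       (loc_psi S (chart_at (iota q)) (rep iota c (chart_at (iota q)) y))
       (loc_Jp S (chart_at (iota q)) (rep iota c (chart_at (iota q)) y))
       (loc_Jm S (chart_at (iota q)) (rep iota c (chart_at (iota q)) y))) =1
    (fun y => invmx (frame c (chart_inv c y)) *m induced_complex (chart_inv c y)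
       *m frame c (chart_inv c y))}.
  by move=> y; rewrite inE => Wy; have [_ ->] := local_inducedE ac ad Wy.
have oW : open (overlap iota c (chart_at (iota q))) by exact: overlap_iota_open.
exact: (eq_smooth_mx oW e (smooth_local_complex ac ad) i j).
Qed.

Definition induced_agh : almost_gen_hermitian N :=
  AlmostGenHermitian induced_smoothG induced_smoothJ induced_hermitian.

Lemma induced_L x :
  (Lplus_bundle induced_agh x :=: pullback_bundle iota (Lplus_bundle S) x)%MS /\
  (Lminus_bundle induced_agh x :=:
   pullback_bundle iota (Lminus_bundle S) x)%MS.
Proof. exact: (pullback_LE (fA x) (hdM x) (AJp x) (AJm x)). Qed.

End InducedStructure.

(** * Integrability of the induced structure *)

Section ClosedBundles.
Context {R : realType} {m : nat} {M : manifold R m}.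
Variable K : M -> 'M[R]_(m + m).

Definition loc_endo (c : chart R m M) (z : 'rV[R]_m) : 'M[R]_(m + m) :=
  let p := chart_inv c z in invmx (frame c p) *m K p *m frame c p.

Hypotheses (sK : smooth_endomorphism K)
  (gK : forall c z, atlas c -> chart_cod c z -> gen_complex (loc_endo c z)).

Definition torsion_free (c : chart R m M) : Prop := forall z u1 u2 u3,
  chart_cod c z -> (u1 <= i_eigenspace (loc_endo c z))%MS ->
  (u2 <= i_eigenspace (loc_endo c z))%MS ->
  (u3 <= i_eigenspace (loc_endo c z))%MS -> torsion (loc_endo c) z u1 u2 u3 = 0.

(** The i-eigenbundle equals its orthogonal, so a bracket is a section of it
    if and only if its products with vectors of the bundle vanish. *)
Lemma courant_closedP :
  courant_closed (fun p => i_eigenspace (K p)) <->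
  forall c, atlas c -> torsion_free c.
Proof.
split=> [cl c ac z u1 u2 u3 cz|free c ac V oV Vc s t ss st sE tE x Vx].
  have oU := @chart_cod_open _ _ _ c.
  apply: (closed_torsion oU (sK ac) (fun y cy => gK ac cy)) => //.
  move=> s t ss st sE tE x cx; rewrite -(local_i_eigen ac cx).
  apply: (cl c ac _ oU) => // y cy; rewrite (local_i_eigen ac cy).
    exact: sE.
  exact: tE.
rewrite (local_i_eigen ac (Vc x Vx)).
have sKV : smooth_mx V (loc_endo c) := smooth_mx_sub Vc (sK ac).
apply: (torsion_closed oV sKV (fun y Vy => gK ac (Vc y Vy)) _ ss st) => //.
- by move=> y u1 u2 u3 Vy; apply: free => //; exact: Vc.
- by move=> y Vy; have := sE y Vy; rewrite (local_i_eigen ac (Vc y Vy)).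
- by move=> y Vy; have := tE y Vy; rewrite (local_i_eigen ac (Vc y Vy)).
Qed.

End ClosedBundles.

Section AlmostHermitianFields.
Context {R : realType} {m : nat} {M : manifold R m}.
Variable S : almost_gen_hermitian M.

Definition second_field (p : M) := second_gcs (agh_G S p) (agh_J S p).

Lemma loc_second_field c z : atlas c -> chart_cod c z ->
  loc_endo second_field c z = second_gcs (loc_metric S c z) (loc_complex S c z).
Proof. by move=> ac cz; exact: loc_second. Qed.

Lemma smooth_second_field : smooth_endomorphism second_field.
Proof.
move=> c ac; have oU := @chart_cod_open _ _ _ c.
have sG := smooth_loc_metric S ac; have sJ := smooth_loc_complex S ac.
apply: (eq_smooth_mx oU _ (smooth_second_gcs oU sG sJ)) => z.
by rewrite inE => cz; rewrite -(loc_second_field ac cz).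
Qed.

Lemma gen_complex_loc c z : atlas c -> chart_cod c z ->
  gen_complex (loc_endo (agh_J S) c z).
Proof.
by move=> ac cz; exact: herm_data_gen_complex (loc_herm_data S ac cz).
Qed.

Lemma gen_complex_loc_second c z : atlas c -> chart_cod c z ->
  gen_complex (loc_endo second_field c z).
Proof.
move=> ac cz; rewrite (loc_second_field ac cz).
exact: herm_data_second_complex (loc_herm_data S ac cz).
Qed.

Lemma gen_kahlerP : gen_kahler S <->
  forall c, atlas c -> torsion_free (agh_J S) c /\ torsion_free second_field c.
Proof.
have c1 := courant_closedP (agh_smoothJ S) gen_complex_loc.
have c2 := courant_closedP smooth_second_field gen_complex_loc_second.
split=> [[/c1 k1 /c2 k2] c ac|k].
  by split; [exact: k1 | exact: k2].
by split; [apply/c1 | apply/c2] => c ac; have [] := k c ac.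
Qed.

End AlmostHermitianFields.

Section Restriction.
Context {R : realType} {n m : nat} {N : manifold R n} {M : manifold R m}.
Variables (S : almost_gen_hermitian M) (iota : N -> M).
Hypothesis hN : submanifold iota.

Lemma invariant_of_decomposition :
  gen_almost_hermitian_submanifold S iota ->
  complex_submanifold (fun p => Jplus (agh_G S p) (agh_J S p)) iota /\
  complex_submanifold (fun p => Jminus (agh_G S p) (agh_J S p)) iota.
Proof.
case=> dec _ _; have [_ _ fA] := hN.
have inv x := decomposition_invariant (fA x)
  (gen_hermitian_data (agh_hermitian S (iota x))) (dec x).
by split=> x; have [] := inv x.
Qed.

Hypotheses
  (Ap : forall x, (tangent_map iota x
     *m Jplus (agh_G S (iota x)) (agh_J S (iota x)) <= tangent_map iota x)%MS)
  (Am : forall x, (tangent_map iota x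
     *m Jminus (agh_G S (iota x)) (agh_J S (iota x)) <= tangent_map iota x)%MS).
Let SN := induced_agh hN Ap Am.

(** The same argument serves both structures, as the lift intertwines each
    of them with its ambient counterpart. *)
Lemma induced_kahler : gen_kahler S -> gen_kahler SN.
Proof.
move=> /gen_kahlerP kS; apply/gen_kahlerP => c ac.
have key (K' : N -> 'M[R]_(n + n)) (K : M -> 'M[R]_(m + m)) :
    smooth_endomorphism K' -> smooth_endomorphism K ->
    (forall d z, atlas d -> chart_cod d z -> gen_complex (loc_endo K d z)) ->
    (forall d, atlas d -> torsion_free K d) ->
    (forall d y, atlas d -> overlap iota c d y ->
       let L := lift_mx (jacobian (rep iota c d) y)
         (loc_gam S d (rep iota c d y)) (loc_psi S d (rep iota c d y)) in
       loc_endo K' c y *m L = L *m loc_endo K d (rep iota c d y)) ->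
    torsion_free K' c.
  move=> sK' sK gK fK KL z u1 u2 u3 cz.
  pose q := chart_inv c z; have [ad dq] := chart_atP (iota q).
  set d := chart_at (iota q) in ad dq.
  have Wz : overlap iota c d z by [].
  have sK'W : smooth_mx (overlap iota c d) (loc_endo K' c).
    by apply: smooth_mx_sub (sK' c ac); exact: subIsetl.
  apply: (torsion_restrict hN Ap Am ac ad Wz sK'W (sK d ad)).
  - by move=> y dy; exact: gK.
  - by move=> y Wy; exact: KL.
  - by move=> y v1 v2 v3; exact: fK.
have indJ d y : atlas d -> overlap iota c d y ->
    loc_endo (agh_J SN) c y = _ :=
  fun ad Wy => (local_inducedE hN Ap Am ac ad Wy).2.
have indG d y : atlas d -> overlap iota c d y -> loc_metric SN c y = _ :=
  fun ad Wy => (local_inducedE hN Ap Am ac ad Wy).1.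
split.
  apply: (key _ (agh_J S) (agh_smoothJ SN) (agh_smoothJ S)).
  - exact: gen_complex_loc.
  - by move=> d ad; have [] := kS d ad.
  - move=> d y ad Wy L; rewrite (indJ d y ad Wy).
    exact: (lift_complex hN Ap Am).
apply: (key _ (second_field S) (smooth_second_field SN)
  (smooth_second_field S)).
- exact: gen_complex_loc_second.
- by move=> d ad; have [] := kS d ad.
- move=> d y ad Wy L; have [cy dy] := Wy.
  rewrite (loc_second_field SN ac cy) (indG d y ad Wy).
  rewrite -[loc_complex SN c y]/(loc_endo (agh_J SN) c y) (indJ d y ad Wy).
  rewrite (loc_second_field S ad (chart_funP dy)).
  exact: (lift_second hN Ap Am).
Qed.

Lemma kahler_submanifold_of_invariant : gen_kahler S ->
  gen_kahler_submanifold S iota.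
Proof.
move=> kS; have indL x := induced_L hN Ap Am x.
split; last by exists SN; split; [exact: indL | exact: induced_kahler].
split=> [x| |].
- have [ep em] := indL x; apply: eqmx_decomposition ep em _.
  exact: herm_data_decomposition (gen_hermitian_data (agh_hermitian SN x)).
- apply: eqmx_smooth_subbundle (smooth_Lplus_bundle SN) => x.
  exact: (indL x).1.
- apply: eqmx_smooth_subbundle (smooth_Lminus_bundle SN) => x.
  exact: (indL x).2.
Qed.

End Restriction.

Theorem proposition4p8 (R : realType) (m n : nat)
    (M : manifold R m) (S : almost_gen_hermitian M) (hS : gen_kahler S)
    (N : manifold R n) (iota : N -> M) (hN : submanifold iota) :
  gen_kahler_submanifold S iota <->
  complex_submanifold (fun p => Jplus (agh_G S p) (agh_J S p)) iota /\
  complex_submanifold (fun p => Jminus (agh_G S p) (agh_J S p)) iota.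
Proof.
split=> [[/(invariant_of_decomposition hN)]//|[Jp Jm]].
apply: kahler_submanifold_of_invariant => // x.
  by rewrite Jp.
by rewrite Jm.
Qed.
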